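(* Let $A$ be a Barbasch–Sahi algebra over a field $\mathbb{F}$ of characteristic $0$, with underlying pointed cocommutative Hopf algebra $H$, orthogonal module $V$, Clifford algebra $C=C(V)$, Dirac element $D\in A\otimes C$, pin cover $(\tilde H,\pi,\gamma)$, diagonal map $\Delta_C$ and $H'=\tilde H/\ker\Delta_C$. Let $z$ be an element in the center of $A$. Then there is an element $a\in(A\otimes C)_{\mathrm{det}}^{\mathrm{odd}}$ and a uniquely determined element $\zeta(z)\in Z(H')$ such that $$z\otimes1=\Delta_C(\zeta(z))+Da+aD.$$ Moreover, the map $\zeta:Z(A)\to Z(H')$ is an algebra homomorphism.
   Context: All vector spaces and tensor products are over a field $\mathbb{F}$ of characteristic $0$; modules are left modules; $Z(\cdot)$ denotes the center. Hopf–Hecke algebras. Let $H$ be a cocommutative Hopf algebra with counit $\varepsilon$, coproduct $\Delta(h)=h_{(1)}\otimes h_{(2)}$ (Sweedler notation) and antipode $S$. Let $V$ be a finite-dimensional orthogonal $H$-module, i.e. $V$ carries a (fixed) non-degenerate symmetric bilinear form $\langle\cdot,\cdot\rangle$ with $\langle h_{(1)}\cdot v,h_{(2)}\cdot w\rangle=\varepsilon(h)\langle v,w\rangle$ for all $h\in H$, $v,w\in V$. Let $T(V)\rtimes H$ be the smash product, the algebra generated by $T(V)$ and $H$ with relations $hv=(h_{(1)}\cdot v)h_{(2)}$. Let $\kappa:V\wedge V\to H$ be linear, let $I_\kappa$ be the ideal generated by all $vw-wv-\kappa(v\wedge w)$, $v,w\in V$, and $A=(T(V)\rtimes H)/I_\kappa$.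 $A$ is called a Hopf–Hecke algebra if it has the PBW property: the natural surjection from $S(V)\rtimes H$ to the associated graded algebra of $A$ (for the filtration coming from $T(V)$) is an isomorphism. Let $C=C(V)$ be the quotient of $T(V)$ by the ideal generated by all $vw+wv-2\langle v,w\rangle$; it has its usual $\mathbb{Z}_2$-gradation, with $V$ odd, and $A\otimes C$ inherits a $\mathbb{Z}_2$-gradation from $C$. The Dirac element is $D=\sum_i v_i\otimes v^i\in A\otimes C$ for any pair $(v_i)_i,(v^i)_i$ of dual bases of $V$ with respect to $\langle\cdot,\cdot\rangle$. Pin cover. Assume $H$ is pointed (every simple subcoalgebra is one-dimensional). Let $G=G(H)$ be the group of group-like elements and $L=P(H)$ the Lie algebra of primitive elements, so $H=\mathcal{U}(L)\rtimes\mathbb{F}[G]$. The algebra $H$ is $\mathbb{Z}_2$-graded by $(-1)^{|g|}=\det(g|_V)$ for $g\in G$ and $(-1)^{|x|}=1$ for $x\in L$. The pin cover of $H$ with respect to $V$ is a triple $(\tilde H,\pi,\gamma)$ where $\tilde H$ is a pointed cocommutative Hopf algebra, $\pi:\tilde H\to H$ is a Hopf algebra epimorphism and $\gamma:\tilde H\to C$ is an algebra map, such that: $(\tilde H,\pi)$ is a double cover of $H$ ($\tilde H\cong H\oplus H$ as coalgebras and $\pi$ restricts to a coalgebra isomorphism on each copy of $H$); $\gamma$ preserves the $\mathbb{Z}_2$-gradation (where $\tilde H$ is graded by the same recipe as $H$, using that $V$ is an orthogonal $\tilde H$-module via $\pi$); and $(-1)^{|\tilde h|}\pi(\tilde h)\cdot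 v=\gamma(\tilde h_{(1)})\,v\,\gamma(S\tilde h_{(2)})$ in $C$ for all homogeneous $\tilde h\in\tilde H$, $v\in V$. Concretely, $\tilde H=\mathcal{U}(L)\rtimes\mathbb{F}[\tilde G]$, where $\tilde G$, $\pi|_{\tilde G}:\tilde G\to G$ and $\gamma|_{\tilde G}:\tilde G\to\mathrm{Pin}(V)$ form the pullback of $G\to O(V)$ and the map $\mathrm{Pin}(V)\to O(V)$ sending a unit vector $v$ to the reflection $\tau_v$ ($\mathrm{Pin}(V)\subset C^\times$ is the subgroup generated by all $v\in V$ with $\langle v,v\rangle=1$), $\tilde G$ acts on $L$ via $G$, $\pi|_L=\mathrm{id}$, and $\gamma|_L$ maps $x\in L$ to the unique element $\gamma(x)$ in the span of the elements $vw-wv$ with $[\gamma(x),u]=x\cdot u$ for all $u\in V$. The diagonal map is the algebra map $\Delta_C:\tilde H\to H\otimes C\subset A\otimes C$, $\Delta_C(\tilde h)=\pi(\tilde h_{(1)})\otimes\gamma(\tilde h_{(2)})$, and $H':=\tilde H/\ker\Delta_C$; the induced injective map $H'\to A\otimes C$ is also denoted $\Delta_C$. $D^2$ satisfies the Parthasarathy condition if $D^2\in Z(A\otimes C)+\Delta_C(\tilde H^{\mathrm{even}})$; a Hopf–Hecke algebra whose Dirac element satisfies it is called a Barbasch–Sahi algebra. $\tilde H$ acts on $A\otimes C$ by $\tilde h\cdot x=\Delta_C(\tilde h_{(1)})\,x\,\Delta_C(S\tilde h_{(2)})$. $(A\otimes C)_{\mathrm{det}}$ is the subspace on which every homogeneous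 $\tilde h\in\tilde H$ acts as $(-1)^{|\tilde h|}\varepsilon(\tilde h)$, and $(A\otimes C)_{\mathrm{det}}^{\mathrm{odd}}$ consists of its odd elements. *)

(* Defs.v *)
Set Warnings "-redundant-canonical-projection,-notation-overridden".
Set Warnings "-ambiguous-paths,-notation-incompatible-prefix".
Set Warnings "-projection-no-head-constant".
From HB Require Import structures.
From mathcomp Require Import all_boot all_order all_algebra.
From mathcomp Require Import mathcomp_extra boolp classical_sets.
From mathcomp Require Import finmap monalg.

Set Implicit Arguments.
Unset Strict Implicit.
Unset Printing Implicit Defensive.

Import GRing.Theory.
Local Open Scope ring_scope.
Local Open Scope classical_set_scope.
Local Open Scope quotient_scope.


(* The library's algType requires 1 != 0, which cannot be asserted a priori of
   an algebra presented by generators and relations. A pzAlgType is an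
   associative unital algebra in which 1 = 0 is not excluded. *)
HB.mixin Record PzRing_isPzAlgebra (R : pzRingType) A of GRing.PzRing A := {
  pzscale : R -> A -> A;
  pzscaleA : forall a b x, pzscale a (pzscale b x) = pzscale (a * b) x;
  pzscale0 : forall x, pzscale 0 x = 0;
  pzscale1 : left_id 1 pzscale;
  pzscaleDr : right_distributive pzscale +%R;
  pzscaleDl : forall x, {morph pzscale^~ x : a b / a + b};
  pzscaleAl : forall a (x y : A), pzscale a (x * y) = pzscale a x * y;
  pzscaleAr : forall a (x y : A), pzscale a (x * y) = x * pzscale a y
}.

#[short(type="pzAlgType")]
HB.structure Definition PzAlgebra (R : pzRingType) :=
  {A of GRing.PzRing A & PzRing_isPzAlgebra R A}.

#[non_forgetful_inheritance]
HB.instance Definition _ (R : pzRingType) (A : pzAlgType R) :=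
  GRing.Nmodule_isLSemiModule.Build R (PzAlgebra.sort A)
    (@pzscaleA R A) (@pzscale0 R A) (@pzscale1 R A)
    (@pzscaleDr R A) (@pzscaleDl R A).

Lemma pzscalerAl (R : pzRingType) (A : pzAlgType R) (a : R) (x y : A) :
  a *: (x * y) = (a *: x) * y.
Proof. exact: pzscaleAl. Qed.

Lemma pzscalerAr (R : pzRingType) (A : pzAlgType R) (a : R) (x y : A) :
  a *: (x * y) = x * (a *: y).
Proof. exact: pzscaleAr. Qed.

HB.mixin Record RMorphism_isPzAlgHom (R : pzRingType) (A : pzAlgType R)
    (B : pzRingType) (s : R -> B -> B) (f : A -> B) := {
  alghomZ : scalable_for s f
}.

HB.structure Definition PzAlgHom (R : pzRingType) (A : pzAlgType R)
    (B : pzRingType) (s : R -> B -> B) :=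
  {f of @GRing.RMorphism A B f & RMorphism_isPzAlgHom R A B s f}.

#[non_forgetful_inheritance]
HB.instance Definition _ (R : pzRingType) (A : pzAlgType R) (B : pzRingType)
    (s : R -> B -> B) (f : @PzAlgHom.type R A B s) :=
  GRing.isScalable.Build R A B s (PzAlgHom.sort f) (@alghomZ R A B s f).

Notation "{ 'alghom' A -> B | s }" := (@PzAlgHom.type _ A%type B%type s)
  (at level 0, A at level 98, B at level 99,
   format "{ 'alghom'  A  ->  B  |  s }") : type_scope.
Notation "{ 'alghom' A -> B }" := {alghom A -> B | *:%R}
  (at level 0, A at level 98, B at level 99,
   format "{ 'alghom'  A  ->  B }") : type_scope.

Section Subspaces.
Variables (F : fieldType) (V : lmodType F).

Definition subspace (S : set V) : Prop :=
  S 0 /\ forall (a : F) x y, S x -> S y -> S (a *: x + y).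

Definition linspan (X : set V) : set V :=
  [set v | forall S, subspace S -> X `<=` S -> S v].

Lemma sub_span (X : set V) : X `<=` linspan X.
Proof. by move=> x Xx S _ /(_ x Xx). Qed.

Lemma span_subspace (X : set V) : subspace (linspan X).
Proof.
split=> [S [S0 _] _|a x y Xx Xy S sS XS]; first exact: S0.
exact: sS.2 (Xx _ sS XS) (Xy _ sS XS).
Qed.

Lemma span_min (X S : set V) : subspace S -> X `<=` S -> linspan X `<=` S.
Proof. by move=> sS XS v /(_ S sS XS). Qed.

Lemma subspace0 (S : set V) : subspace S -> S 0.
Proof. by move=> []. Qed.

Lemma subspaceD (S : set V) x y : subspace S -> S x -> S y -> S (x + y).
Proof. by move=> [_ sS] Sx Sy; rewrite -[x]scale1r; apply: sS. Qed.

Lemma subspaceZ (S : set V) a x : subspace S -> S x -> S (a *: x).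
Proof. by move=> [S0 sS] Sx; rewrite -[_ *: _]addr0; apply: sS. Qed.

Lemma subspaceN (S : set V) x : subspace S -> S x -> S (- x).
Proof. by move=> sS Sx; rewrite -scaleN1r; apply: subspaceZ. Qed.

Lemma subspaceB (S : set V) x y : subspace S -> S x -> S y -> S (x - y).
Proof. by move=> sS Sx Sy; apply: subspaceD => //; apply: subspaceN. Qed.

End Subspaces.

(* Quotient of a vector space by the span of a subset. *)
Section QuotientSpace.
Variables (F : fieldType) (V : lmodType F) (X : set V).

Definition qrel : rel V := fun x y => `[< linspan X (x - y) >].

Lemma qrel_equiv : equiv_class_of qrel.
Proof.
have sX := span_subspace X; split=> [x|x y|y x z].
- by apply/asboolP; rewrite subrr; apply: subspace0.
- by apply/asboolP/asboolP => /(subspaceN sX); rewrite opprB.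
- move=> /asboolP xy /asboolP yz; apply/asboolP.
  by rewrite -[x](subrK y) -addrA; exact: subspaceD xy yz.
Qed.

Canonical qrel_equiv_rel := EquivRelPack qrel_equiv.

Definition quotspace : Type := {eq_quot qrel_equiv_rel}.

HB.instance Definition _ := Choice.on quotspace.
HB.instance Definition _ := EqQuotient.on quotspace.

End QuotientSpace.

(* The operations on quotients and on tensor products are locked: unification
   would otherwise unfold them down to the choice of representatives. *)
HB.lock Definition qproj (F : fieldType) (V : lmodType F) (X : set V) (x : V) :
  quotspace X := \pi_(quotspace X) x.
HB.lock Definition qadd (F : fieldType) (V : lmodType F) (X : set V)
  (u v : quotspace X) : quotspace X := qproj X (repr u + repr v).
HB.lock Definition qopp (F : fieldType) (V : lmodType F) (X : set V)
  (u : quotspace X) : quotspace X := qproj X (- repr u).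
HB.lock Definition qscale (F : fieldType) (V : lmodType F) (X : set V)
  (a : F) (u : quotspace X) : quotspace X := qproj X (a *: repr u).

Section QuotientSpaceTheory.
Variables (F : fieldType) (V : lmodType F) (X : set V).
Local Notation quotspace := (quotspace X).
Local Notation qproj := (qproj X).
Local Notation qadd := (@qadd F V X).
Local Notation qopp := (@qopp F V X).
Local Notation qscale := (@qscale F V X).

Lemma qprojP x y : qproj x = qproj y <-> linspan X (x - y).
Proof.
by rewrite qproj.unlock; split=> [/eqmodP/asboolP//|xy]; apply/eqmodP/asboolP.
Qed.

Lemma qproj_repr (u : quotspace) : qproj (repr u) = u.
Proof. by rewrite qproj.unlock reprK. Qed.

Lemma qproj_surj (u : quotspace) : exists x, u = qproj x.
Proof. by exists (repr u); rewrite qproj_repr. Qed.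

Lemma span_repr x : linspan X (repr (qproj x) - x).
Proof. by apply/qprojP; rewrite qproj_repr. Qed.

Lemma qaddE x y : qadd (qproj x) (qproj y) = qproj (x + y).
Proof.
rewrite qadd.unlock; apply/qprojP; rewrite opprD addrACA.
by apply: subspaceD (span_subspace X) _ _; apply: span_repr.
Qed.

Lemma qoppE x : qopp (qproj x) = qproj (- x).
Proof.
rewrite qopp.unlock; apply/qprojP.
rewrite opprK addrC -[X in X - _]opprK -opprD.
by apply: subspaceN (span_subspace X) _; rewrite addrC; apply: span_repr.
Qed.

Lemma qscaleE a x : qscale a (qproj x) = qproj (a *: x).
Proof.
rewrite qscale.unlock; apply/qprojP; rewrite -scalerBr.
by apply: subspaceZ (span_subspace X) _; apply: span_repr.
Qed.

Fact qaddA : associative qadd.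
Proof.
move=> u v w; have [x ->] := qproj_surj u; have [y ->] := qproj_surj v.
by have [z ->] := qproj_surj w; rewrite !qaddE addrA.
Qed.

Fact qaddC : commutative qadd.
Proof. by move=> u v; rewrite qadd.unlock addrC. Qed.

Fact qadd0 : left_id (qproj 0) qadd.
Proof. by move=> u; have [x ->] := qproj_surj u; rewrite qaddE add0r. Qed.

Fact qaddN : left_inverse (qproj 0) qopp qadd.
Proof. by move=> u; have [x ->] := qproj_surj u; rewrite qoppE qaddE addNr. Qed.

HB.instance Definition _ :=
  GRing.isZmodule.Build quotspace qaddA qaddC qadd0 qaddN.

Fact qscaleA a b u : qscale a (qscale b u) = qscale (a * b) u.
Proof. by have [x ->] := qproj_surj u; rewrite !qscaleE scalerA. Qed.

Fact qscale1 : left_id 1 qscale.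
Proof. by move=> u; have [x ->] := qproj_surj u; rewrite qscaleE scale1r. Qed.

Fact qscaleDr : right_distributive qscale +%R.
Proof.
move=> a u v; have [x ->] := qproj_surj u; have [y ->] := qproj_surj v.
by rewrite [_ + _]qaddE !qscaleE scalerDr -qaddE.
Qed.

Fact qscaleDl u : {morph qscale^~ u : a b / a + b}.
Proof.
by move=> a b; have [x ->] := qproj_surj u; rewrite !qscaleE scalerDl -qaddE.
Qed.

HB.instance Definition _ := GRing.Zmodule_isLmodule.Build F quotspace
  qscaleA qscale1 qscaleDr qscaleDl.

Fact qproj_linear : linear qproj.
Proof. by move=> a x y; rewrite -qaddE -qscaleE. Qed.

HB.instance Definition _ := GRing.isLinear.Build F V quotspace _ qproj
  qproj_linear.

End QuotientSpaceTheory.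

Section QuotientAlgebra.
Variables (F : fieldType) (A : pzAlgType F) (X : set A).

Definition two_sided_ideal (I : set A) : Prop :=
  subspace I /\ forall a x, I x -> I (a * x) /\ I (x * a).

Definition gen_ideal : set A :=
  [set x | forall I, two_sided_ideal I -> X `<=` I -> I x].

Lemma sub_ideal : X `<=` gen_ideal.
Proof. by move=> x Xx I _ /(_ x Xx). Qed.

Lemma ideal_two_sided : two_sided_ideal gen_ideal.
Proof.
split; first split.
- by move=> I [[I0 _] _] _.
- by move=> a x y Ix Iy I II XI; exact: II.1.2 (Ix _ II XI) (Iy _ II XI).
- by move=> a x Ix; split=> I II XI; have [] := II.2 a x (Ix _ II XI).
Qed.

Lemma ideal_min (I : set A) : two_sided_ideal I -> X `<=` I -> gen_ideal `<=` I.
Proof. by move=> II XI x /(_ I II XI). Qed.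

Definition quotalg : Type := quotspace gen_ideal.

HB.instance Definition _ := GRing.Lmodule.on quotalg.
HB.instance Definition _ := EqQuotient.on quotalg.

Definition qalg (x : A) : quotalg := qproj gen_ideal x.

Lemma qalgP x y : qalg x = qalg y <-> gen_ideal (x - y).
Proof.
split=> [/qprojP|xy]; last by apply/qprojP; apply: sub_span xy.
exact: (span_min ideal_two_sided.1 (@subset_refl _ _)).
Qed.

Lemma qalg_repr (u : quotalg) : qalg (repr u) = u.
Proof. exact: qproj_repr. Qed.

Lemma qalg_surj (u : quotalg) : exists x, u = qalg x.
Proof. by exists (repr u); rewrite qalg_repr. Qed.


End QuotientAlgebra.

HB.lock Definition qmul (F : fieldType) (A : pzAlgType F) (X : set A)
  (u v : quotalg X) : quotalg X := qalg X (repr u * repr v).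

Section QuotientAlgebraTheory.
Variables (F : fieldType) (A : pzAlgType F) (X : set A).
Local Notation gen_ideal := (gen_ideal X).
Local Notation quotalg := (quotalg X).
Local Notation qalg := (qalg X).
Local Notation qmul := (@qmul F A X).

Lemma qmulE x y : qmul (qalg x) (qalg y) = qalg (x * y).
Proof.
have [sI mI] := ideal_two_sided X.
have rI z : gen_ideal (repr (qalg z) - z) by apply/qalgP; rewrite qalg_repr.
rewrite qmul.unlock; apply/qalgP.
rewrite -(subrK (x * repr (qalg y)) (_ * _)) -addrA.
rewrite -mulrBl -mulrBr; apply: subspaceD sI _ _.
  by have [] := mI (repr (qalg y)) _ (rI x).
by have [] := mI x _ (rI y).
Qed.

Lemma qalgD x y : qalg (x + y) = qalg x + qalg y.
Proof. exact: (raddfD (qproj gen_ideal)). Qed.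

Fact qmulA : associative qmul.
Proof.
move=> u v w; have [x ->] := @qalg_surj _ _ X u; have [y ->] := @qalg_surj _ _ X v.
by have [z ->] := @qalg_surj _ _ X w; rewrite !qmulE mulrA.
Qed.

Fact qmul1l : left_id (qalg 1) qmul.
Proof. by move=> u; have [x ->] := @qalg_surj _ _ X u; rewrite qmulE mul1r. Qed.

Fact qmul1r : right_id (qalg 1) qmul.
Proof. by move=> u; have [x ->] := @qalg_surj _ _ X u; rewrite qmulE mulr1. Qed.

Fact qmulDl : left_distributive qmul +%R.
Proof.
move=> u v w; have [x ->] := @qalg_surj _ _ X u; have [y ->] := @qalg_surj _ _ X v.
by have [z ->] := @qalg_surj _ _ X w; rewrite -qalgD !qmulE mulrDl qalgD.
Qed.

Fact qmulDr : right_distributive qmul +%R.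
Proof.
move=> u v w; have [x ->] := @qalg_surj _ _ X u; have [y ->] := @qalg_surj _ _ X v.
by have [z ->] := @qalg_surj _ _ X w; rewrite -qalgD !qmulE mulrDr qalgD.
Qed.

HB.instance Definition _ := GRing.Zmodule_isPzRing.Build quotalg
  qmulA qmul1l qmul1r qmulDl qmulDr.

Lemma qalgM x y : qalg (x * y) = qalg x * qalg y.
Proof. by rewrite -qmulE. Qed.

Lemma qalgZ a x : qalg (a *: x) = a *: qalg x.
Proof. exact: (linearZ_LR (qproj gen_ideal)). Qed.

Fact qalg_scaleAl (a : F) (u v : quotalg) : a *: (u * v) = (a *: u) * v.
Proof.
have [x ->] := @qalg_surj _ _ X u; have [y ->] := @qalg_surj _ _ X v.
by rewrite -qalgM -!qalgZ -qalgM pzscalerAl.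
Qed.

Fact qalg_scaleAr (a : F) (u v : quotalg) : a *: (u * v) = u * (a *: v).
Proof.
have [x ->] := @qalg_surj _ _ X u; have [y ->] := @qalg_surj _ _ X v.
by rewrite -qalgM -!qalgZ -qalgM pzscalerAr.
Qed.

HB.instance Definition _ := PzRing_isPzAlgebra.Build F quotalg
  (@scalerA F quotalg) (@scale0r F quotalg) (@scale1r F quotalg)
  (@scalerDr F quotalg) (@scalerDl F quotalg) qalg_scaleAl qalg_scaleAr.

Fact qalg_zmod_morphism : zmod_morphism qalg.
Proof. exact: (raddfB (qproj gen_ideal)). Qed.

Fact qalg_monoid_morphism : monoid_morphism qalg.
Proof. by split=> // x y; apply: qalgM. Qed.

Fact qalg_scalable : scalable qalg.
Proof. exact: qalgZ. Qed.

HB.instance Definition _ :=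
  GRing.isZmodMorphism.Build A quotalg qalg qalg_zmod_morphism.
HB.instance Definition _ :=
  GRing.isMonoidMorphism.Build A quotalg qalg qalg_monoid_morphism.
HB.instance Definition _ :=
  RMorphism_isPzAlgHom.Build F A quotalg *:%R qalg qalg_scalable.
HB.instance Definition _ :=
  GRing.isScalable.Build F A quotalg *:%R qalg qalg_scalable.

End QuotientAlgebraTheory.

(* The tensor product: the free vector space on U * V modulo bilinearity. *)
Section TensorProduct.
Variables (F : fieldType) (U V : lmodType F).

Definition tensor_rel : set {malg F[(U * V)%type]} :=
  [set r | (exists a u u' v,
              r = << (a *: u + u', v) >> - (a *: << (u, v) >> + << (u', v) >>))
        \/ (exists a u v v',
              r = << (u, a *: v + v') >> - (a *: << (u, v) >> + << (u, v') >>))].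

Definition tensor : Type := quotspace tensor_rel.

HB.instance Definition _ := GRing.Lmodule.on tensor.
HB.instance Definition _ := EqQuotient.on tensor.

End TensorProduct.

HB.lock Definition tens (F : fieldType) (U V : lmodType F) (u : U) (v : V) :
  tensor U V := qproj (@tensor_rel F U V) << (u, v) >>.

Notation "U ⊗ V" := (tensor U V) (at level 40, left associativity) : type_scope.
Notation "u ⊗ v" := (tens u v) (at level 40, left associativity) : ring_scope.

Definition free_lift (F : fieldType) (U V W : lmodType F) (f : U -> V -> W)
    (x : {malg F[(U * V)%type]}) : W :=
  \sum_(k <- msupp x) x@_k *: f k.1 k.2.

(* [tlift^~ f] is the linear map on U ⊗ V induced by a bilinear f; when f is
   not bilinear its values depend on the choice of representatives. *)
HB.lock Definition tlift (F : fieldType) (U V W : lmodType F) (t : U ⊗ V)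
  (f : U -> V -> W) : W := free_lift f (repr t).

Notation "'\tsum_' ( a , b <- t ) E" := (tlift t (fun a b => E))
  (at level 41, a name, b name, t at level 100, E at level 41,
   format "'\tsum_' ( a ,  b  <-  t )  E") : ring_scope.

Section TensorLift.
Variables (F : fieldType) (U V W : lmodType F).

Definition bilin (f : U -> V -> W) : Prop :=
  (forall v, linear (f^~ v)) /\ (forall u, linear (f u)).

Lemma free_liftE (f : U -> V -> W) (d : {fset (U * V)%type}) x :
  (msupp x `<=` d)%fset ->
  free_lift f x = \sum_(k <- d) x@_k *: f k.1 k.2.
Proof.
move=> le; rewrite /free_lift; apply: big_fset_incl => // k _ /mcoeff_outdom ->.
exact: scale0r.
Qed.

Lemma free_lift_linear (f : U -> V -> W) : linear (free_lift f).
Proof.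
move=> a x y.
have le z : (z = x \/ z = y) -> (msupp z `<=` msupp x `|` msupp y)%fset.
  by case=> ->; rewrite ?fsubsetUl ?fsubsetUr.
rewrite (free_liftE f (le _ (or_introl erefl))).
rewrite (free_liftE f (le _ (or_intror erefl))).
rewrite (@free_liftE f (msupp x `|` msupp y)%fset); last first.
  apply: fsubset_trans (msuppD_le _ _) _.
  by apply: fsetUSS (msuppZ_le _ _) _.
rewrite scaler_sumr -big_split /=; apply: eq_bigr => k _.
by rewrite mcoeffD mcoeffZ scalerDl scalerA.
Qed.

Lemma free_liftU (f : U -> V -> W) u v : free_lift f << (u, v) >> = f u v.
Proof.
by rewrite (free_liftE f (msuppU_le)) big_seq_fset1 mcoeffUU scale1r.
Qed.

Lemma free_lift_rel (f : U -> V -> W) x y :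
  bilin f -> linspan (@tensor_rel F U V) (x - y) ->
  free_lift f x = free_lift f y.
Proof.
move=> [fl fr] xy.
pose lf := GRing.isLinear.Build F _ W _ (free_lift f) (@free_lift_linear f).
pose L : {linear {malg F[(U * V)%type]} -> W} := HB.pack (free_lift f) lf.
suff: L (x - y) = 0 by rewrite linearB => /eqP; rewrite subr_eq0 => /eqP.
apply: (xy [set z | L z = 0]) => [|z].
  split=> [|a z t /= z0 t0]; first exact: linear0.
  by rewrite free_lift_linear z0 t0 scaler0 addr0.
have Lrel a p q r : L << p >> = a *: L << q >> + L << r >> ->
    L (<< p >> - (a *: << q >> + << r >>)) = 0.
  by move=> e; rewrite linearB [L (_ *: _ + _)]linearP e subrr.
by case=> -[a [u [u' [v ->]]]]; apply: Lrel; rewrite /= !free_liftU;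
  [exact: fl|exact: fr].
Qed.

Lemma tliftE (f : U -> V -> W) u v : bilin f -> tlift (u ⊗ v) f = f u v.
Proof.
move=> bf; rewrite tlift.unlock tens.unlock -(free_liftU f).
by apply: free_lift_rel => //; apply: span_repr.
Qed.

Lemma tlift_linear (f : U -> V -> W) :
  bilin f -> linear (fun t : U ⊗ V => tlift t f).
Proof.
move=> bf a s t; rewrite tlift.unlock -free_lift_linear.
apply: free_lift_rel => //.
have reprE (z : U ⊗ V) : qproj (@tensor_rel F U V) (repr z) = z.
  exact: qproj_repr.
by apply/qprojP; rewrite reprE linearP /= !reprE.
Qed.

End TensorLift.

Section TensorTheory.
Variables (F : fieldType) (U V : lmodType F).

Lemma tens_bilin : bilin (@tens F U V).
Proof.
rewrite tens.unlock; pose p := qproj (@tensor_rel F U V).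
split=> [v a u u'|u a v v'].
  transitivity (p (a *: << (u, v) >> + << (u', v) >>)); last exact: linearP.
  by apply/qprojP; apply: sub_span; left; exists a, u, u', v.
transitivity (p (a *: << (u, v) >> + << (u, v') >>)); last exact: linearP.
by apply/qprojP; apply: sub_span; right; exists a, u, v, v'.
Qed.

Lemma tensor_ind (P : U ⊗ V -> Prop) :
  P 0 -> (forall a u v t, P t -> P (a *: (u ⊗ v) + t)) -> forall t, P t.
Proof.
move=> P0 PD t.
have -> : t = \sum_(k <- msupp (repr t)) (repr t)@_k *: (k.1 ⊗ k.2).
  pose p := qproj (@tensor_rel F U V).
  transitivity (p (repr t)); first by rewrite [RHS]qproj_repr.
  rewrite [X in p X]monalgE [LHS](linear_sum p); apply: eq_bigr => -[u v] _ /=.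
  have -> c : << c *g (u, v) >> = c *: << (u, v) >> :> {malg F[(U * V)%type]}.
    by apply/malgP => k; rewrite mcoeffZ !mcoeffU mulr_natr.
  by rewrite tens.unlock; exact: linearZ.
by elim/big_rec: _ => // -[u v] s _; apply: PD.
Qed.

End TensorTheory.
(* The algebra structure (a ⊗ b) (c ⊗ d) = a c ⊗ b d on a tensor product. *)
HB.lock Definition tmul (F : fieldType) (A B : pzAlgType F) (s t : A ⊗ B) :
  A ⊗ B := \tsum_(a, b <- s) \tsum_(c, d <- t) (a * c) ⊗ (b * d).

Section TensorAlgebraStructure.
Variables (F : fieldType) (A B : pzAlgType F).

Lemma tlift_comb (U V W : lmodType F) (f g : U -> V -> W) a t :
  \tsum_(u, v <- t) (a *: f u v + g u v) = a *: tlift t f + tlift t g.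
Proof.
rewrite tlift.unlock /free_lift scaler_sumr -big_split /=.
apply: eq_bigr => k _.
by rewrite scalerDr !scalerA mulrC.
Qed.

Lemma eq_tlift (U V W : lmodType F) (f g : U -> V -> W) t :
  (forall u v, f u v = g u v) -> tlift t f = tlift t g.
Proof. by move=> fg; rewrite tlift.unlock; apply: eq_bigr => k _; rewrite fg. Qed.

Local Notation tmul := (@tmul F A B).

Let tensl (v : B) : linear (fun u : A => u ⊗ v) := (@tens_bilin F A B).1 v.
Let tensr (u : A) : linear (fun v : B => u ⊗ v) := (@tens_bilin F A B).2 u.

Lemma tmul_bilin_in a b : bilin (fun (c : A) (d : B) => (a * c) ⊗ (b * d)).
Proof.
split=> [d k c c'|c k d d'].
  by rewrite mulrDr -pzscalerAr tensl.
by rewrite mulrDr -pzscalerAr tensr.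
Qed.

Lemma tmul_bilin_out t :
  bilin (fun (a : A) (b : B) => \tsum_(c, d <- t) (a * c) ⊗ (b * d)).
Proof.
split=> [b k a a'|a k b b']; rewrite -tlift_comb; apply: eq_tlift => c d.
  by rewrite mulrDl -pzscalerAl tensl.
by rewrite mulrDl -pzscalerAl tensr.
Qed.

Lemma tmul_linearl t : linear (tmul^~ t).
Proof. by rewrite tmul.unlock; exact: tlift_linear (tmul_bilin_out t). Qed.

Lemma tmul_linearr s : linear (tmul s).
Proof.
move=> k t t'; rewrite tmul.unlock -tlift_comb; apply: eq_tlift => a b.
exact: tlift_linear (tmul_bilin_in a b) _ _ _.
Qed.

Lemma tmulE a b c d : tmul (a ⊗ b) (c ⊗ d) = (a * c) ⊗ (b * d).
Proof.
rewrite tmul.unlock (tliftE _ _ (tmul_bilin_out _)).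
by rewrite (tliftE _ _ (tmul_bilin_in _ _)).
Qed.

Let tmulPl k s s' t : tmul (k *: s + s') t = k *: tmul s t + tmul s' t.
Proof. exact: tmul_linearl. Qed.

Let tmulPr k s t t' : tmul s (k *: t + t') = k *: tmul s t + tmul s t'.
Proof. exact: tmul_linearr. Qed.

Let tmull0 t : tmul 0 t = 0.
Proof. by have := tmulPl (-1) 0 0 t; rewrite scaler0 addr0 scaleN1r addNr. Qed.

Let tmulr0 s : tmul s 0 = 0.
Proof. by have := tmulPr (-1) s 0 0; rewrite scaler0 addr0 scaleN1r addNr. Qed.

Fact tmulA : associative tmul.
Proof.
have H2 a b c d u :
    tmul (a ⊗ b) (tmul (c ⊗ d) u) = tmul (tmul (a ⊗ b) (c ⊗ d)) u.
  elim/tensor_ind: u => [|k e f u IH]; first by rewrite !tmulr0.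
  rewrite (tmulPr k (c ⊗ d)) (tmulPr k (a ⊗ b)) (tmulPr k (tmul _ _)) IH.
  by rewrite !tmulE !mulrA.
have H1 a b t u : tmul (a ⊗ b) (tmul t u) = tmul (tmul (a ⊗ b) t) u.
  elim/tensor_ind: t => [|k c d t IH]; first by rewrite tmull0 tmulr0 tmull0.
  by rewrite (tmulPl k (c ⊗ d)) !(tmulPr k (a ⊗ b)) IH H2 (tmulPl k (tmul _ _)).
move=> s t u; elim/tensor_ind: s => [|k a b s IH]; first by rewrite !tmull0.
by rewrite !(tmulPl k (a ⊗ b)) IH H1 (tmulPl k (tmul _ _)).
Qed.

Fact tmul1l : left_id ((1 : A) ⊗ (1 : B)) tmul.
Proof.
elim/tensor_ind=> [|k a b t IH]; first exact: tmulr0.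
by rewrite tmulPr IH tmulE !mul1r.
Qed.

Fact tmul1r : right_id ((1 : A) ⊗ (1 : B)) tmul.
Proof.
elim/tensor_ind=> [|k a b t IH]; first exact: tmull0.
by rewrite tmulPl IH tmulE !mulr1.
Qed.

Fact tmulDl : left_distributive tmul +%R.
Proof.
by move=> s t u; have := tmulPl 1 s t u; rewrite !scale1r.
Qed.

Fact tmulDr : right_distributive tmul +%R.
Proof.
by move=> s t u; have := tmulPr 1 s t u; rewrite !scale1r.
Qed.

HB.instance Definition _ := GRing.Zmodule_isPzRing.Build (tensor A B)
  tmulA tmul1l tmul1r tmulDl tmulDr.

Fact tscaleAl (a : F) (s t : A ⊗ B) : a *: (s * t) = (a *: s) * t.
Proof.
by have := tmulPl a s 0 t; rewrite tmull0 !addr0.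
Qed.

Fact tscaleAr (a : F) (s t : A ⊗ B) : a *: (s * t) = s * (a *: t).
Proof.
by have := tmulPr a s t 0; rewrite tmulr0 !addr0.
Qed.

HB.instance Definition _ := PzRing_isPzAlgebra.Build F (tensor A B)
  (@scalerA F (tensor A B)) (@scale0r F (tensor A B)) (@scale1r F (tensor A B))
  (@scalerDr F (tensor A B)) (@scalerDl F (tensor A B)) tscaleAl tscaleAr.

Lemma tensM (a c : A) (b d : B) : (a ⊗ b) * (c ⊗ d) = (a * c) ⊗ (b * d).
Proof. exact: tmulE. Qed.

End TensorAlgebraStructure.

Section Center.
Variables (F : fieldType) (A : pzAlgType F).

Definition central : {pred A} := fun z => `[< forall x : A, z * x = x * z >].

Lemma centralP z : reflect (forall x : A, z * x = x * z) (z \in central).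
Proof. exact: asboolP. Qed.

Fact central_subring : subring_closed central.
Proof.
split; first by apply/centralP => x; rewrite mul1r mulr1.
  move=> y z /centralP yC /centralP zC; apply/centralP => x.
  by rewrite mulrBl mulrBr yC zC.
move=> y z /centralP yC /centralP zC; apply/centralP => x.
by rewrite -mulrA zC mulrA yC mulrA.
Qed.

HB.instance Definition _ := GRing.isSubringClosed.Build A central
  central_subring.

Fact central_scale : scaler_closed central.
Proof.
move=> a z /centralP zC; apply/centralP => x.
by rewrite -pzscalerAl zC pzscalerAr.
Qed.

HB.instance Definition _ := GRing.isScaleClosed.Build F A central central_scale.

Record center := Center { center_val :> A; _ : center_val \in central }.

HB.instance Definition _ := [isSub for center_val].
HB.instance Definition _ := [Choice of center by <:].
HB.instance Definition _ := 
  GRing.SubChoice_isSubPzRing.Build A central center central_subring.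
HB.instance Definition _ := [SubZmodule_isSubLmodule of center by <:].

Fact center_scaleAl (a : F) (x y : center) : a *: (x * y) = (a *: x) * y.
Proof. by apply: val_inj; rewrite /= pzscalerAl. Qed.

Fact center_scaleAr (a : F) (x y : center) : a *: (x * y) = x * (a *: y).
Proof. by apply: val_inj; rewrite /= pzscalerAr. Qed.

HB.instance Definition _ := PzRing_isPzAlgebra.Build F center
  (@scalerA F center) (@scale0r F center) (@scale1r F center)
  (@scalerDr F center) (@scalerDl F center) center_scaleAl center_scaleAr.

End Center.

Section FreeAlgebra.
Variables (F : fieldType) (X : choiceType).

Fact malg_scaleAl (a : F) (x y : {malg F[{fmonom X}]}) :
  a *: (x * y) = (a *: x) * y.
Proof. exact: scalerAl. Qed.

Fact malg_scaleAr (a : F) (x y : {malg F[{fmonom X}]}) :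
  a *: (x * y) = x * (a *: y).
Proof.
rewrite (malgMEw (fsubset_refl (msupp x)) (msuppZ_le a y)) malgME scaler_sumr.
apply: eq_bigr => k _; rewrite scaler_sumr; apply: eq_bigr => l _.
by apply/malgP => m; rewrite !mcoeffZ !mcoeffU mulrnAr mulrCA.
Qed.

HB.instance Definition _ :=
  PzRing_isPzAlgebra.Build F (malg (fmonom X) F)
    (@scalerA F {malg F[{fmonom X}]}) (@scale0r F {malg F[{fmonom X}]})
    (@scale1r F {malg F[{fmonom X}]}) (@scalerDr F {malg F[{fmonom X}]})
    (@scalerDl F {malg F[{fmonom X}]}) malg_scaleAl malg_scaleAr.

Definition freealg : pzAlgType F := {malg F[{fmonom X}]}.

Definition fgen (x : X) : freealg := << fmu x >>.

End FreeAlgebra.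

Section Relations.
Variables (F : fieldType) (B : pzAlgType F).

Definition linear_rel (V : lmodType F) (f : V -> B) : set B :=
  [set r | exists a u v, r = f (a *: u + v) - (a *: f u + f v)].

Definition alghom_rel (A : pzAlgType F) (f : A -> B) : set B :=
  linear_rel f `|` [set f 1 - 1]
  `|` [set r | exists x y, r = f (x * y) - f x * f y].

End Relations.

(* The algebra generated by A and B, without relations between the two. *)
Section FreeProduct.
Variables (F : fieldType) (A B : pzAlgType F).

Definition freeprod_rel : set (freealg F (A + B)%type) :=
  alghom_rel (fun a : A => fgen F (inl a : A + B)%type)
  `|` alghom_rel (fun b : B => fgen F (inr b : A + B)%type).

Definition freeprod : pzAlgType F := quotalg freeprod_rel.

Definition fp_inl (a : A) : freeprod := qalg freeprod_rel (fgen F (inl a)).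
Definition fp_inr (b : B) : freeprod := qalg freeprod_rel (fgen F (inr b)).

End FreeProduct.

Record hopfAlg (F : fieldType) := HopfAlg {
  hopf_sort :> pzAlgType F;
  comul : {alghom hopf_sort -> hopf_sort ⊗ hopf_sort};
  counit : {alghom hopf_sort -> F | *%R};
  antipode : {linear hopf_sort -> hopf_sort};
  comulA : forall h : hopf_sort,
    \tsum_(a, b <- comul h) \tsum_(c, d <- comul a) (c ⊗ (d ⊗ b))
    = \tsum_(a, b <- comul h) \tsum_(c, d <- comul b) (a ⊗ (c ⊗ d));
  counitl : forall h : hopf_sort, \tsum_(a, b <- comul h) (counit a *: b) = h;
  counitr : forall h : hopf_sort, \tsum_(a, b <- comul h) (counit b *: a) = h;
  antipodel : forall h : hopf_sort,
    \tsum_(a, b <- comul h) (antipode a * b) = counit h *: (1 : hopf_sort);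
  antipoder : forall h : hopf_sort,
    \tsum_(a, b <- comul h) (a * antipode b) = counit h *: (1 : hopf_sort)
}.

Arguments comul {F h} : rename.
Arguments counit {F h} : rename.
Arguments antipode {F h} : rename.

Section HopfNotions.
Variables (F : fieldType) (H : hopfAlg F).

Definition cocommutative : Prop :=
  forall h : H, \tsum_(a, b <- comul h) (b ⊗ a) = comul h.

Definition grouplike (g : H) : Prop := comul g = g ⊗ g /\ counit g = 1.

Definition primitive (x : H) : Prop :=
  comul x = x ⊗ (1 : H) + (1 : H) ⊗ x.

Definition subcoalgebra (S : set H) : Prop :=
  subspace S /\
  forall h, S h -> linspan [set a ⊗ b | a in S & b in S] (comul h).

Definition simple_subcoalgebra (S : set H) : Prop :=
  [/\ subcoalgebra S, S <> [set 0] &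
      forall S', subcoalgebra S' -> S' `<=` S -> S' = [set 0] \/ S' = S].

Definition pointed : Prop :=
  forall S, simple_subcoalgebra S -> exists2 x : H, x != 0 & S = linspan [set x].

End HopfNotions.

Definition hopf_morphism (F : fieldType) (K H : hopfAlg F)
    (f : {alghom K -> H}) : Prop :=
  [/\ forall k, comul (f k) = \tsum_(a, b <- comul k) (f a ⊗ f b),
      forall k, counit (f k) = counit k &
      forall k, antipode (f k) = f (antipode k)].

Definition coalgebra_morphism (F : fieldType) (K H : hopfAlg F)
    (f : {linear K -> H}) : Prop :=
  (forall k, comul (f k) = \tsum_(a, b <- comul k) (f a ⊗ f b))
  /\ (forall k, counit (f k) = counit k).

Record orthModule (F : fieldType) (H : hopfAlg F) := OrthModule {
  orth_sort :> vectType F;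
  orth_act : H -> orth_sort -> orth_sort;
  orth_act_bilin : bilin orth_act;
  orth_act1 : forall v, orth_act 1 v = v;
  orth_actM : forall g h v, orth_act (g * h) v = orth_act g (orth_act h v);
  orth_form : {symmetric orth_sort};
  orth_form_nondegenerate : nondegenerate orth_form;
  orth_form_invariant : forall h v w,
    \tsum_(a, b <- comul h) (orth_form (orth_act a v) (orth_act b w) : F^o)
    = counit h * orth_form v w
}.

Arguments orth_act {F H o} : rename.
Arguments orth_form {F H o} : rename.

(* The Z/2-grading of H = U(L) ⋊ F[G] attached to an action on V: the part of
   degree e (true meaning odd) is spanned by the products x_1 ... x_k g with x_i
   primitive and g group-like of determinant (-1)^e on V. *)
Section HopfGrading.
Variables (F : fieldType) (H : hopfAlg F) (V : vectType F).
Variable actV : H -> V -> V.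

Definition act_det (h : H) : F :=
  \det (passmx.mxof (vbasis {:V}) (vbasis {:V}) (linfun (actV h))).

Definition hopf_part (e : bool) : set H :=
  linspan [set h | exists (xs : seq H) (g : H),
    [/\ {in xs, forall x, primitive x}, grouplike g, act_det g = (-1) ^+ e
      & h = (\prod_(x <- xs) x) * g]].

End HopfGrading.

Section TensorAlgebra.
Variables (F : fieldType) (V : lmodType F).

Definition tensoralg : pzAlgType F := quotalg (linear_rel (@fgen F V)).

Definition tvec (v : V) : tensoralg := qalg _ (fgen F v).

Definition tensoralg_deg (n : nat) : set tensoralg :=
  linspan [set \prod_(v <- vs) tvec v | vs in [set vs : seq V | size vs = n]].

Definition symalg : pzAlgType F :=
  quotalg [set r | exists v w, r = tvec v * tvec w - tvec w * tvec v].

Definition symproj (t : tensoralg) : symalg := qalg _ t.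

Definition wedge2 : lmodType F := quotspace [set v ⊗ v | v in [set: V]].

Definition wedge (v w : V) : wedge2 := qproj _ (v ⊗ w).

End TensorAlgebra.

Section Clifford.
Variables (F : fieldType) (H : hopfAlg F) (V : orthModule H).

Definition clifford : pzAlgType F :=
  quotalg [set r : tensoralg V | exists v w,
    r = tvec v * tvec w + tvec w * tvec v
        - (2 * orth_form v w) *: (1 : tensoralg V)].

Definition cvec (v : V) : clifford := qalg _ (tvec v).

Definition clifford_part (e : bool) : set clifford :=
  linspan [set \prod_(v <- vs) cvec v
          | vs in [set vs : seq V | odd (size vs) = e]].

End Clifford.

(* The smash product B ⋊ H of H with an algebra B generated by the image of
   j : V -> B, where H acts on B through its action on V. *)
Section Smash.
Variables (F : fieldType) (H : hopfAlg F) (V : orthModule H).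
Variables (B : pzAlgType F) (j : V -> B).

Definition smash_rel : set (freeprod B H) :=
  [set r | exists h v, r = fp_inr B h * fp_inl H (j v)
     - \tsum_(a, b <- comul h) (fp_inl H (j (orth_act a v)) * fp_inr B b)].

Definition smash : pzAlgType F := quotalg smash_rel.

Definition smash_inl (b : B) : smash := qalg _ (fp_inl H b).
Definition smash_inr (h : H) : smash := qalg _ (fp_inr B h).

End Smash.

Section HopfHecke.
Variables (F : fieldType) (H : hopfAlg F) (V : orthModule H).
Variable kappa : {linear wedge2 V -> H}.

Definition TH : pzAlgType F := smash (@tvec F V).
Definition TH_T (t : tensoralg V) : TH := smash_inl _ t.
Definition TH_H (h : H) : TH := smash_inr _ h.

Definition SH : pzAlgType F := smash (fun v : V => symproj (tvec v)).
Definition SH_S (s : symalg V) : SH := smash_inl _ s.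
Definition SH_H (h : H) : SH := smash_inr _ h.

Definition SH_deg (n : nat) : set SH :=
  linspan [set r | exists t h,
    tensoralg_deg n t /\ r = SH_S (symproj t) * SH_H h].

Definition hecke_rel : set TH :=
  [set r | exists v w, r = TH_T (tvec v) * TH_T (tvec w)
     - TH_T (tvec w) * TH_T (tvec v) - TH_H (kappa (wedge v w))].

Definition hecke : pzAlgType F := quotalg hecke_rel.

Definition hecke_T (t : tensoralg V) : hecke := qalg _ (TH_T t).
Definition hecke_V (v : V) : hecke := hecke_T (tvec v).
Definition hecke_H (h : H) : hecke := qalg _ (TH_H h).

(* The image of the tensors of degree < n: the n-th piece of the associated
   graded algebra is hecke_fil n.+1 / hecke_fil n. *)
Definition hecke_fil (n : nat) : set hecke :=
  linspan [set r | exists k t h,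
    [/\ (k < n)%N, tensoralg_deg k t & r = hecke_T t * hecke_H h]].

(* In each degree n, the natural map from the degree n part of S(V) ⋊ H to
   hecke_fil n.+1 / hecke_fil n is bijective. *)
Definition PBW : Prop := forall n,
  exists Phi : {linear SH -> quotspace (hecke_fil n)},
  [/\ forall t h, tensoralg_deg n t ->
        Phi (SH_S (symproj t) * SH_H h) = qproj _ (hecke_T t * hecke_H h),
      forall x y, SH_deg n x -> SH_deg n y -> Phi x = Phi y -> x = y
    & Phi @` SH_deg n = qproj (hecke_fil n) @` hecke_fil n.+1].

End HopfHecke.

(* A pin cover is any triple with the defining properties; in particular the
   group-likes of the cover need not form the pullback of G -> O(V) along
   Pin(V) -> O(V), which is the standard example. The last two fields use that V
   is a module over the cover via pin_pi. *)
Record pinCover (F : fieldType) (H : hopfAlg F) (V : orthModule H) := PinCover {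
  pin :> hopfAlg F;
  pin_cocommutative : cocommutative pin;
  pin_pointed : pointed pin;
  pin_pi : {alghom pin -> H};
  pin_gamma : {alghom pin -> clifford V};
  pin_pi_hopf : hopf_morphism pin_pi;
  pin_pi_epi : forall h : H, exists k, pin_pi k = h;
  pin_double : exists i0 i1 : {linear H -> pin},
    [/\ coalgebra_morphism i0, coalgebra_morphism i1,
        bijective (fun p : H * H => i0 p.1 + i1 p.2),
        bijective (pin_pi \o i0) & bijective (pin_pi \o i1)];
  pin_part := hopf_part (fun (k : pin) (v : V) => orth_act (pin_pi k) v);
  pin_gamma_graded : forall e k, pin_part e k -> clifford_part e (pin_gamma k);
  pin_twisted : forall e k (v : V), pin_part e k ->
    (-1) ^+ e *: cvec (orth_act (pin_pi k) v)
    = \tsum_(a, b <- comul k) (pin_gamma a * cvec v * pin_gamma (antipode b))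
}.

Arguments pin_pi {F H V}.
Arguments pin_gamma {F H V}.
Arguments pin_part {F H V}.

Section Dirac.
Variables (F : fieldType) (H : hopfAlg F) (V : orthModule H).
Variable kappa : {linear wedge2 V -> H}.
Variable P : pinCover V.

Local Notation AC := (hecke kappa ⊗ clifford V)%type.

Definition AC_odd : set AC :=
  linspan [set a ⊗ c | a in [set: hecke kappa] & c in clifford_part true].

Definition dual_bases n (b b' : n.-tuple V) : Prop :=
  [/\ basis_of {:V} b, basis_of {:V} b' &
      forall i j : 'I_n, orth_form (tnth b i) (tnth b' j) = (i == j)%:R].

Definition dirac n (b b' : n.-tuple V) : AC :=
  \sum_(i < n) hecke_V kappa (tnth b i) ⊗ cvec (tnth b' i).

Definition DeltaC (k : P) : AC :=
  \tsum_(a, b <- comul k) (hecke_H kappa (pin_pi P a) ⊗ pin_gamma P b).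

Definition pin_quot : pzAlgType F := quotalg [set k : P | DeltaC k = 0].

(* DeltaC is an algebra map, so this does not depend on the representative. *)
Definition DeltaC' (x : pin_quot) : AC := DeltaC (repr x).

Definition parthasarathy (D : AC) : Prop :=
  exists (c : center AC) (k : P),
    pin_part P false k /\ D * D = center_val c + DeltaC k.

Definition pin_act (k : P) (x : AC) : AC :=
  \tsum_(a, b <- comul k) (DeltaC a * x * DeltaC (antipode b)).

Definition AC_det : set AC :=
  [set x | forall e k, pin_part P e k ->
     pin_act k x = ((-1) ^+ e * counit k) *: x].

Definition AC_det_odd : set AC := AC_det `&` AC_odd.

End Dirac.

(* Main.v *)
Require Import Defs.
From HB Require Import structures.
From mathcomp Require Import all_boot all_order all_algebra.
From mathcomp Require Import mathcomp_extra boolp classical_sets.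
From mathcomp Require finmap monalg.

Set Implicit Arguments.
Unset Strict Implicit.
Unset Printing Implicit Defensive.

Import GRing.Theory.
Local Open Scope ring_scope.
Local Open Scope classical_set_scope.

(** Write T = A ⊗ C, let θ be its parity automorphism and Δ the diagonal map. On the
    odd (even) elements x of T on which the pin cover acts through det (trivially), the
    operator d x = D x - θ(x) D is a differential: d (d x) = [D^2, x] vanishes by the
    Parthasarathy condition. The point is that, modulo coboundaries, every cocycle is
    Δ(k) for some k, and that Δ(k) is a coboundary only if it is 0.

    By the structure theorem of pointed cocommutative Hopf algebras and polarization, T
    is spanned by the elements (v^n ⊗ c) Δ(k), and the PBW property makes the Koszul
    contraction K : (v^n ⊗ c) Δ(k) |-> n (v^(n-1) ⊗ v ∧ c) Δ(k) well defined and
    equivariant. On elements of degree n in V and exterior degree r, the operator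
    d K + K d is multiplication by 2 (n + r) up to terms of lower degree in V. Hence a
    cocycle of positive degree is cohomologous to one of lower degree, and in degree 0
    only r = 0, that is the image of Δ, survives. *)

(** * Linear algebra and tensor products *)

(** The obstacle is that the monomials [gen v m c k] spanning [T] are not independent: [Δ] need not
    be injective, and [T] is not known to be free over its image. A linear map can be defined on
    monomials only once it is known to respect every relation. PBW splits a relation by degree and
    shows that in degree [n] it survives the replacement of [v ^+ n] by the scalar [f v ^+ n], for
    every functional [f]; polarization turns these scalar identities back into identities between
    vectors. For [w ∧ c] the delicate half is multiplication of [c] by [w] on the right, since
    [Δ(k)] stands there; it is obtained from [D Δ(k) = θ(Δ(k)) D] read in degree 1. As [d K + K d]
    is diagonal only up to lower degree, products of the operators [d K + K d - 2 j] with [j > 0]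
    are used: they kill the unwanted leading terms, while on cocycles they are nonzero multiples of
    the identity up to coboundaries and lower degree. Finally [z ⊗ 1] is a cocycle because it is
    central in [T], and products of decompositions decompose by a Leibniz rule for [d]. *)

Definition linear_pack (F : fieldType) (U V : lmodType F) (f : U -> V)
    (fL : linear f) : {linear U -> V} :=
  HB.pack f (GRing.isLinear.Build F U V _ f fL).

(* Locked so that simplification does not expose the packed function. *)
HB.lock Definition mklin (F : fieldType) (U V : lmodType F) (f : U -> V)
  (fL : linear f) : {linear U -> V} := linear_pack fL.

Lemma mklinE (F : fieldType) (U V : lmodType F) (f : U -> V) (fL : linear f) x :
  mklin fL x = f x.
Proof. by rewrite mklin.unlock. Qed.

Section LinearMaps.
Variables (F : fieldType) (U V W : lmodType F).

Lemma subspace_sum (S : set V) (I : Type) (r : seq I) (P : pred I) (f : I -> V) :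
  subspace S -> (forall i, P i -> S (f i)) -> S (\sum_(i <- r | P i) f i).
Proof.
by move=> sS Sf; elim/big_rec: _ => [|i x /Sf Si Sx]; [exact: sS.1|apply: subspaceD].
Qed.

Lemma subspace_preim (f : {linear U -> V}) (S : set V) :
  subspace S -> subspace (f @^-1` S).
Proof.
move=> sS; split=> [|a x y Sx Sy]; first by rewrite /preimage/= linear0; exact: sS.1.
by rewrite /preimage/= linearP; apply: sS.2.
Qed.

Lemma subspaceBr (S : set V) x y : subspace S -> S y -> S (x - y) -> S x.
Proof. by move=> sS Sy Sxy; rewrite -(subrK y x); apply: subspaceD. Qed.

Lemma subspaceZr (S : set V) (a : F) x : subspace S -> a != 0 -> S (a *: x) -> S x.
Proof.
by move=> sS a0 Sax; rewrite -[x]scale1r -(mulVf a0) -scalerA; apply: subspaceZ.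
Qed.

Lemma subspace0set : subspace ([set 0] : set V).
Proof. by split=> // a x y /= -> ->; rewrite scaler0 addr0. Qed.

Lemma subspaceI (S T : set V) : subspace S -> subspace T -> subspace (S `&` T).
Proof.
move=> sS sT; split; first by split; [exact: sS.1|exact: sT.1].
by move=> a x y [? ?] [? ?]; split; [apply: sS.2|apply: sT.2].
Qed.

Lemma linspan_sub (X Y : set V) : X `<=` Y -> linspan X `<=` linspan Y.
Proof.
by move=> XY; apply: span_min (span_subspace Y) _ => x /XY Yx; apply: Defs.sub_span.
Qed.

Lemma linear_eq_span (f g : {linear V -> W}) (X : set V) x :
  linspan X x -> (forall y, X y -> f y = g y) -> f x = g x.
Proof.
move=> Xx fg; apply: (span_min (S := [set y | f y = g y]) _ fg Xx).
split=> [|a y z /= fy fz] /=; first by rewrite !linear0.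
by rewrite !linearP fy fz.
Qed.

End LinearMaps.

Lemma span_map (F : fieldType) (U V : lmodType F) (L : {linear U -> V})
    (X : set U) (S : set V) x :
  subspace S -> (forall y, X y -> S (L y)) -> linspan X x -> S (L x).
Proof. by move=> sS XS; apply: (span_min (subspace_preim L sS)). Qed.

Section Functionals.
Variables (F : fieldType) (V : lmodType F).

(* A subspace maximal among those containing S but not v has codimension 1. *)
Lemma functional_sep (S : set V) v : subspace S -> ~ S v ->
  exists f : {linear V -> F^o}, (forall x, S x -> f x = 0) /\ f v = 1.
Proof.
move=> sS Sv.
pose P := [set M : set V | subspace M /\ S `<=` M /\ ~ M v \/ M = set0].
have [|M [PM maxM]] := @Zorn_bigcup _ P.
  move=> C CP Ctot.
  have [[X CX Xne]|Cno] := pselect (exists2 X, C X & X !=set0); last first.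
    right; rewrite -subset0 => x [Y CY Yx]; apply: Cno.
    by exists Y => //; exists x.
  have PX Y y : C Y -> Y y -> subspace Y /\ S `<=` Y /\ ~ Y v.
    by move=> CY Yy; have [//|Y0] := CP _ CY; rewrite Y0 in Yy.
  have [x0 Xx0] := Xne; have [sX [SX _]] := PX _ _ CX Xx0.
  left; split; last first.
    split=> [y /SX Xy|[Y CY Yv]]; first by exists X.
    by have [_ [_]] := PX _ _ CY Yv.
  split=> [|a y z [Y CY Yy] [Z CZ Zz]]; first by exists X => //; exact: sX.1.
  have [sY _] := PX _ _ CY Yy; have [sZ _] := PX _ _ CZ Zz.
  have [YZ|ZY] := Ctot _ _ CY CZ.
    by exists Z => //; apply: sZ.2 => //; exact: YZ.
  by exists Y => //; apply: sY.2 => //; exact: ZY.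
have [sM [SM Mv]] : subspace M /\ S `<=` M /\ ~ M v.
  case: PM => // M0; exfalso; apply: (maxM S); last by left; split=> //; split.
  by rewrite M0; split=> // /(_ 0 sS.1).
have dec w : exists a, M (w - a *: v).
  have [Mw|Mw] := pselect (M w); first by exists 0; rewrite scale0r subr0.
  pose M' := [set x | exists b, M (x - b *: w)].
  have [] := pselect (M' v) => [[b Mb]|M'v].
    have b0 : b != 0.
      by apply/eqP => b0; apply: Mv; move: Mb; rewrite b0 scale0r subr0.
    exists b^-1; have := subspaceZ (- b^-1) sM Mb.
    by rewrite scaleNr scalerBr scalerA mulVf // scale1r opprB.
  exfalso; apply: (maxM M').
    split=> [x Mx|/(_ w)]; first by exists 0; rewrite scale0r subr0.
    by move=> MM; apply/Mw/MM; exists 1; rewrite scale1r subrr; exact: sM.1.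
  left; split; last first.
    by split=> // x Sx; exists 0; rewrite scale0r subr0; exact: SM.
  split=> [|a x y [b Mx] [c My]].
    by exists 0; rewrite scale0r subr0; exact: sM.1.
  exists (a * b + c); rewrite scalerDl opprD addrACA -scalerA -scalerBr.
  exact: sM.2.
have [f Mf] := choice dec.
have funi w a : M (w - a *: v) -> f w = a.
  move=> Ma; have := subspaceB sM (Mf w) Ma.
  rewrite opprB addrC addrA subrK -scalerBl => Mfa.
  apply/esym/eqP; rewrite -subr_eq0; apply/eqP.
  apply: contrapT => /eqP ne0; apply: Mv; apply: subspaceZr ne0 Mfa => //.
have fL : linear (f : V -> F^o).
  move=> a x y; apply: funi; rewrite scalerDl opprD addrACA -scalerA -scalerBr.
  by apply: sM.2.
exists (mklin fL); split=> [x Sx|]; rewrite mklinE; apply: funi.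
  by rewrite scale0r subr0; exact: SM.
by rewrite scale1r subrr; exact: sM.1.
Qed.

Lemma functional_eq0 (v : V) : (forall f : {linear V -> F^o}, f v = 0) -> v = 0.
Proof.
move=> fv0; apply: contrapT => v0.
have [f [_ fv]] := functional_sep (subspace0set V) v0.
by have := oner_neq0 F; rewrite -fv fv0 eqxx.
Qed.

End Functionals.

(** * Tensor products, slices and representations with independent factors *)

Section Tensors.
Variables (F : fieldType) (U V : lmodType F).
Implicit Types (u : U) (v : V) (t : U ⊗ V).

Definition tensl v : {linear U -> (U ⊗ V)%type} := linear_pack ((@tens_bilin F U V).1 v).
Definition tensr u : {linear V -> (U ⊗ V)%type} := linear_pack ((@tens_bilin F U V).2 u).

Lemma tensDl u u' v : (u + u') ⊗ v = u ⊗ v + u' ⊗ v.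
Proof. exact: (raddfD (tensl v)). Qed.
Lemma tensBl u u' v : (u - u') ⊗ v = u ⊗ v - u' ⊗ v.
Proof. exact: (raddfB (tensl v)). Qed.
Lemma tensDr u v v' : u ⊗ (v + v') = u ⊗ v + u ⊗ v'.
Proof. exact: (raddfD (tensr u)). Qed.
Lemma tensBr u v v' : u ⊗ (v - v') = u ⊗ v - u ⊗ v'.
Proof. exact: (raddfB (tensr u)). Qed.
Lemma tensZl a u v : (a *: u) ⊗ v = a *: (u ⊗ v).
Proof. exact: (linearZ_LR (tensl v)). Qed.
Lemma tensZr a u v : u ⊗ (a *: v) = a *: (u ⊗ v).
Proof. exact: (linearZ_LR (tensr u)). Qed.
Lemma tens0l v : (0 : U) ⊗ v = 0.
Proof. exact: (raddf0 (tensl v)). Qed.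
Lemma tens0r u : u ⊗ (0 : V) = 0.
Proof. exact: (raddf0 (tensr u)). Qed.
Lemma tens_suml (I : Type) (r : seq I) (P : pred I) (f : I -> U) v :
  (\sum_(i <- r | P i) f i) ⊗ v = \sum_(i <- r | P i) (f i ⊗ v).
Proof. exact: (raddf_sum (tensl v)). Qed.
Lemma tens_sumr (I : Type) (r : seq I) (P : pred I) u (f : I -> V) :
  u ⊗ (\sum_(i <- r | P i) f i) = \sum_(i <- r | P i) (u ⊗ f i).
Proof. exact: (raddf_sum (tensr u)). Qed.

Lemma tens_span t : linspan [set u ⊗ v | u in [set: U] & v in [set: V]] t.
Proof.
elim/tensor_ind: t => [|a u v t IH]; first exact: (span_subspace _).1.
by apply: (span_subspace _).2 => //; apply: Defs.sub_span; exists u => //; exists v.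
Qed.

Lemma tensor_subspace (S : set (U ⊗ V)) :
  subspace S -> (forall u v, S (u ⊗ v)) -> forall t, S t.
Proof.
move=> sS Suv t; apply: (span_min sS) (tens_span t) => _ [u _] [v _ <-].
exact: Suv.
Qed.

Lemma tensor_linear_eq (W : lmodType F) (f g : {linear (U ⊗ V)%type -> W}) :
  (forall u v, f (u ⊗ v) = g (u ⊗ v)) -> f =1 g.
Proof.
move=> fg t; apply: linear_eq_span (tens_span t) _ => _ [u _] [v _ <-].
exact: fg.
Qed.

Definition tliftL (W : lmodType F) (f : U -> V -> W) (bf : bilin f) :
  {linear (U ⊗ V)%type -> W} := mklin (tlift_linear bf).

Lemma tliftLE (W : lmodType F) (f : U -> V -> W) (bf : bilin f) u v :
  tliftL bf (u ⊗ v) = f u v.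
Proof. by rewrite [LHS]mklinE; exact: tliftE. Qed.

Lemma linear_tlift (W W' : lmodType F) (L : {linear W -> W'}) (f : U -> V -> W) t :
  L (tlift t f) = tlift t (fun u v => L (f u v)).
Proof.
rewrite tlift.unlock /free_lift linear_sum; apply: eq_bigr => k _.
by rewrite linearZ_LR.
Qed.

Lemma tlift_subspace (W : lmodType F) (S : set W) (f : U -> V -> W) t :
  subspace S -> (forall u v, S (f u v)) -> S (tlift t f).
Proof.
move=> sS Sf; rewrite tlift.unlock; apply: subspace_sum => // k _.
exact: subspaceZ.
Qed.

Lemma sliceR_bilin (r : {linear V -> F^o}) :
  bilin (fun (u : U) (v : V) => (r v : F) *: u).
Proof.
split=> [v a x y|u a x y]; first by rewrite scalerDr !scalerA mulrC.
by rewrite linearP scalerDl /= -scalerA.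
Qed.

Lemma sliceL_bilin (r : {linear U -> F^o}) :
  bilin (fun (u : U) (v : V) => (r u : F) *: v).
Proof.
split=> [v a x y|u a x y]; first by rewrite linearP scalerDl /= -scalerA.
by rewrite scalerDr !scalerA mulrC.
Qed.

Definition sliceR r : {linear (U ⊗ V)%type -> U} := tliftL (sliceR_bilin r).
Definition sliceL r : {linear (U ⊗ V)%type -> V} := tliftL (sliceL_bilin r).

Lemma sliceRE r u v : sliceR r (u ⊗ v) = r v *: u.
Proof. exact: tliftLE. Qed.
Lemma sliceLE r u v : sliceL r (u ⊗ v) = r u *: v.
Proof. exact: tliftLE. Qed.

Lemma dual_family n (w : 'I_n -> V) :
  (forall i a, w i <> \sum_(j | j != i) a j *: w j) ->
  exists r : 'I_n -> {linear V -> F^o}, forall i j, r i (w j) = (i == j)%:R.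
Proof.
move=> wfree.
suff dual1 i : exists r : {linear V -> F^o}, forall j, r (w j) = (i == j)%:R.
  by have [r rP] := choice dual1; exists r.
have [|r [r0 r1]] := @functional_sep _ _ (linspan [set w j | j in [set j | j != i]])
    (w i) (span_subspace _).
  set S := [set x | exists a, x = \sum_(j | j != i) a j *: w j].
  suff sub : linspan [set w j | j in [set j | j != i]] `<=` S.
    by move=> /sub[a]; exact: wfree.
  apply: span_min => [|_ [j /= ji <-]].
    split=> [|a y z [b ->] [c ->]].
      by exists (fun _ => 0); rewrite big1 // => k _; rewrite scale0r.
    exists (fun j => a * b j + c j); rewrite scaler_sumr -big_split /=.
    by apply: eq_bigr => j _; rewrite scalerDl scalerA.
  exists (fun k => (k == j)%:R).
  rewrite (bigD1 j) //= eqxx scale1r big1 ?addr0 // => k /andP[_ /negPf->].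
  by rewrite scale0r.
exists r => j; case: eqVneq => [<- //|ij]; apply: r0; apply: Defs.sub_span.
by exists j => //=; rewrite eq_sym.
Qed.

Lemma tensor_sum t : exists n (u : 'I_n -> U) (v : 'I_n -> V),
  t = \sum_i u i ⊗ v i.
Proof.
elim/tensor_ind: t => [|a u v t [n [us [vs ->]]]].
  by exists 0, (fun _ => 0), (fun _ => 0); rewrite big_ord0.
exists n.+1, (fun i => if unlift ord0 i is Some j then us j else a *: u),
  (fun i => if unlift ord0 i is Some j then vs j else v).
rewrite big_ord_recl !unlift_none tensZl; congr (_ + _).
by apply: eq_bigr => i _; rewrite !liftK.
Qed.

End Tensors.

(** The dependent right factor is eliminated, and its coefficients are absorbed by the left factors
    of the other summands. *)
Lemma tensor_shorten_r (F : fieldType) (U V : lmodType F) n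
    (u : 'I_n -> U) (v : 'I_n -> V) i a :
  v i = \sum_(j | j != i) a j *: v j ->
  exists (u' : 'I_n.-1 -> U) (v' : 'I_n.-1 -> V),
    \sum_j u j ⊗ v j = \sum_j u' j ⊗ v' j.
Proof.
case: n u v i a => [|n] u v i a vi /=; first by case: i vi.
exists (fun j => u (lift i j) + a (lift i j) *: u i), (fun j => v (lift i j)).
rewrite (bigD1 i) //= {1}vi tens_sumr -big_split /=.
rewrite (reindex_omap (lift i) (unlift i)) => [|j ji]; last first.
  by case: unliftP => [k ->|/eqP]; rewrite ?(negPf ji).
apply: eq_big => [j|j _]; first by rewrite liftK eqxx eq_sym neq_lift.
by rewrite tensZr tensDl tensZl addrC.
Qed.

Lemma tensor_shorten_l (F : fieldType) (U V : lmodType F) n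
    (u : 'I_n -> U) (v : 'I_n -> V) i a :
  u i = \sum_(j | j != i) a j *: u j ->
  exists (u' : 'I_n.-1 -> U) (v' : 'I_n.-1 -> V),
    \sum_j u j ⊗ v j = \sum_j u' j ⊗ v' j.
Proof.
case: n u v i a => [|n] u v i a vi /=; first by case: i vi.
exists (fun j => u (lift i j)), (fun j => v (lift i j) + a (lift i j) *: v i).
rewrite (bigD1 i) //= {1}vi tens_suml -big_split /=.
rewrite (reindex_omap (lift i) (unlift i)) => [|j ji]; last first.
  by case: unliftP => [k ->|/eqP]; rewrite ?(negPf ji).
apply: eq_big => [j|j _]; first by rewrite liftK eqxx eq_sym neq_lift.
by rewrite tensZl tensDr tensZr addrC.
Qed.

Arguments sliceR {F U V} r.
Arguments sliceL {F U V} r.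

(* A representation of t of minimal length has independent factors. *)
Lemma tensor_dual_rep (F : fieldType) (U V : lmodType F) (t : U ⊗ V) :
  exists n (u : 'I_n -> U) (v : 'I_n -> V)
    (l : 'I_n -> {linear U -> F^o}) (m : 'I_n -> {linear V -> F^o}),
  [/\ t = \sum_i u i ⊗ v i, forall i, sliceR (m i) t = u i
    & forall i, sliceL (l i) t = v i].
Proof.
have ex : exists n, `[< exists (u : 'I_n -> U) (v : 'I_n -> V),
    t = \sum_i u i ⊗ v i >].
  by have [n [u [v tE]]] := tensor_sum t; exists n; apply/asboolP; exists u, v.
case: (ex_minnP ex) => n /asboolP[u [v tE]] nmin.
have lt (i : 'I_n) (u' : 'I_n.-1 -> U) (v' : 'I_n.-1 -> V) :
    t <> \sum_j u' j ⊗ v' j.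
  move=> tE'; have /nmin : `[< exists (u : 'I_n.-1 -> U) (v : 'I_n.-1 -> V),
    t = \sum_i u i ⊗ v i >] by apply/asboolP; exists u', v'.
  by case: n i {u v tE nmin u' v' tE'} => [[]|n _] //=; rewrite ltnn.
have [|m mP] := @dual_family _ _ n v.
  move=> i a /(tensor_shorten_r u) [u' [v' E]].
  by apply: (lt i u' v'); rewrite -E.
have [|l lP] := @dual_family _ _ n u.
  move=> i a /(tensor_shorten_l v) [u' [v' E]].
  by apply: (lt i u' v'); rewrite -E.
exists n, u, v, l, m; split=> // i.
  rewrite tE linear_sum (bigD1 i) // sliceRE mP eqxx scale1r.
  by rewrite big1 /= ?addr0 // => j /negPf ji; rewrite sliceRE mP eq_sym ji scale0r.
rewrite tE linear_sum (bigD1 i) // sliceLE lP eqxx scale1r.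
by rewrite big1 /= ?addr0 // => j /negPf ji; rewrite sliceLE lP eq_sym ji scale0r.
Qed.

Lemma tensor_eq0 (F : fieldType) (U V : lmodType F) (t : U ⊗ V) :
  (forall r : {linear V -> F^o}, sliceR r t = 0) -> t = 0.
Proof.
move=> t0; have [n [u [v [l [m [tE uE _]]]]]] := tensor_dual_rep t.
by rewrite tE big1 // => i _; rewrite -uE t0 tens0l.
Qed.

(** In a representation with independent factors, these factors are themselves slices of [t]. *)
Lemma tensor_slices (F : fieldType) (U V : lmodType F) (S : set U) (T : set V)
    (t : U ⊗ V) :
  (forall r : {linear V -> F^o}, S (sliceR r t)) ->
  (forall r : {linear U -> F^o}, T (sliceL r t)) ->
  linspan [set u ⊗ v | u in S & v in T] t.
Proof.
move=> St Tt; have [n [u [v [l [m [tE uE vE]]]]]] := tensor_dual_rep t.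
rewrite tE; apply: subspace_sum (span_subspace _) _ => i _; apply: Defs.sub_span.
by exists (u i); [rewrite -uE|exists (v i) => //; rewrite -vE].
Qed.

Section TensorMap.
Variables (F : fieldType) (U V U' V' : lmodType F).
Variables (f : {linear U -> U'}) (g : {linear V -> V'}).

Lemma tmap_bilin : bilin (fun u v => f u ⊗ g v).
Proof.
split=> [v a x y|u a x y]; first by rewrite linearP tensDl tensZl.
by rewrite linearP tensDr tensZr.
Qed.

Definition tmap : {linear (U ⊗ V)%type -> (U' ⊗ V')%type} := tliftL tmap_bilin.

Lemma tmapE u v : tmap (u ⊗ v) = f u ⊗ g v.
Proof. exact: tliftLE. Qed.

End TensorMap.

Section TensorMapAlgebra.
Variables (F : fieldType) (A B A' B' : pzAlgType F).
Variables (f : {alghom A -> A'}) (g : {alghom B -> B'}).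

Lemma tmapM s t : tmap f g (s * t) = tmap f g s * tmap f g t.
Proof.
elim/tensor_ind: s => [|a u v s IH]; first by rewrite mul0r linear0 mul0r.
rewrite mulrDl -pzscalerAl linearP IH [tmap f g (_ + s)]linearP mulrDl -pzscalerAl.
congr (_ *: _ + _); elim/tensor_ind: t {IH} => [|b u' v' t IH].
  by rewrite mulr0 linear0 mulr0.
rewrite mulrDr -pzscalerAr linearP IH [tmap f g (_ + t)]linearP mulrDr -pzscalerAr.
by congr (_ *: _ + _); rewrite tensM !tmapE tensM !rmorphM.
Qed.

Lemma tmap1 : tmap f g 1 = 1.
Proof. by rewrite [LHS]tmapE !rmorph1. Qed.

End TensorMapAlgebra.

Lemma natf_inj (F : fieldType) : [pchar F] =i pred0 ->
  injective (fun n => n%:R : F).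
Proof.
move=> char0 m n; wlog mn : m n / (m <= n)%N => [th|e].
  by case/orP: (leq_total m n) => mn e; [apply: th|apply/esym/th].
apply/eqP; rewrite eqn_leq mn -subn_eq0 -((pcharf0P F).1 char0) natrB // e.
by rewrite subrr eqxx.
Qed.

(* The coefficients are isolated using P(2t) - 2^n P(t), of smaller degree. *)
Lemma poly_coef_subspace (F : fieldType) (V : lmodType F) (S : set V) n
    (a : nat -> V) : [pchar F] =i pred0 -> subspace S ->
  (forall t : F, S (\sum_(k < n) t ^+ k *: a k)) -> forall k, (k < n)%N -> S (a k).
Proof.
move=> char0 sS; elim: n a => // n IH a Sa.
have Sk k : (k < n)%N -> S (a k).
  move=> kn; apply: (@subspaceZr _ _ _ (2 ^+ k - 2 ^+ n)) => //.
    rewrite subr_eq0 -!natrX (inj_eq (natf_inj char0)) eqn_exp2l //.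
    by rewrite neq_ltn kn.
  apply: (IH (fun k => (2 ^+ k - 2 ^+ n) *: a k)) kn => t.
  have := subspaceD sS (Sa (2 * t)) (subspaceZ (- 2 ^+ n) sS (Sa t)).
  rewrite scaler_sumr -big_split big_ord_recr /= !scalerA -scalerDl.
  rewrite exprMn mulNr subrr scale0r addr0; congr S; apply: eq_bigr => i _.
  by rewrite !scalerA -scalerDl exprMn mulrBr mulNr ![t ^+ i * _]mulrC.
move=> k; rewrite ltnS leq_eqVlt => /predU1P[->|/Sk//].
have := Sa 1; rewrite big_ord_recr /= expr1n scale1r addrC.
rewrite -[X in _ + X]opprK; apply: subspaceBr => //.
apply: subspaceN => //; apply: subspace_sum => // i _.
by rewrite expr1n scale1r; apply: Sk.
Qed.

Section LinearExtension.
Variables (F : fieldType) (X Y : lmodType F) (I : Type) (e : I -> X) (t : I -> Y).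

Lemma linspan_comb (V : lmodType F) (g : I -> V) x :
  linspan [set g i | i in [set: I]] x ->
  exists s : seq (F * I), x = \sum_(p <- s) p.1 *: g p.2.
Proof.
apply: (@span_min _ _ _ [set x | exists s : seq (F * I),
  x = \sum_(p <- s) p.1 *: g p.2]) => [|_ [i _ <-]]; last first.
  by exists [:: (1, i)]; rewrite big_seq1 scale1r.
split=> [|a y z [s ->] [s' ->]]; first by exists [::]; rewrite big_nil.
exists ([seq (a * p.1, p.2) | p <- s] ++ s').
rewrite big_cat big_map scaler_sumr /=; congr (_ + _).
by apply: eq_bigr => p _; rewrite scalerA.
Qed.

(** The value at [x] is read off a chosen representation of [x]; two representations differ by a
    relation, so the choice does not matter and linearity follows. *)
Lemma linear_extension :
  (forall x, linspan [set e i | i in [set: I]] x) ->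
  (forall s : seq (F * I), \sum_(p <- s) p.1 *: e p.2 = 0 ->
     \sum_(p <- s) p.1 *: t p.2 = 0) ->
  exists L : {linear X -> Y}, forall i, L (e i) = t i.
Proof.
move=> espan ecompat.
have [s sP] := choice (fun x => linspan_comb (espan x)).
pose L x := \sum_(p <- s x) p.1 *: t p.2.
have LE x s' : x = \sum_(p <- s') p.1 *: e p.2 -> L x = \sum_(p <- s') p.1 *: t p.2.
  move=> xE; apply/eqP; rewrite -subr_eq0; apply/eqP.
  have := ecompat (s x ++ [seq (- p.1, p.2) | p <- s']).
  rewrite !big_cat !big_map /= -sP.
  under eq_bigr do rewrite scaleNr.
  rewrite sumrN -xE subrr => /(_ erefl).
  by under [X in _ + X = 0 -> _]eq_bigr do rewrite scaleNr; rewrite sumrN.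
have LL : linear L.
  move=> a x y; rewrite (LE _ ([seq (a * p.1, p.2) | p <- s x] ++ s y)).
    rewrite big_cat big_map /= scaler_sumr; congr (_ + _).
    by apply: eq_bigr => p _; rewrite scalerA.
  rewrite big_cat big_map /= {1}(sP x) {1}(sP y) scaler_sumr; congr (_ + _).
  by apply: eq_bigr => p _; rewrite scalerA.
exists (mklin LL) => i; rewrite mklinE (LE _ [:: (1, i)]) big_seq1 /= ?scale1r //.
Qed.

End LinearExtension.

(** * Induction and chain conditions for finitely spanned subspaces *)

Section FiniteSpan.
Variables (F : fieldType) (V : lmodType F).

Definition fin_spanned (S : set V) := exists n (e : 'I_n -> V),
  forall x, S x -> exists a, x = \sum_i a i *: e i.

(** The family [e] may be dependent, so [d T] is the rank of the coefficient vectors whose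
    combinations lie in [T], that is, for a subspace, the dimension of its preimage in [F^n]. It
    still grows strictly along strict inclusions below [S]. *)
Lemma fin_spanned_rank (S : set V) : fin_spanned S -> exists (d : set V -> nat) (N : nat),
  (forall T, (d T <= N)%N) /\
  forall T T' v, subspace T -> subspace T' -> T `<=` T' -> T' `<=` S ->
    T' v -> ~ T v -> (d T < d T')%N.
Proof.
move=> [n [e eS]]; pose vec (c : 'rV[F]_n) := \sum_j c 0 j *: e j.
have vecL : linear vec.
  move=> a c c'; rewrite /vec scaler_sumr -big_split /=; apply: eq_bigr => j _.
  by rewrite !mxE scalerDl scalerA.
pose vecl := mklin vecL.
pose Q T k := `[< exists M : 'M[F]_(k, n),
  row_free M /\ forall i, T (vecl (row i M)) >].
have Q0 T : exists k, Q T k.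
  exists 0; apply/asboolP; exists 0; split=> [|[]//].
  by rewrite /row_free mxrank0.
have Qn T k : Q T k -> (k <= n)%N.
  move=> /asboolP[M [/eqP Mk _]]; rewrite -[X in (X <= _)%N]Mk.
  exact: rank_leq_col.
pose d T := ex_maxn (Q0 T) (Qn T).
exists d, n; split=> [T|T T' v sT sT' TT' T'S T'v Tv].
  by rewrite /d; case: ex_maxnP => k /Qn.
rewrite {1}/d.
case: ex_maxnP => k /asboolP[M [Mf MT]] kmax.
rewrite {}/d; case: ex_maxnP => k' _; rewrite -(add1n k); apply; apply/asboolP.
have [a va] := eS _ (T'S _ T'v); pose c := \row_i a i.
have vc : vecl c = v.
  by rewrite mklinE va; apply: eq_bigr => i _; rewrite mxE.
have cM : ~~ (c <= M)%MS.
  apply/negP => /submxP[D cD]; apply: Tv; rewrite -vc cD mulmx_sum_row linear_sum.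
  by apply: subspace_sum => // i _; rewrite linearZ_LR; apply: subspaceZ.
exists (col_mx c M); split=> [|i]; last first.
  rewrite -(splitK i); case: (fintype.split i) => j /=.
    by rewrite rowKu [j]ord1 row_id vc.
  by rewrite rowKd; apply/TT'/MT.
apply: inj_row_free => u; rewrite -[u]hsubmxK mul_row_col.
set a1 := lsubmx u; set a2 := rsubmx u => u0.
suff a10 : a1 = 0.
  move: u0; rewrite a10 mul0mx add0r => /eqP; rewrite mulmx_free_eq0 // => /eqP ->.
  by rewrite row_mx0.
apply: contra_notP (negP cM) => /eqP a10; move: a10 u0.
rewrite [a1]mx11_scalar mul_scalar_mx => a10 /eqP; rewrite addr_eq0 => /eqP cE.
have a00 : a1 0 0 != 0 by apply: contraPneq a10 => ->; rewrite raddf0 eqxx.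
rewrite -[c]scale1r -(mulVf a00) -scalerA cE scalemx_sub // -mulNmx.
exact: submxMl.
Qed.

Lemma fin_spanned_sub (S T : set V) : fin_spanned S -> T `<=` S -> fin_spanned T.
Proof. by move=> [n [e eS]] TS; exists n, e => x /TS/eS. Qed.

Lemma fin_spanned_ind (P : set V -> Prop) (S : set V) : fin_spanned S ->
  (forall T, subspace T -> T `<=` S ->
     (forall T' v, subspace T' -> T' `<=` T -> T v -> ~ T' v -> P T') -> P T) ->
  subspace S -> P S.
Proof.
move=> /fin_spanned_rank[d [N [dN dP]]] IH sS.
suff main k T : (d T < k)%N -> subspace T -> T `<=` S -> P T by exact: main (leqnn _) sS _.
elim: k T => // k IHk T ddiff sT TS; apply: IH => // T' v sT' T'T Tv T'v.
apply: IHk => //; last exact: subset_trans TS.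
exact: leq_trans (dP _ _ v sT' sT T'T TS Tv T'v) _.
Qed.

Lemma fin_spanned_asc (S : set V) (T : nat -> set V) : fin_spanned S ->
  (forall k, subspace (T k)) -> (forall k, T k `<=` S) ->
  (forall k, T k `<=` T k.+1) -> exists k, T k.+1 `<=` T k.
Proof.
move=> /fin_spanned_rank[d [N [dN dP]]] sT TS TT; apply: contrapT => no.
have step k : (d (T k) < d (T k.+1))%N.
  have [v [Tv Tkv]] : exists v, T k.+1 v /\ ~ T k v.
    apply: contrapT => nov; apply: no; exists k => v Tv.
    by apply: contrapT => Tkv; apply: nov; exists v.
  exact: dP Tv Tkv.
have : (N.+1 <= d (T N.+1))%N by elim: N.+1 => // k /leq_ltn_trans; apply.
by rewrite ltnNge dN.
Qed.

Lemma fin_spanned_desc (S : set V) (T : nat -> set V) : fin_spanned S ->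
  (forall k, subspace (T k)) -> (forall k, T k `<=` S) ->
  (forall k, T k.+1 `<=` T k) -> exists k, T k `<=` T k.+1.
Proof.
move=> /fin_spanned_rank[d [N [dN dP]]] sT TS TT; apply: contrapT => no.
have step k : (d (T k.+1) < d (T k))%N.
  have [v [Tv Tkv]] : exists v, T k v /\ ~ T k.+1 v.
    apply: contrapT => nov; apply: no; exists k => v Tv.
    by apply: contrapT => Tkv; apply: nov; exists v.
  exact: dP Tv Tkv.
have : (N.+1 + d (T N.+1) <= d (T 0))%N.
  by elim: N.+1 => // k; apply: leq_trans; rewrite addSnnS leq_add2l.
by move=> /leq_trans/(_ (dN _)); rewrite leqNgt ltn_addr.
Qed.

End FiniteSpan.

(** * Polarization in characteristic 0 *)

Section Polarization.
Variables (F : fieldType) (V : vectType F) (W : lmodType F).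
Hypothesis char0 : [pchar F] =i pred0.
Variables (I : Type) (v : I -> V).

Lemma poly_coef_eq (n : nat) (a b : nat -> W) :
  (forall t : F, \sum_(k < n) t ^+ k *: a k = \sum_(k < n) t ^+ k *: b k) ->
  forall k, (k < n)%N -> a k = b k.
Proof.
move=> ab k kn; apply/eqP; rewrite -subr_eq0; apply/eqP.
apply: (poly_coef_subspace (a := fun k => a k - b k) char0 (subspace0set W)) kn => t.
under eq_bigr do rewrite scalerBr.
by rewrite /= sumrB ab subrr.
Qed.

(** The hypothesis for [f + t g] is a polynomial identity in [t], whose coefficient of [t] is [n+1]
    times the conclusion. *)
Lemma polarize_form n (r : seq I) (x : I -> W) :
  (forall f : {linear V -> F^o}, \sum_(i <- r) (f (v i) : F) ^+ n.+1 *: x i = 0) ->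
  forall f g : {linear V -> F^o},
    \sum_(i <- r) ((f (v i) : F) ^+ n * g (v i)) *: x i = 0.
Proof.
move=> r0 f g.
pose a k := \sum_(i <- r) (((f (v i) : F) ^+ (n.+1 - k) * (g (v i) : F) ^+ k)
   *+ 'C(n.+1, k)) *: x i.
have a1 : a 1 = n.+1%:R *: (\sum_(i <- r) ((f (v i) : F) ^+ n * g (v i)) *: x i).
  rewrite /a scaler_sumr; apply: eq_bigr => i _.
  by rewrite subn1 expr1 bin1 scalerA mulr_natl.
suff : a 1 = 0.
  rewrite a1 => /eqP; rewrite scaler_eq0 ((pcharf0P F).1 char0) /=.
  by move=> /eqP.
apply: (poly_coef_eq (n := n.+2) (a := a) (b := fun _ => 0)) => // t.
rewrite [RHS]big1 => [|k _]; last by rewrite scaler0.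
rewrite -[RHS](r0 (f \+ t \*: g)%R).
under eq_bigr do rewrite scaler_sumr.
rewrite exchange_big /=; apply: eq_bigr => i _.
rewrite /= [t *: _]/(t * _) exprDn scaler_suml; apply: eq_bigr => k _.
rewrite scalerA exprMn mulrCA; congr (_ *: _).
by rewrite mulrnAr.
Qed.

(** The vector [v i] is expanded in a basis whose coordinate functions serve as the form [g] of
    [polarize_form]; thus one factor [f (v i)] is traded for the vector [v i] in the free argument
    of [x]. *)
Lemma polarize_diag n (r : seq I) (x : I -> V -> W) : (forall i, linear (x i)) ->
  (forall w (f : {linear V -> F^o}), \sum_(i <- r) (f (v i) : F) ^+ n.+1 *: x i w = 0) ->
  forall f : {linear V -> F^o}, \sum_(i <- r) (f (v i) : F) ^+ n *: x i (v i) = 0.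
Proof.
move=> xL r0 f; pose b := vbasis {:V}.
have xE i : x i (v i) = \sum_j coord b j (v i) *: x i b`_j.
  rewrite {1}(coord_vbasis (memvf (v i))) -/b.
  rewrite [LHS](raddf_sum (linear_pack (xL i))) /=; apply: eq_bigr => j _.
  exact: (linearZ_LR (linear_pack (xL i))).
under eq_bigr do rewrite xE scaler_sumr.
rewrite exchange_big big1 //= => j _.
rewrite -[RHS](polarize_form (r0 b`_j) f (coord b j : {linear V -> F^o})).
by apply: eq_bigr => i _; rewrite scalerA.
Qed.

(** Passage from symbols to actual elements: each round trades one scalar factor [f (v i)] for one
    application of [op (v i)], until no functional is left. *)
Lemma polarize_iter n (r : seq I) (x : I -> W) (op : V -> W -> W) : bilin op ->
  (forall f : {linear V -> F^o}, \sum_(i <- r) (f (v i) : F) ^+ n *: x i = 0) ->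
  \sum_(i <- r) iter n (op (v i)) (x i) = 0.
Proof.
move=> [opl opr]; elim: n x => [|n IH] x r0.
  (* At exponent 0 any functional gives the claim; the zero functional is at hand. *)
  have z : linear (fun _ : V => 0 : F^o) by move=> a y z; rewrite scaler0 addr0.
  by rewrite -[RHS](r0 (mklin z)); apply: eq_bigr => i _; rewrite expr0 scale1r.
under eq_bigr do rewrite iterSr.
apply: IH; apply: (polarize_diag (x := fun i w => op w (x i))) => [i|w f]; first exact: opl.
pose L := linear_pack (opr w).
have := congr1 L (r0 f); rewrite linear0 linear_sum; apply: etrans.
by apply: eq_bigr => i _; rewrite [RHS](linearZ_LR L).
Qed.

End Polarization.

Section NoncommutativeBinomial.
Variables (F : fieldType) (A : pzAlgType F).

(* The derivative of [x ^+ n] in the direction [y]. *)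
Fixpoint dpow (x y : A) n : A := if n is n'.+1 then x * dpow x y n' + y * x ^+ n' else 0.

(** The sum runs up to [n+1], one more than the degree, so that the coefficient of [t] is among its
    terms even for [n = 0]. *)
Lemma exprD_scale (x y : A) n : exists P : nat -> A, [/\ P 0 = x ^+ n, P 1 = dpow x y n
  & forall t : F, (x + t *: y) ^+ n = \sum_(k < n.+2) t ^+ k *: P k].
Proof.
suff [P [P0 P1 Pn Pt]] : exists P : nat -> A, [/\ P 0 = x ^+ n, P 1 = dpow x y n,
    forall k, (k > n)%N -> P k = 0
  & forall t : F, (x + t *: y) ^+ n = \sum_(k < n.+2) t ^+ k *: P k] by exists P.
elim: n => [|n [P [P0 P1 Pn Pt]]].
  exists (fun k => (k == 0)%:R); split=> // [[]//|t].
  by rewrite !big_ord_recl big_ord0 /= expr0 scale1r scaler0 !addr0.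
exists (fun k => x * P k + if k is k'.+1 then y * P k' else 0); split.
- by rewrite P0 addr0 exprS.
- by rewrite /= P0 P1.
- by move=> [|k] //; rewrite ltnS => nk; rewrite !Pn ?mulr0 ?addr0 // ltnW.
move=> t; rewrite exprS Pt mulrDl.
under [RHS]eq_bigr do rewrite scalerDr; rewrite big_split /=; congr (_ + _).
  rewrite [RHS]big_ord_recr /= Pn // mulr0 scaler0 addr0 mulr_sumr.
  by apply: eq_bigr => k _; rewrite -pzscalerAr.
rewrite [RHS]big_ord_recl scaler0 add0r mulr_sumr; apply: eq_bigr => k _.
by rewrite -pzscalerAl -pzscalerAr scalerA -exprS.
Qed.

End NoncommutativeBinomial.

Lemma tliftZ (F : fieldType) (U V W : lmodType F) (c : F) (f : U -> V -> W) t :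
  c *: tlift t f = \tsum_(u, v <- t) (c *: f u v).
Proof.
rewrite tlift.unlock /free_lift scaler_sumr; apply: eq_bigr => k _.
by rewrite !scalerA mulrC.
Qed.

Section TensorAssociativity.
Variables (F : fieldType) (U V W : lmodType F).

Lemma tassoc_bilin :
  bilin (fun (u : U) (t : V ⊗ W) => \tsum_(v, w <- t) ((u ⊗ v) ⊗ w)).
Proof.
split=> [t a u u'|u a s t].
  rewrite -tlift_comb; apply: eq_tlift => v w.
  by rewrite tensDl tensZl tensDl tensZl.
apply: tlift_linear; split=> [w b v v'|v b w w'].
  by rewrite tensDr tensZr tensDl tensZl.
by rewrite tensDr tensZr.
Qed.

Definition tassoc : {linear (U ⊗ (V ⊗ W))%type -> ((U ⊗ V) ⊗ W)%type} :=
  tliftL tassoc_bilin.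

Lemma tassocE u v w : tassoc (u ⊗ (v ⊗ w)) = (u ⊗ v) ⊗ w.
Proof.
rewrite tliftLE tliftE //; split=> [x b y y'|y b x x'].
  by rewrite tensDr tensZr tensDl tensZl.
by rewrite tensDr tensZr.
Qed.

End TensorAssociativity.

(* Stated for [tmul], whose arguments carry the Lmodule structure of the tensor
   product rather than the one derived from its algebra structure. *)
Lemma tmul_bilin (F : fieldType) (A B : pzAlgType F) : bilin (@tmul F A B).
Proof. by split=> [t|s]; [exact: tmul_linearl|exact: tmul_linearr]. Qed.

Section Multiplication.
Variables (F : fieldType) (A : pzAlgType F).

Lemma mul_bilin : bilin (fun a b : A => a * b).
Proof.
split=> [b k x y|a k x y]; first by rewrite mulrDl pzscalerAl.
by rewrite mulrDr pzscalerAr.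
Qed.

Definition tmulL : {linear (A ⊗ A)%type -> A} := tliftL mul_bilin.
Definition lmul (a : A) : {linear A -> A} := mklin (mul_bilin.2 a).
Definition rmul (a : A) : {linear A -> A} := mklin (mul_bilin.1 a).

Lemma tmulLE a b : tmulL (a ⊗ b) = a * b. Proof. exact: tliftLE. Qed.
Lemma lmulE a b : lmul a b = a * b. Proof. exact: mklinE. Qed.
Lemma rmulE a b : rmul a b = b * a. Proof. exact: mklinE. Qed.

End Multiplication.

(** * Pointed cocommutative Hopf algebras *)

Section Coalgebra.
Variables (F : fieldType) (K : hopfAlg F).
Implicit Types (r s : {linear K -> F^o}) (h x : K) (S T : set K).

Lemma tlift_tens (U V : lmodType F) (t : U ⊗ V) : tlift t (@tens F U V) = t.
Proof.
pose f := tliftL (@tens_bilin F U V).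
have -> : tlift t (@tens F U V) = f t by rewrite [f t]mklinE.
by apply: (tensor_linear_eq (g := idfun)) => u v; rewrite tliftLE.
Qed.

Lemma eps_linear : linear (counit : K -> F^o).
Proof. by move=> a x y; rewrite linearP. Qed.
Definition eps : {linear K -> F^o} := mklin eps_linear.
Lemma epsE h : eps h = counit h. Proof. exact: mklinE. Qed.

Lemma comul_linear : linear (comul : K -> (K ⊗ K)%type).
Proof. by move=> a x y; exact: linearP. Qed.
Definition comulL : {linear K -> (K ⊗ K)%type} := mklin comul_linear.
Lemma comulLE h : comulL h = comul h. Proof. exact: mklinE. Qed.

(** The action of the dual algebra on [K]: [h] goes to [h_(1) r(h_(2))]. *)
Definition hit r : {linear K -> K} := sliceR r \o comulL.

Lemma hitS r h : hit r h = sliceR r (comul h).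
Proof. by rewrite -[LHS]/(sliceR r (comulL h)) comulLE. Qed.

Lemma hitE r h : hit r h = \tsum_(a, b <- comul h) ((r b : F) *: a).
Proof. by rewrite hitS [LHS]mklinE. Qed.

Lemma hit_eps h : hit eps h = h.
Proof. by rewrite -[RHS]counitr hitE; apply: eq_tlift => a b; rewrite epsE. Qed.

Lemma eq_hit r s h : r =1 s -> hit r h = hit s h.
Proof. by move=> rs; rewrite !hitE; apply: eq_tlift => a b; rewrite rs. Qed.

Lemma hit_comb (c : F) r s h :
  c *: hit r h + hit s h = hit (c \*: r \+ s)%R h.
Proof.
rewrite !hitE -tlift_comb; apply: eq_tlift => a b.
by rewrite scalerDl scalerA.
Qed.

(** This is coassociativity: [s \o hit r] is the convolution product of the two functionals. *)
Lemma hit_comp r s h : hit s (hit r h) = hit (s \o hit r) h.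
Proof.
pose L : {linear (K ⊗ (K ⊗ K))%type -> K} := sliceR (s \o sliceR r).
have LE a b c : L (a ⊗ (b ⊗ c)) = (r c : F) *: ((s b : F) *: a).
  by rewrite sliceRE /= sliceRE linearZ /= scalerA.
have := congr1 L (comulA h); rewrite !linear_tlift => E.
transitivity (\tsum_(a, b <- comul h) L (\tsum_(c, d <- comul a) (c ⊗ (d ⊗ b)))).
  rewrite hitS [hit r h]hitE -comulLE.
  rewrite -[LHS]/((sliceR s \o comulL) _) linear_tlift; apply: eq_tlift => a b.
  rewrite linearZ /= comulLE [sliceR s _]mklinE [RHS]linear_tlift.
  by rewrite tliftZ; apply: eq_tlift => c d; rewrite LE.
rewrite {}E [RHS]hitE; apply: eq_tlift => a b; rewrite linear_tlift.
rewrite -[X in X *: a]/(s (hit r b)) hitE linear_tlift.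
have aL : linear (fun c : F^o => c *: a) by move=> c x y; rewrite scalerDl scalerA.
rewrite -[RHS]/(linear_pack aL _) linear_tlift; apply: eq_tlift => c d.
transitivity (((r d : F) * s c) *: a); first by rewrite LE scalerA.
by rewrite -[RHS]/(s (r d *: c) *: a) linearZ.
Qed.

Definition stable S := forall r h, S h -> S (hit r h).

Definition hits h : set K := [set hit r h | r in [set: {linear K -> F^o}]].

Lemma hits_subspace h : subspace (hits h).
Proof.
split=> [|c _ _ [r _ <-] [s _ <-]]; last by exists (c \*: r \+ s)%R; rewrite ?hit_comb.
by exists (-1 \*: eps \+ eps)%R; rewrite // -hit_comb scaleN1r addNr.
Qed.

Lemma mem_hits h : hits h h.
Proof. by exists eps => //; rewrite hit_eps. Qed.

Lemma hits_stable h : stable (hits h).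
Proof. by move=> s _ [r _ <-]; exists (s \o hit r) => //; rewrite hit_comp. Qed.

(** Finiteness theorem for coalgebras: every [hit r h] is a combination of the left factors of one
    representation of [comul h]. *)
Lemma hits_fin h : fin_spanned (hits h).
Proof.
have [n [u [v hE]]] := tensor_sum (comul h).
exists n, u => _ [r _ <-]; exists (fun i => r (v i)).
by rewrite hitS hE linear_sum; apply: eq_bigr => i _; rewrite sliceRE.
Qed.

Lemma sliceL_functional r s (t : K ⊗ K) : s (sliceL r t) = r (sliceR s t).
Proof.
by apply: (tensor_linear_eq (f := s \o sliceL r) (g := r \o sliceR s)) => u v /=;
  rewrite sliceLE sliceRE !linearZ /= [LHS]mulrC.
Qed.

Lemma subcoalgebra_stable S : subcoalgebra S -> stable S.
Proof.
move=> [sS ScS] r h /ScS; rewrite hitS; apply: (span_min (S := [set t | S (sliceR r t)])) => /=.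
  exact: (subspace_preim (sliceR r) sS).
by move=> _ [a Sa] [b _ <-]; rewrite /= sliceRE; apply: subspaceZ.
Qed.

Hypothesis coco : cocommutative K.

Lemma comul_sliceL r h : sliceL r (comul h) = hit r h.
Proof.
by rewrite hitS -{2}coco linear_tlift [LHS]mklinE; apply: eq_tlift => a b;
  rewrite sliceRE.
Qed.

(** By cocommutativity left and right slices of [comul h] agree, so both stay in [S] and
    [tensor_slices] applies. *)
Lemma stable_subcoalgebra S : subspace S -> stable S -> subcoalgebra S.
Proof.
move=> sS stS; split=> // h Sh; apply: tensor_slices => r.
  by rewrite -hitS; apply: stS.
by rewrite comul_sliceL; exact: stS.
Qed.

Lemma hitC r s h : hit s (hit r h) = hit r (hit s h).
Proof.
rewrite !hit_comp; apply: eq_hit => x /=.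
by rewrite !comulLE -!hitS -comul_sliceL sliceL_functional -hitS.
Qed.

Lemma coassoc_tlift (W : lmodType F) (G : {linear (K ⊗ (K ⊗ K))%type -> W}) h :
  \tsum_(a, b <- comul h) \tsum_(c, d <- comul a) G (c ⊗ (d ⊗ b))
  = \tsum_(a, b <- comul h) \tsum_(c, d <- comul b) G (a ⊗ (c ⊗ d)).
Proof.
have := congr1 G (comulA h); rewrite !linear_tlift => E.
transitivity (\tsum_(a, b <- comul h) G (\tsum_(c, d <- comul a) (c ⊗ (d ⊗ b)))).
  by apply: eq_tlift => a b; rewrite linear_tlift.
by rewrite {}E; apply: eq_tlift => a b; rewrite linear_tlift.
Qed.

Lemma coco_tlift (W : lmodType F) (G : {linear (K ⊗ K)%type -> W}) h :
  \tsum_(a, b <- comul h) G (a ⊗ b) = \tsum_(a, b <- comul h) G (b ⊗ a).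
Proof.
have := congr1 G (coco h); rewrite linear_tlift => ->.
by rewrite -{2}(tlift_tens (comul h)) linear_tlift.
Qed.

(** Rebrackets the fourfold coproduct so that its two middle factors come from a single coproduct,
    the form in which cocommutativity can exchange them. *)
Lemma four_fold (W : lmodType F) (G : {linear (K ⊗ (K ⊗ (K ⊗ K)))%type -> W}) h :
  \tsum_(a, b <- comul h) \tsum_(c, d <- comul a) G (c ⊗ (d ⊗ comul b))
  = \tsum_(a, b <- comul h) \tsum_(r, d <- comul b) \tsum_(c, e <- comul r)
      G (a ⊗ (c ⊗ (e ⊗ d))).
Proof.
have GE a b c : (G \o tmap idfun (tmap idfun comulL)) (a ⊗ (b ⊗ c))
  = G (a ⊗ (b ⊗ comul c)).
  by rewrite -[LHS]/(G (tmap _ _ _)) !tmapE comulLE.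
transitivity (\tsum_(a, b <- comul h) \tsum_(c, d <- comul a)
  (G \o tmap idfun (tmap idfun comulL)) (c ⊗ (d ⊗ b))).
  by apply: eq_tlift => a b; apply: eq_tlift => c d; rewrite GE.
rewrite coassoc_tlift; apply: eq_tlift => a b.
rewrite (coassoc_tlift (G \o tensr _ a)).
apply: eq_tlift => c d; apply: etrans (GE a c d) _.
rewrite -{1}(tlift_tens (comul d)).
by rewrite -[LHS]/((G \o tensr _ a \o tensr _ c) _) linear_tlift.
Qed.

(* h1 (x) h2 (x) h3 (x) h4 is unchanged when h2 and h3 are exchanged. *)
Lemma four_fold_swap (W : lmodType F)
    (G G' : {linear (K ⊗ (K ⊗ (K ⊗ K)))%type -> W}) h :
  (forall a b c d, G (a ⊗ (b ⊗ (c ⊗ d))) = G' (a ⊗ (c ⊗ (b ⊗ d)))) ->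
  \tsum_(a, b <- comul h) \tsum_(c, d <- comul a) G (c ⊗ (d ⊗ comul b))
  = \tsum_(a, b <- comul h) \tsum_(c, d <- comul a) G' (c ⊗ (d ⊗ comul b)).
Proof.
move=> GG'; rewrite !four_fold; apply: eq_tlift => a b; apply: eq_tlift => r d.
have L (H : {linear (K ⊗ (K ⊗ (K ⊗ K)))%type -> W}) c e :
    (H \o tensr _ a \o tmap idfun (tensl _ d)) (c ⊗ e) = H (a ⊗ (c ⊗ (e ⊗ d))).
  by apply: (congr1 (H \o tensr _ a)); rewrite tmapE.
transitivity (\tsum_(c, e <- comul r)
    (G' \o tensr _ a \o tmap idfun (tensl _ d)) (e ⊗ c)).
  by apply: eq_tlift => c e; rewrite [RHS]L GG'.
by rewrite -coco_tlift; apply: eq_tlift => c e; exact: L.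
Qed.

Lemma psi_linear : linear (fun h => tmulL K (comulL h)).
Proof. by move=> a x y; rewrite !linearP. Qed.
(** The convolution square of the identity, an Adams operator: on a product of [k] primitives it is
    [2^k] up to shorter products. *)
Definition psi : {linear K -> K} := mklin psi_linear.
Lemma psiS h : psi h = tmulL K (comul h).
Proof. by rewrite [LHS]mklinE comulLE. Qed.

Lemma psiE h : psi h = \tsum_(a, b <- comul h) (a * b).
Proof. by rewrite psiS [LHS]mklinE. Qed.

(** The left side is [h_(1) h_(3) ⊗ h_(2) h_(4)], the right side [h_(1) h_(2) ⊗ h_(3) h_(4)]; they
    agree after exchanging the middle factors. *)
Lemma comul_psi h : comul (psi h) = tmap psi psi (comul h).
Proof.
pose G : {linear (K ⊗ (K ⊗ (K ⊗ K)))%type -> (K ⊗ K)%type} :=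
  tliftL (@tmul_bilin F K K) \o tassoc K K (K ⊗ K)%type.
pose G' : {linear (K ⊗ (K ⊗ (K ⊗ K)))%type -> (K ⊗ K)%type} :=
  tmap (tmulL K) (tmulL K) \o tassoc K K (K ⊗ K)%type.
have GE a b t : G (a ⊗ (b ⊗ t)) = (a ⊗ b) * t.
  rewrite -[LHS]/(tliftL (@tmul_bilin F K K) (tassoc K K (K ⊗ K)%type (a ⊗ (b ⊗ t)))).
  by rewrite tassocE tliftLE.
have G'E a b t : G' (a ⊗ (b ⊗ t)) = (a * b) ⊗ tmulL K t.
  rewrite -[LHS]/(tmap (tmulL K) (tmulL K) (tassoc K K (K ⊗ K)%type (a ⊗ (b ⊗ t)))).
  by rewrite tassocE tmapE; congr (_ ⊗ _); exact: tmulLE.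
transitivity (\tsum_(a, b <- comul h) \tsum_(c, d <- comul a) G (c ⊗ (d ⊗ comul b))).
  rewrite -comulLE psiE linear_tlift; apply: eq_tlift => a b.
  rewrite comulLE; transitivity (comul a * comul b); first exact: rmorphM.
  rewrite -[comul a in LHS]tlift_tens.
  rewrite -[LHS]/(linear_pack (tmul_linearl (comul b)) _) linear_tlift.
  by apply: eq_tlift => c d; rewrite GE.
rewrite (four_fold_swap (G' := G')) => [|a b c d]; last first.
  by rewrite GE G'E tensM tmulLE.
rewrite -{2}(tlift_tens (comul h)) linear_tlift; apply: eq_tlift => a b.
rewrite tmapE [psi a]psiE -[RHS]/(tensl _ (psi b) _) linear_tlift.
by apply: eq_tlift => c d; rewrite G'E -psiS.
Qed.

End Coalgebra.

(** * The irreducible component of 1 is generated by primitives *)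

Section PrimitiveFiltration.
Variables (F : fieldType) (K : hopfAlg F).
Hypothesis char0 : [pchar F] =i pred0.
Hypothesis coco : cocommutative K.
Implicit Types (h x y : K) (n : nat).

Lemma comulB h h' : comul (h - h') = comul h - comul h' :> (K ⊗ K)%type.
Proof. by rewrite -!comulLE raddfB. Qed.
Lemma comulZ a h : comul (a *: h) = a *: comul h :> (K ⊗ K)%type.
Proof. by rewrite -!comulLE linearZ_LR. Qed.
Lemma comulM h h' : comul (h * h') = comul h * comul h' :> (K ⊗ K)%type.
Proof. exact: rmorphM. Qed.
Lemma comul1 : comul (1 : K) = (1 : K) ⊗ (1 : K).
Proof. exact: rmorph1. Qed.

Lemma counitE h : counit h = eps K h. Proof. by rewrite epsE. Qed.
Lemma counit1 : counit (1 : K) = 1. Proof. exact: rmorph1. Qed.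

Lemma counitB h h' : counit (h - h') = counit h - counit h'.
Proof. exact: raddfB. Qed.
Lemma counitZ (a : F) h : counit (a *: h) = a * counit h.
Proof. exact: linearZ_LR. Qed.
Lemma counitM h h' : counit (h * h') = counit h * counit h'.
Proof. exact: rmorphM. Qed.

Lemma eps_primitive x : primitive x -> counit x = 0.
Proof.
move=> px; have := hit_eps x; rewrite hitS px linearD !sliceRE !epsE counit1 scale1r.
rewrite addrC => /(canRL (addrK _)); rewrite subrr => /(congr1 counit).
by rewrite counitZ counit1 mulr1 raddf0.
Qed.

Lemma primitive_comm x y : primitive x -> primitive y -> primitive (x * y - y * x).
Proof.
move=> px py; rewrite /primitive comulB !comulM px py.
rewrite !mulrDl !mulrDr !tensM !mulr1 !mul1r tensBl tensBr !opprD.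
set p := (x * y) ⊗ _; set q := (1 : K) ⊗ (x * y); set r := (y * x) ⊗ _.
set s := (1 : K) ⊗ (y * x); set e := x ⊗ y; set f := y ⊗ x.
rewrite [f + q]addrC (addrACA p) [- e - s]addrC (addrACA (- r)) (addrACA (p + q)).
by rewrite -[- f - e]opprD [f + e]addrC subrr addr0 addrACA.
Qed.

Definition prims (xs : seq K) := {in xs, forall x, primitive x}.

Lemma prims_cons x xs : prims (x :: xs) -> primitive x /\ prims xs.
Proof.
move=> pxs; split=> [|y yxs]; first by apply: pxs; rewrite mem_head.
by apply: pxs; rewrite in_cons yxs orbT.
Qed.

Definition Ufil n : set K := linspan
  [set \prod_(x <- xs) x | xs in [set xs | (size xs <= n)%N /\ prims xs]].

Lemma Ufil_subspace n : subspace (Ufil n).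
Proof. exact: span_subspace. Qed.
Hint Resolve Ufil_subspace : core.

Lemma Ufil_le m n : (m <= n)%N -> Ufil m `<=` Ufil n.
Proof.
move=> mn; apply: linspan_sub => _ [xs [sxs pxs] <-]; exists xs => //; split=> //.
exact: leq_trans sxs mn.
Qed.

Lemma Ufil_prod xs : prims xs -> Ufil (size xs) (\prod_(x <- xs) x).
Proof. by move=> pxs; apply: Defs.sub_span; exists xs. Qed.

Lemma Ufil1 n : Ufil n 1.
Proof. by apply: Defs.sub_span; exists [::]; rewrite ?big_nil. Qed.

Lemma UfilM m n a b : Ufil m a -> Ufil n b -> Ufil (m + n) (a * b).
Proof.
move=> Ua Ub.
rewrite -rmulE; apply: span_map Ua => // _ [xs [sxs pxs] <-].
rewrite rmulE -lmulE; apply: span_map Ub => // _ [ys [sys pys] <-].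
rewrite lmulE -big_cat.
apply: Defs.sub_span; exists (xs ++ ys) => //; split.
  by rewrite size_cat leq_add.
by move=> z; rewrite mem_cat => /orP[/pxs|/pys].
Qed.

Lemma Ufil_prim x : primitive x -> Ufil 1 x.
Proof.
by move=> px; have := @Ufil_prod [:: x]; rewrite big_seq1; apply=> y /[!inE] /eqP ->.
Qed.

Lemma Ufil0 h : Ufil 0 h -> counit h = 0 -> h = 0.
Proof.
move=> U0; suff [a ->] : exists a, h = a *: (1 : K).
  by rewrite counitZ counit1 mulr1 => ->; rewrite scale0r.
apply: (span_min (S := [set h | exists a, h = a *: (1 : K)]) _ _ U0).
  split=> [|a _ _ [b ->] [c ->]]; first by exists 0; rewrite scale0r.
  by exists (a * b + c); rewrite scalerDl scalerA.
by move=> _ [[|x xs] [//= _ _] <-]; exists 1; rewrite big_nil scale1r.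
Qed.

(** The commutator with [x] is a derivation and sends a primitive factor to a primitive one, so the
    number of factors does not increase. *)
Lemma Ufil_ad x n y : primitive x -> Ufil n y -> Ufil n (y * x - x * y).
Proof.
move=> px Uy.
pose L : {linear K -> K} := (rmul x \- lmul x)%R.
have LE z : L z = z * x - x * z by rewrite /L /= rmulE lmulE.
rewrite -LE; apply: span_map Uy => // _ [xs [sxs pxs] <-]; rewrite LE.
apply: Ufil_le sxs _ _; elim: xs pxs => [|z xs IH] /= pxs.
  by rewrite big_nil mul1r mulr1 subrr; exact: (Ufil_subspace _).1.
have [pz {}pxs] := prims_cons pxs; rewrite big_cons.
have -> u : z * u * x - x * (z * u) = z * (u * x - x * u) + (z * x - x * z) * u.
  by rewrite mulrBr mulrBl !mulrA addrA subrK.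
apply: (subspaceD (Ufil_subspace _)); rewrite -add1n; apply: UfilM.
- exact: Ufil_prim.
- exact: IH.
- by apply: Ufil_prim; apply: primitive_comm.
- exact: Ufil_prod.
Qed.

Definition TTfil n : set (K ⊗ K)%type := linspan
  [set t | exists i j a b, [/\ (i + j <= n)%N, Ufil i a, Ufil j b & t = a ⊗ b]].

Lemma Ufil_comul n y : Ufil n y -> TTfil n (comul y).
Proof.
rewrite -comulLE; apply: span_map (span_subspace _) _ => _ [xs [sxs pxs] <-].
rewrite comulLE.
elim: xs n sxs pxs => [|x xs IH] n /= sxs pxs.
  rewrite big_nil comul1; apply: Defs.sub_span; exists 0, 0, 1, 1.
  by split=> //; apply: Ufil1.
case: n sxs => // n sxs; have [px {}pxs] := prims_cons pxs.
rewrite big_cons comulM px.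
pose L := linear_pack (tmul_linearr (x ⊗ (1 : K) + (1 : K) ⊗ x)).
apply: (span_map (L := L) (span_subspace _) _ (IH _ sxs pxs)).
move=> _ [i [j [a [b [ij Ua Ub ->]]]]].
rewrite -[L _]/((x ⊗ (1 : K) + (1 : K) ⊗ x) * (a ⊗ b)) mulrDl !tensM !mul1r.
apply: subspaceD (span_subspace _) _ _; apply: Defs.sub_span.
  by exists i.+1, j, (x * a), b; split=> //; rewrite -add1n; apply: UfilM => //; apply: Ufil_prim.
exists i, j.+1, a, (x * b); split; rewrite ?addnS //.
by rewrite -add1n; apply: UfilM => //; apply: Ufil_prim.
Qed.

Lemma Ufil_psi n y : Ufil n y -> Ufil n (psi K y).
Proof.
move=> /Ufil_comul Uy; rewrite psiS; apply: span_map Uy => //.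
move=> _ [i [j [a [b [ij Ua Ub ->]]]]]; rewrite tmulLE.
by apply: Ufil_le ij _ _; apply: UfilM.
Qed.

Lemma psi1 : psi K 1 = 1.
Proof.
by rewrite psiS comul1 tmulLE mulr1.
Qed.

(** For [x] primitive, [psi (x y) = x y_(1) y_(2) + y_(1) x y_(2)]. This is [2 x psi(y)] plus
    [[y_(1), x] y_(2)], and the latter has no more factors than [y]. *)
Lemma psi_prod xs : prims xs ->
  Ufil (size xs).-1 (psi K (\prod_(x <- xs) x) - 2 ^+ size xs *: \prod_(x <- xs) x).
Proof.
elim: xs => [|x xs IH] pxs /=.
  by rewrite big_nil psi1 expr0 scale1r subrr; exact: (Ufil_subspace _).1.
have [px {}pxs] := prims_cons pxs; rewrite big_cons.
set y := \prod_(_ <- xs) _; set k := size xs.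
have adR_bilin : bilin (fun a b : K => (a * x - x * a) * b).
  split=> [b c a a'|a c b b']; last by rewrite mulrDr pzscalerAr.
  rewrite pzscalerAl -mulrDl; congr (_ * _).
  by rewrite mulrDl mulrDr -pzscalerAl -pzscalerAr opprD addrACA -scalerBr.
pose adR := tliftL adR_bilin.
have psiM : psi K (x * y) = 2 *: (x * psi K y) + adR (comul y).
  rewrite !psiS comulM px.
  move: (comul y) => t.
  pose L := tmulL K \o linear_pack (tmul_linearr (x ⊗ (1 : K) + (1 : K) ⊗ x)).
  pose R : {linear (K ⊗ K)%type -> K} := (2 \*: (lmul x \o tmulL K) \+ adR)%R.
  transitivity (L t); first by [].
  transitivity (R t); last by rewrite /R /= lmulE.
  apply: tensor_linear_eq => a b.
  transitivity (tmulL K ((x ⊗ (1 : K) + (1 : K) ⊗ x) * (a ⊗ b))); first by [].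
  transitivity (2 *: lmul x (tmulL K (a ⊗ b)) + adR (a ⊗ b)); last by [].
  rewrite mulrDl !tensM !mul1r linearD !tmulLE lmulE tliftLE.
  rewrite mulrBl scaler_nat mulr2n !mulrA.
  by rewrite addrCA -addrA subrr addr0 addrC.
rewrite psiM exprS -scalerA addrAC -scalerBr pzscalerAr -mulrBr.
apply: (subspaceD (Ufil_subspace _)); last first.
  have := Ufil_comul (Ufil_prod pxs); rewrite -/y -/k => Uy.
  apply: span_map Uy => // _ [i [j [a [b [ij Ua Ub ->]]]]]; rewrite tliftLE.
  by apply: Ufil_le ij _ _; apply: UfilM => //; apply: Ufil_ad.
apply: (subspaceZ _ (Ufil_subspace _)); move: (IH pxs); rewrite -/y -/k.
rewrite {}/k; case: xs @y {IH psiM} pxs => [|z xs] y pxs Uy.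
  rewrite /y big_nil psi1 expr0 scale1r subrr mulr0.
  exact: (Ufil_subspace _).1.
by rewrite /= -add1n; apply: UfilM => //; apply: Ufil_prim.
Qed.

Lemma Ufil_psi_lead n y : Ufil n.+1 y -> Ufil n (psi K y - 2 ^+ n.+1 *: y).
Proof.
move=> Uy; pose L : {linear K -> K} := (psi K \- (2 ^+ n.+1 \*: idfun))%R.
apply: (span_map (L := L) _ _ Uy) => // _ [xs [sxs pxs] <-] /=.
move: sxs; rewrite leq_eqVlt => /predU1P[sxs|sxs].
  by have := psi_prod pxs; rewrite sxs.
have Uxs := Ufil_le (sxs : (size xs <= n)%N) (Ufil_prod pxs).
apply: (subspaceB (Ufil_subspace _)); first exact: Ufil_psi.
exact: (subspaceZ _ (Ufil_subspace _) Uxs).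
Qed.

Definition Uplus n : set K := Ufil n `&` [set h | counit h = 0].

Lemma counit_psi h : counit (psi K h) = counit h.
Proof.
transitivity (eps K (\tsum_(a, b <- comul h) (counit a *: b))).
  rewrite counitE psiE [LHS]linear_tlift [RHS]linear_tlift.
  apply: (eq_tlift (W := F^o)) => a b.
  by rewrite !epsE counitM counitZ.
by rewrite counitl epsE.
Qed.

Lemma Uplus_psi n h : Uplus n h -> Uplus n (psi K h).
Proof. by move=> [Uh h0]; split; [apply: Ufil_psi|rewrite /= counit_psi]. Qed.

Lemma Uplus_psi_lead n h : Uplus n.+1 h -> Uplus n (psi K h - 2 ^+ n.+1 *: h).
Proof.
move=> [Uh h0]; split; first exact: Ufil_psi_lead.
by rewrite /= counitB counit_psi counitZ h0 mulr0 subrr.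
Qed.

Lemma Uplus0 h : Uplus 0 h -> h = 0.
Proof. by move=> [Uh h0]; exact: Ufil0. Qed.

Definition TPfil n : set (K ⊗ K)%type := linspan
  [set t | exists i j a b, [/\ (i + j <= n)%N, Uplus i a, Uplus j b & t = a ⊗ b]].

Lemma TPfil_le m n : (m <= n)%N -> TPfil m `<=` TPfil n.
Proof.
move=> mn; apply: linspan_sub => _ [i [j [a [b [ij Ua Ub ->]]]]].
by exists i, j, a, b; split=> //; apply: leq_trans ij mn.
Qed.

Lemma TPfil_tens i j a b : Uplus i a -> Uplus j b -> TPfil (i + j) (a ⊗ b).
Proof. by move=> Ua Ub; apply: Defs.sub_span; exists i, j, a, b. Qed.

(** On [a ⊗ b] of degrees [i] and [j] the leading eigenvalue of [psi ⊗ psi] is [2^(i+j)]. Working in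
    the kernel of the counit makes the pieces with [i = 0] or [j = 0] vanish, so the expansion is
    only needed in positive degrees. *)
Lemma TPfil_psi n t : TPfil n.+1 t ->
  TPfil n (tmap (psi K) (psi K) t - 2 ^+ n.+1 *: t).
Proof.
move=> Tt; pose L : {linear (K ⊗ K)%type -> (K ⊗ K)%type} :=
  (tmap (psi K) (psi K) \- (2 ^+ n.+1 \*: idfun))%R.
have sT := span_subspace _ : subspace (TPfil n).
apply: (span_map (L := L) sT _ Tt) => _ [i [j [a [b [ij Ua Ub ->]]]]] /=.
rewrite tmapE.
case: i j Ua Ub ij => [|i] j Ua Ub ij.
  by rewrite (Uplus0 Ua) linear0 !tens0l scaler0 subrr; exact: sT.1.
case: j Ub ij => [|j] Ub ij.
  by rewrite (Uplus0 Ub) linear0 !tens0r scaler0 subrr; exact: sT.1.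
move: ij; rewrite leq_eqVlt => /predU1P[ij|ij]; last first.
  apply: (subspaceB sT); first by apply: (TPfil_le (ij : (i.+1 + j.+1 <= n)%N)); apply: TPfil_tens; apply: Uplus_psi.
  by apply: (subspaceZ _ sT); apply: (TPfil_le (ij : (i.+1 + j.+1 <= n)%N)); apply: TPfil_tens.
have /(canRL (subrK _)) := erefl (psi K a - 2 ^+ i.+1 *: a).
have := Uplus_psi_lead Ua; move: (psi K a - _) => a' Ua' ->.
have /(canRL (subrK _)) := erefl (psi K b - 2 ^+ j.+1 *: b).
have := Uplus_psi_lead Ub; move: (psi K b - _) => b' Ub' ->.
have cd : (2 ^+ i.+1 *: a) ⊗ (2 ^+ j.+1 *: b) = 2 ^+ n.+1 *: (a ⊗ b).
  by rewrite tensZl tensZr scalerA -exprD ij.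
rewrite tensDl !tensDr cd addrA addrK.
move: ij; rewrite addSn addnS => -[ij].
apply: (subspaceD sT); first apply: (subspaceD sT).
- by apply: (@TPfil_le (i + j)); [rewrite -ltnS ij|apply: TPfil_tens].
- by rewrite tensZr; apply: (subspaceZ _ sT); rewrite -ij -addnS; apply: TPfil_tens.
- by rewrite tensZl; apply: (subspaceZ _ sT); rewrite -ij -addSn; apply: TPfil_tens.
Qed.

Lemma TPfil1 t : TPfil 1 t -> t = 0.
Proof.
move=> /(span_min (subspace0set _)); apply=> _ [i [j [a [b [ij Ua Ub ->]]]]].
case: i j Ua Ub ij => [|i] [|j] Ua Ub //= ij; last by rewrite addnS in ij.
- by rewrite (Uplus0 Ua) tens0l.
- by rewrite (Uplus0 Ua) tens0l.
- by rewrite (Uplus0 Ub) tens0r.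
Qed.

Definition redcomul : {linear K -> (K ⊗ K)%type} :=
  (comulL K \- tensl K (1 : K) \- tensr K (1 : K))%R.

Lemma redcomulE h : redcomul h = comul h - h ⊗ (1 : K) - (1 : K) ⊗ h.
Proof. by rewrite -comulLE. Qed.

Lemma redcomul_psi h : redcomul (psi K h) = tmap (psi K) (psi K) (redcomul h).
Proof. by rewrite !redcomulE !linearB !tmapE psi1 (comul_psi coco). Qed.

(* psi multiplies the leading part of degree n by 2^n, so that the operators
   psi - 2^n, n >= 2, successively kill the reduced coproduct of h, whereas
   psi h - 2 h is obtained by multiplying the two factors of the latter. *)
Lemma Ufil_of_redcomul n h : TPfil n.+1 (redcomul h) -> exists m, Ufil m h.
Proof.
elim: n h => [|n IH] h.
  move=> /TPfil1 /eqP; rewrite redcomulE -addrA -opprD subr_eq0 => /eqP ph.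
  by exists 1; apply: Ufil_prim.
move=> Th; pose h' := psi K h - 2 ^+ n.+2 *: h.
have [|m Uh'] := IH h'.
  have -> : redcomul h' = tmap (psi K) (psi K) (redcomul h) - 2 ^+ n.+2 *: redcomul h.
    by rewrite linearB linearZ_LR redcomul_psi.
  exact: TPfil_psi.
have [m' Um'] : exists m', Ufil m' (psi K h - 2 *: h).
  have -> : psi K h - 2 *: h = tmulL K (redcomul h).
    rewrite redcomulE !linearB !tmulLE mulr1 mul1r psiS.
    by rewrite scaler_nat mulr2n opprD addrA.
  exists n.+2; apply: span_map Th => // _ [i [j [a [b [ij [Ua _] [Ub _] ->]]]]].
  by rewrite tmulLE; apply: Ufil_le ij _ _; apply: UfilM.
exists (m + m')%N; apply: (@subspaceZr _ _ _ (2 - 2 ^+ n.+2) _ (Ufil_subspace _)).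
  rewrite subr_eq0 -natrX (inj_eq (natf_inj char0)) -[X in X == _]expn1.
  by rewrite eqn_exp2l.
have -> : (2 - 2 ^+ n.+2) *: h = h' - (psi K h - 2 *: h).
  by rewrite scalerBl /h' opprB [RHS]addrC addrA subrK.
apply: (subspaceB (Ufil_subspace _)).
  exact: Ufil_le (leq_addr _ _) _ Uh'.
exact: Ufil_le (leq_addl _ _) _ Um'.
Qed.

(** These are the elements killed by any [n] successive functionals vanishing at [g]; for a
    group-like [g] they filter its irreducible component. *)
Fixpoint conil (g : K) n : set K := if n is n'.+1 then
  [set h | forall r : {linear K -> F^o}, r g = 0 -> conil g n' (hit r h)] else [set 0].

Lemma conil_subspace g n : subspace (conil g n).
Proof.
elim: n => [|n IH]; first exact: subspace0set.
split=> [r _|c x y Cx Cy r rg]; first by rewrite linear0; exact: IH.1.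
by rewrite linearP; apply: IH.2; [apply: Cx|apply: Cy].
Qed.

Lemma conil_stable g n : stable (conil g n).
Proof.
elim: n => [|n IH] s h Ch; first by rewrite [h]Ch linear0.
move=> r rg; rewrite -[_ (hit r _)]/(conil g n (hit r (hit s h))) (hitC coco).
by apply: IH; apply: Ch.
Qed.

Lemma conil_le g m n : (m <= n)%N -> conil g m `<=` conil g n.
Proof.
move=> /subnK <-; elim: (n - m)%N => // k IH h /IH {IH}; rewrite addSn.
move: (k + m)%N => l Ch r rg.
exact: conil_stable Ch.
Qed.

Lemma conil1_one n : conil 1 n.+1 1.
Proof.
apply: (@conil_le _ 1) => // r r1; change (hit r 1 = 0).
by rewrite hitS comul1 sliceRE r1; exact: scale0r.
Qed.

Lemma eps_hit r h : eps K (hit r h) = r h.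
Proof. by rewrite hitS -sliceL_functional (comul_sliceL coco) hit_eps. Qed.

Lemma eps_sliceR (r : {linear K -> F^o}) (t : K ⊗ K) :
  counit (sliceR r t) = r (sliceL (eps K) t).
Proof. by rewrite counitE -sliceL_functional sliceL_functional. Qed.

(** Once [h] is normalized to counit 0, the slices of its reduced coproduct lie one step lower and
    again have counit 0. By induction they are polynomials in primitives, and [Ufil_of_redcomul]
    carries this over to [h]. *)
Lemma conil1_Ufil n h : conil 1 n h -> exists m, Ufil m h.
Proof.
elim: n h => [|n IH] h; first by move=> ->; exists 0; exact: (Ufil_subspace _).1.
move=> Ch; pose h0 := h - counit h *: (1 : K).
suff [m Um] : exists m, Ufil m h0.
  exists m; rewrite -(subrK (counit h *: (1 : K)) h); apply: (subspaceD (Ufil_subspace _)) => //.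
  by apply: (subspaceZ _ (Ufil_subspace _)); apply: Ufil1.
have e0 : counit h0 = 0 by rewrite counitB counitZ counit1 mulr1 subrr.
have Ch0 : conil 1 n.+1 h0.
  apply: (subspaceB (conil_subspace _ _)) => //.
  by apply: (subspaceZ _ (conil_subspace _ _)); apply: conil1_one.
clearbody h0; case: n IH {Ch} Ch0 => [|n] IH Ch0.
  exists 0; suff -> : h0 = 0 by exact: (Ufil_subspace _).1.
  (* Subtracting a multiple of the counit makes [r] vanish at 1, as [conil] requires; the change is
     invisible on [h0], whose counit is 0. *)
  apply: functional_eq0 => r; pose s : {linear K -> F^o} := (r \- (r 1 \*: eps K))%R.
  have s1 : s 1 = 0 by rewrite /s /= epsE counit1 [_ *: _]mulr1 subrr.
  have := congr1 (eps K) (Ch0 s s1); rewrite eps_hit linear0 /s /= epsE e0.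
  by rewrite scaler0 subr0.
have sl r : conil 1 n.+1 (sliceR r (redcomul h0)).
  pose s : {linear K -> F^o} := (r \- (r 1 \*: eps K))%R.
  have s1 : s 1 = 0 by rewrite /s /= epsE counit1 [_ *: _]mulr1 subrr.
  have -> : sliceR r (redcomul h0) = hit s h0 - (r h0 : F) *: (1 : K).
    rewrite redcomulE !linearB !sliceRE -hitS; congr (_ - _).
    have -> : hit s h0 = - (r 1 : F) *: hit (eps K) h0 + hit r h0.
      rewrite hit_comb; apply: eq_hit => x; rewrite /s /= scaleNr.
      by rewrite [RHS]addrC.
    by rewrite hit_eps scaleNr addrC.
  apply: (subspaceB (conil_subspace _ _)); first exact: Ch0.
  by apply: (subspaceZ _ (conil_subspace _ _)); apply: conil1_one.
have symm r : sliceL r (redcomul h0) = sliceR r (redcomul h0).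
  rewrite redcomulE !linearB !sliceRE !sliceLE (comul_sliceL coco) hitS.
  by rewrite addrAC.
have [k [u [v [l [m [tE uE vE]]]]]] := tensor_dual_rep (redcomul h0).
have t0 : sliceL (eps K) (redcomul h0) = 0.
  rewrite redcomulE !linearB !sliceLE (comul_sliceL coco) hit_eps !epsE e0 counit1.
  by rewrite scale0r scale1r subr0 subrr.
have Uu i : exists m, Uplus m (u i).
  have [j Uj] := IH _ (sl (m i)); exists j; split; rewrite -uE //=.
  by rewrite eps_sliceR t0 linear0.
have Uv i : exists m, Uplus m (v i).
  have [j Uj] := IH _ (sl (l i)); exists j; split; rewrite -vE symm //=.
  by rewrite eps_sliceR t0 linear0.
suff [j Tj] : exists j, TPfil j (redcomul h0).
  by apply: (@Ufil_of_redcomul j); apply: TPfil_le Tj.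
pose S := [set t | exists j, TPfil j t].
have sS : subspace S.
  split=> [|a x y [i Tx] [j Ty]]; first by exists 0; exact: (span_subspace _).1.
  exists (i + j)%N; apply: (span_subspace _).2.
    exact: TPfil_le (leq_addr _ _) _ Tx.
  exact: TPfil_le (leq_addl _ _) _ Ty.
change (S (redcomul h0)); rewrite tE; apply: subspace_sum => // i _.
have [a Ua] := Uu i; have [b Ub] := Uv i; exists (a + b)%N.
exact: TPfil_tens.
Qed.

End PrimitiveFiltration.

Section Grouplike.
Variables (F : fieldType) (K : hopfAlg F).
Implicit Types (g h x : K).

Lemma grouplike_antipodeV g : grouplike g -> antipode g * g = 1.
Proof.
move=> [gg g1]; have := antipodel g; rewrite gg g1 scale1r => <-.
rewrite tliftE //; split=> [b a x y|a c x y]; first by rewrite linearP mulrDl pzscalerAl.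
by rewrite mulrDr pzscalerAr.
Qed.

Lemma grouplike_antipode g : grouplike g -> g * antipode g = 1.
Proof.
move=> [gg g1]; have := antipoder g; rewrite gg g1 scale1r => <-.
rewrite tliftE //; split=> [b a x y|a c x y]; first by rewrite mulrDl pzscalerAl.
by rewrite linearP mulrDr pzscalerAr.
Qed.

Lemma grouplike_inv g : grouplike g -> grouplike (antipode g).
Proof.
move=> Gg; have [gg g1] := Gg; split.
  have e : comul (antipode g) * (g ⊗ g) = 1.
    by rewrite -gg -comulM grouplike_antipodeV // comul1.
  rewrite -[LHS]mulr1; have <- : (g ⊗ g) * (antipode g ⊗ antipode g) = 1.
    by rewrite tensM !grouplike_antipode.
  by rewrite mulrA e mul1r.
by have := congr1 counit (grouplike_antipodeV Gg); rewrite counitM g1 mulr1 counit1.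
Qed.

Lemma grouplike_conj g x : grouplike g -> primitive x -> primitive (g * x * antipode g).
Proof.
move=> Gg px; have [gg _] := Gg; have [gg' _] := grouplike_inv Gg.
rewrite /primitive !comulM gg gg' px mulrDr mulrDl !tensM !mulr1.
by rewrite !grouplike_antipode.
Qed.

Lemma hit_grouplike (r : {linear K -> F^o}) g h : grouplike g ->
  hit r (g * h) = g * hit (r \o lmul g) h.
Proof.
move=> [gg _]; rewrite !hitS comulM gg; move: (comul h) => t.
pose L := sliceR r \o linear_pack (tmul_linearr (g ⊗ g)).
pose R := lmul g \o @sliceR F K K (r \o lmul g).
transitivity (L t); first by [].
transitivity (R t); last by rewrite [LHS]lmulE.
apply: tensor_linear_eq => a b.
transitivity (sliceR r ((g ⊗ g) * (a ⊗ b))); first by [].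
by rewrite [RHS]lmulE tensM !sliceRE -pzscalerAr /= lmulE.
Qed.

Definition hopf_gens : set K := linspan [set h | exists (xs : seq K) (g : K),
  [/\ prims xs, grouplike g & h = (\prod_(x <- xs) x) * g]].

End Grouplike.

Arguments hopf_gens {F K}.

(** * A pointed cocommutative Hopf algebra is generated by group-likes and primitives *)

Section PointedStructure.
Variables (F : fieldType) (K : hopfAlg F).
Hypothesis char0 : [pchar F] =i pred0.
Hypothesis coco : cocommutative K.
Implicit Types (g h x : K) (S T D : set K).

Lemma conil_translate g n h : grouplike g -> conil g n h -> conil 1 n (antipode g * h).
Proof.
move=> Gg; elim: n h => [|n IH] h Ch; first by rewrite [h]Ch; change (antipode g * 0 = 0); rewrite mulr0.
move=> r r1; change (conil 1 n (hit r (antipode g * h))).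
rewrite hit_grouplike; last exact: grouplike_inv.
by apply: IH; apply: Ch; rewrite /= lmulE grouplike_antipodeV.
Qed.

Lemma grouplike_prod g xs : grouplike g -> prims xs ->
  exists ys, prims ys /\ g * (\prod_(x <- xs) x) = (\prod_(y <- ys) y) * g.
Proof.
move=> Gg; elim: xs => [|x xs IH] pxs.
  by exists [::]; split=> //; rewrite !big_nil mulr1 mul1r.
have [px /IH[ys [pys E]]] := prims_cons pxs.
exists (g * x * antipode g :: ys); split.
  move=> y; rewrite in_cons => /predU1P[->|/pys//]; exact: grouplike_conj.
rewrite !big_cons -[RHS]mulrA -E !mulrA; congr (_ * _).
by rewrite -!mulrA grouplike_antipodeV // mulr1.
Qed.

(** Multiplication by [antipode g] carries the component of [g] to that of 1; on the way back,
    moving [g] to the right conjugates the primitives. *)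
Lemma conil_gens g n h : grouplike g -> conil g n h -> hopf_gens h.
Proof.
move=> Gg /(conil_translate Gg) /(conil1_Ufil char0 coco)[m Um].
have <- : lmul g (antipode g * h) = h.
  by rewrite lmulE mulrA grouplike_antipode // mul1r.
apply: span_map Um => [|_ [xs [_ pxs] <-]]; first exact: span_subspace.
have [ys [pys E]] := grouplike_prod Gg pxs.
by apply: Defs.sub_span; exists ys, g; split; rewrite // lmulE.
Qed.

Lemma hit_grouplikeE (r : {linear K -> F^o}) g : grouplike g -> hit r g = (r g : F) *: g.
Proof. by move=> [gg _]; rewrite hitS gg sliceRE. Qed.

(** A Nakayama argument. The images of [h] under functionals vanishing at [g] form a stable subspace
    [E]. If [h] were in [E], then [h = hit r h] for one such [r], and iterating would contradict
    nilpotence; so [E] has smaller rank. *)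
Lemma nilpotent_conil g D : grouplike g -> subspace D -> stable D -> fin_spanned D ->
  (forall (r : {linear K -> F^o}) h, r g = 0 -> D h -> exists k, iter k (hit r) h = 0) ->
  exists n, D `<=` conil g n.
Proof.
move=> Gg sD stD fD nil; have [d [N [dN dP]]] := fin_spanned_rank fD.
suff main n T : (d T < n)%N -> subspace T -> stable T -> T `<=` D -> T `<=` conil g n.
  by exists N.+1; apply: main; rewrite // ltnS.
elim: n T => // n IH T ddiff sT stT TD h Th.
have [->|h0] := pselect (h = 0); first exact: (conil_subspace _ _).1.
pose E := [set hit r h | r in [set r : {linear K -> F^o} | r g = 0]].
have ET : E `<=` T by move=> _ [r _ <-]; apply: stT.
have sE : subspace E.
  split=> [|c _ _ [r rg <-] [s sg <-]].
    exists (-1 \*: eps K \+ eps K)%R; last by rewrite -hit_comb scaleN1r addNr.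
    by rewrite /= scaleN1r addNr.
  exists (c \*: r \+ s)%R; last by rewrite hit_comb.
  by move: rg sg; rewrite /= => -> ->; rewrite scaler0 addr0.
have stE : stable E.
  move=> s _ [r rg <-]; exists (s \o hit r); last by rewrite hit_comp.
  change (s (hit r g) = 0); rewrite hit_grouplikeE //.
  by rewrite [r g]rg scale0r linear0.
have Eh : ~ E h.
  move=> [r rg rh]; have [k] := nil r h rg (TD _ Th); move=> hk; apply: h0.
  by rewrite -hk; elim: k {hk} => // k IHk; rewrite iterS -IHk rh.
have EC : E `<=` conil g n.
  apply: IH => //; last exact: subset_trans TD.
  exact: leq_trans (dP _ _ h sE sT ET TD Th Eh) _.
by move=> r rg; apply: EC; exists r.
Qed.

Hypothesis pt : pointed K.

(** A minimal nonzero stable subspace is a simple subcoalgebra, hence a line since [K] is pointed; a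
    multiple of its generator is group-like. *)
Lemma exists_grouplike D : fin_spanned D -> subspace D -> stable D ->
  (exists2 h, D h & h <> 0) -> exists2 g, grouplike g & D g.
Proof.
move=> fD sD; pose P T := stable T -> (exists2 h, T h & h <> 0) ->
  exists2 g, grouplike g & T g.
apply: (@fin_spanned_ind _ _ P _ fD) sD => T sT TD IH stT [h Th h0].
have [[T' [[sT' stT'] T'T [h' T'h' h'0]] [v Tv T'v]]|no] := pselect (exists T', [/\
    subspace T' /\ stable T', T' `<=` T, exists2 h', T' h' & h' <> 0
    & exists2 v, T v & ~ T' v]).
  have [|g Gg T'g] := IH T' v sT' T'T Tv T'v stT'; first by exists h'.
  by exists g => //; apply: T'T.
have [|x x0 TE] := pt (S := T).
  split=> [|T0|T' cT' T'T].
  - exact: stable_subcoalgebra.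
  - by move: Th; rewrite T0.
  have stT' := subcoalgebra_stable cT'; have sT' := cT'.1.
  have [[h' T'h' h'0]|T'0] := pselect (exists2 h', T' h' & h' <> 0).
    right; apply/seteqP; split=> // v Tv; apply: contrapT => T'v.
    by apply: no; exists T'; split=> //; [exists h'|exists v].
  left; apply/seteqP; split=> [v T'v|v ->]; last exact: sT'.1.
  by apply: contrapT => v0; apply: T'0; exists v.
have line (z : K) : T z -> exists c, z = c *: x.
  rewrite TE; apply: (span_min (S := [set z | exists c, z = c *: x])).
    split=> [|a _ _ [c ->] [c' ->]]; first by exists 0; rewrite scale0r.
    by exists (a * c + c'); rewrite scalerDl scalerA.
  by move=> _ ->; exists 1; rewrite scale1r.
have Tx : T x by rewrite TE; apply: Defs.sub_span.
have [c cE] : exists c, comul x = c *: (x ⊗ x).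
  have [_ /(_ _ Tx)] := stable_subcoalgebra coco sT stT.
  apply: (span_min (S := [set t | exists c, t = c *: (x ⊗ x)])).
    split=> [|a _ _ [b ->] [b' ->]]; first by exists 0; rewrite scale0r.
    by exists (a * b + b'); rewrite scalerDl scalerA.
  move=> _ [a /line[ca ->]] [b /line[cb ->] <-].
  by exists (ca * cb); rewrite tensZl tensZr scalerA.
have ce : c * counit x = 1.
  have := hit_eps x; rewrite hitS cE linearZ_LR sliceRE epsE scalerA => E.
  have : (c * counit x - 1) *: x == 0 by rewrite scalerBl scale1r E subrr.
  by rewrite scaler_eq0 (negPf x0) orbF subr_eq0 => /eqP.
(* From [comul x = c *: (x ⊗ x)] and [c * counit x = 1], scaling by [c] corrects both the coproduct
   and the counit. *)
exists (c *: x); last exact: subspaceZ.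
by split; rewrite ?counitZ // comulZ cE tensZl tensZr.
Qed.

Lemma iter_hitC (r s : {linear K -> F^o}) k h :
  iter k (hit r) (hit s h) = hit s (iter k (hit r) h).
Proof. by elim: k => // k IH; rewrite !iterS IH (hitC coco). Qed.

Lemma iter_hit_linear (r : {linear K -> F^o}) k : linear (iter k (hit r)).
Proof. by elim: k => // k IH a x y; rewrite !iterS IH linearP. Qed.

(* When multiplication by a function vanishing at the group-like g is not locally
   nilpotent, Fitting's decomposition splits D into two proper subcoalgebras. *)
Lemma fin_spanned_gens D : fin_spanned D -> subspace D -> stable D ->
  D `<=` hopf_gens.
Proof.
move=> fD sD; pose P T := stable T -> T `<=` hopf_gens.
apply: (@fin_spanned_ind _ _ P _ fD) sD => T sT TD IH stT h Th.
have [->|/eqP h0] := pselect (h = 0); first exact: (span_subspace _).1.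
have fT := fin_spanned_sub fD TD.
have [|g Gg Tg] := exists_grouplike fT sT stT; first by exists h => //; apply/eqP.
have [nil|/existsNP[r /existsNP[h1 /not_implyP[rg /not_implyP[Th1 /forallNP nnil]]]]] :=
    pselect (forall (r : {linear K -> F^o}) h, r g = 0 -> T h ->
      exists k, iter k (hit r) h = 0).
  have [n TC] := nilpotent_conil Gg sT stT fT nil.
  exact: conil_gens Gg (TC _ Th).
pose it k := linear_pack (iter_hit_linear r k).
have it1 y : it 1 y = hit r y by [].
have it0 y : it 0 y = y by [].
have itD j k y : it (j + k)%N y = it j (it k y) by exact: iterD.
have itC s k y : it k (hit s y) = hit s (it k y) by exact: iter_hitC.
have nil0 k : it k h1 <> 0 by exact: nnil.
clearbody it; have itS k y : it k.+1 y = hit r (it k y) by rewrite -add1n itD it1.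
have itT k y : T y -> T (it k y).
  by move=> Ty; elim: k => [|k]; rewrite ?it0 // itS; apply: stT.
pose ker k := T `&` [set y | it k y = 0].
pose im k := [set it k y | y in T].
have sker k : subspace (ker k).
  exact: subspaceI sT (subspace_preim (it k) (subspace0set _)).
have sim k : subspace (im k).
  split=> [|a _ _ [y Ty <-] [z Tz <-]]; first by exists 0; [exact: sT.1|rewrite linear0].
  by exists (a *: y + z); [exact: sT.2|rewrite linearP].
have imT k : im k `<=` T by move=> _ [y Ty <-]; apply: itT.
have imS k : im k.+1 `<=` im k.
  by move=> _ [y Ty <-]; exists (hit r y); [apply: stT|rewrite itC -itS].
have kerT k : ker k `<=` T by move=> y [].
have kerS k : ker k `<=` ker k.+1.
  by move=> y [Ty y0]; split=> //; rewrite /= itS [it k y]y0 linear0.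
(* The chain starts at [im 1], so that the stable image is contained in it. *)
have [k imk] := fin_spanned_desc fT (fun k => sim k.+1) (fun k => imT k.+1)
  (fun k => imS k.+1).
have stker : stable (ker k.+1).
  move=> s y [Ty y0]; split; first exact: stT.
  by rewrite /= itC [it _ y]y0 linear0.
have stim : stable (im k.+1).
  move=> s _ [y Ty <-]; exists (hit s y); first exact: stT.
  exact: itC.
(* This kernel is proper: no power of [hit r] kills [h1]. *)
have kerG : ker k.+1 `<=` hopf_gens.
  by apply: (IH _ h1) => // -[_]; apply: nil0.
have imG : im k.+1 `<=` hopf_gens.
  have [Tim|/existsNP[v /not_implyP[Tv imv]]] := pselect (T `<=` im 1); last first.
    apply: (IH _ v) => // imkv; apply: imv.
    by elim: k imkv {imk kerG stim stker} => // k IHk /imS /IHk.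
  (* If [hit r] were onto [T], then [g = it m y] for some [y] in [T], with [m] where the kernels
     stabilize. As [hit r g = 0], the element [y] lies in [ker m.+1], hence in [ker m], and [g]
     would be 0. *)
  exfalso; have [m kerm] := fin_spanned_asc fT sker kerT kerS.
  have imall j : T `<=` im j.
    elim: j => [|j IHj] y Ty; first by exists y.
    have [z /IHj[w Tw <-] <-] := Tim _ Ty; exists w => //.
    by rewrite itS it1.
  have [y Ty yg] := imall m _ Tg.
  have : ker m y.
    apply: kerm; split=> //=; rewrite itS yg.
    by rewrite hit_grouplikeE // rg scale0r.
  move=> [_ /= y0]; have := Gg.2; rewrite -yg [it _ _]y0 raddf0 => /esym/eqP.
  by rewrite oner_eq0.
have imkj j : im k.+1 `<=` im (j + k.+1)%N.
  elim: j => // j IHj _ [y Ty <-].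
  have [|z Tz zE] := imk (it k.+1 y); first by exists y.
  have [|w Tw wE] := IHj (it k.+1 z); first by exists z.
  exists w => //; rewrite addSn itS wE -zE; apply: esym; exact: itS.
(* Fitting splitting: [h] and [it k.+1 y] have the same image under [it k.+1], so their difference
   lies in the kernel. *)
have [|y Ty yE] := imkj k.+1 (it k.+1 h); first by exists h.
rewrite -(subrK (it k.+1 y) h); apply: (subspaceD (span_subspace _)).
  apply: kerG; split; first by apply: (subspaceB sT) => //; apply: itT.
  by rewrite /= linearB -itD yE subrr.
by apply: imG; exists y.
Qed.

Theorem pointed_gens h : hopf_gens h.
Proof.
exact: fin_spanned_gens (hits_fin h) (hits_subspace h) (hits_stable (h := h)) _ (mem_hits h).
Qed.

End PointedStructure.

(** * Algebras given by generators and relations *)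

Section AlgebraMaps.
Variables (F : fieldType) (A B : pzAlgType F) (f : A -> B).
Hypotheses (fL : linear f) (f1 : f 1 = 1) (fM : {morph f : x y / x * y}).

Fact alghom_zmod : zmod_morphism f.
Proof. exact: (raddfB (linear_pack fL)). Qed.

Fact alghom_monoid : monoid_morphism f.
Proof. by split. Qed.

Fact alghom_scalable : scalable f.
Proof. exact: (linearZ_LR (linear_pack fL)). Qed.

Definition alghom_pack : {alghom A -> B} := HB.pack f
  (GRing.isZmodMorphism.Build A B f alghom_zmod)
  (GRing.isMonoidMorphism.Build A B f alghom_monoid)
  (RMorphism_isPzAlgHom.Build F A B *:%R f alghom_scalable).

End AlgebraMaps.

HB.lock Definition mkalghom (F : fieldType) (A B : pzAlgType F) (f : A -> B)
  (fL : linear f) (f1 : f 1 = 1) (fM : {morph f : x y / x * y}) :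
  {alghom A -> B} := alghom_pack fL f1 fM.

Lemma mkalghomE (F : fieldType) (A B : pzAlgType F) (f : A -> B)
    (fL : linear f) (f1 : f 1 = 1) (fM : {morph f : x y / x * y}) x :
  mkalghom fL f1 fM x = f x.
Proof. by rewrite mkalghom.unlock. Qed.

Section AlgebraMapTheory.
Variables (F : fieldType) (A B : pzAlgType F) (phi : {alghom A -> B}).

Lemma ah0 : phi 0 = 0. Proof. exact: raddf0. Qed.
Lemma ahD x y : phi (x + y) = phi x + phi y. Proof. exact: raddfD. Qed.
Lemma ahN x : phi (- x) = - phi x. Proof. exact: raddfN. Qed.
Lemma ahB x y : phi (x - y) = phi x - phi y. Proof. exact: raddfB. Qed.
Lemma ahZ a x : phi (a *: x) = a *: phi x. Proof. exact: linearZ_LR. Qed.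
Lemma ah1 : phi 1 = 1. Proof. exact: rmorph1. Qed.
Lemma ahM x y : phi (x * y) = phi x * phi y. Proof. exact: rmorphM. Qed.
Lemma ahX x n : phi (x ^+ n) = phi x ^+ n. Proof. exact: rmorphXn. Qed.
Lemma ah_sum (I : Type) (r : seq I) (P : pred I) (f : I -> A) :
  phi (\sum_(i <- r | P i) f i) = \sum_(i <- r | P i) phi (f i).
Proof. exact: raddf_sum. Qed.
Lemma ah_prod (I : Type) (r : seq I) (f : I -> A) :
  phi (\prod_(i <- r) f i) = \prod_(i <- r) phi (f i).
Proof. exact: rmorph_prod. Qed.
Lemma ah_linear : linear phi.
Proof. by move=> a x y; rewrite ahD ahZ. Qed.
Lemma ah_tlift (U V : lmodType F) (f : U -> V -> A) t :
  phi (tlift t f) = \tsum_(u, v <- t) phi (f u v).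
Proof. exact: (linear_tlift (linear_pack ah_linear)). Qed.

End AlgebraMapTheory.

Section AlgebraMapComposition.
Variables (F : fieldType) (A B C : pzAlgType F).
Variables (psi : {alghom B -> C}) (phi : {alghom A -> B}).

Fact ah_comp_linear : linear (psi \o phi).
Proof. by move=> a x y /=; rewrite !ah_linear. Qed.
Fact ah_comp1 : (psi \o phi) 1 = 1.
Proof. by rewrite /= !ah1. Qed.
Fact ah_compM : {morph psi \o phi : x y / x * y}.
Proof. by move=> x y /=; rewrite !ahM. Qed.

Definition ah_comp : {alghom A -> C} := mkalghom ah_comp_linear ah_comp1 ah_compM.
Lemma ah_compE x : ah_comp x = psi (phi x). Proof. exact: mkalghomE. Qed.

End AlgebraMapComposition.

Section FreeAlgebraLift.
Variables (F : fieldType) (X : choiceType) (B : pzAlgType F) (f : X -> B).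
Local Notation msupp := monalg.msupp.
Local Notation mcoeff := monalg.mcoeff.
Local Notation mU := monalg.mkmalgU.

Definition fmonom_eval (m : monalg.fmonom X) : B :=
  \prod_(x <- monalg.fmonom_val m) f x.

Definition freealg_eval (g : freealg F X) : B :=
  \sum_(m <- finmap.enum_fset (msupp g)) mcoeff m g *: fmonom_eval m.

Lemma freealg_evalE d g : finmap.fsubset (msupp g) d ->
  freealg_eval g = \sum_(m <- finmap.enum_fset d) mcoeff m g *: fmonom_eval m.
Proof.
move=> le; rewrite /freealg_eval; apply: finmap.big_fset_incl => // m _.
by move=> /monalg.mcoeff_outdom ->; rewrite scale0r.
Qed.

Lemma freealg_eval_linear : linear freealg_eval.
Proof.
move=> a x y.
rewrite (@freealg_evalE (finmap.fsetU (msupp x) (msupp y))); last first.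
  apply: finmap.fsubset_trans (monalg.msuppD_le _ _) _.
  by apply: finmap.fsetUSS => //; exact: monalg.msuppZ_le.
rewrite (@freealg_evalE (finmap.fsetU (msupp x) (msupp y)) x) ?finmap.fsubsetUl //.
rewrite (@freealg_evalE (finmap.fsetU (msupp x) (msupp y)) y) ?finmap.fsubsetUr //.
rewrite scaler_sumr -big_split /=; apply: eq_bigr => k _.
by rewrite monalg.mcoeffD monalg.mcoeffZ scalerDl scalerA.
Qed.

Lemma freealg_evalU c m : freealg_eval (mU m c) = c *: fmonom_eval m.
Proof.
by rewrite (freealg_evalE monalg.msuppU_le) finmap.big_seq_fset1 monalg.mcoeffUU.
Qed.

Lemma fmonom_evalM (m m' : monalg.fmonom X) : 
  fmonom_eval (monalg.fmmul m m') = fmonom_eval m * fmonom_eval m'.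
Proof. by rewrite /fmonom_eval monalg.fmmulE big_cat. Qed.

Lemma freealg_evalM : {morph freealg_eval : x y / x * y}.
Proof.
pose L := linear_pack freealg_eval_linear.
move=> x y; rewrite [x * y]monalg.malgME.
rewrite -[LHS]/(L _) linear_sum [in RHS]/freealg_eval mulr_suml; apply: eq_bigr => m _.
rewrite linear_sum mulr_sumr; apply: eq_bigr => m' _.
rewrite [LHS]freealg_evalU [fmonom_eval _](fmonom_evalM m m').
by rewrite -pzscalerAl -pzscalerAr scalerA.
Qed.

Lemma freealg_eval1 : freealg_eval 1 = 1.
Proof.
rewrite -[1 in LHS]/(mU _ 1) freealg_evalU scale1r /fmonom_eval.
by rewrite monalg.fm1 big_nil.
Qed.

Lemma freealg_lift :
  exists phi : {alghom freealg F X -> B}, forall x, phi (fgen F x) = f x.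
Proof.
exists (mkalghom freealg_eval_linear freealg_eval1 freealg_evalM) => x.
by rewrite mkalghomE freealg_evalU scale1r /fmonom_eval monalg.fmU big_seq1.
Qed.

End FreeAlgebraLift.

Section QuotientLift.
Variables (F : fieldType) (A B : pzAlgType F).

Lemma ker_two_sided (phi : {alghom A -> B}) : two_sided_ideal [set a | phi a = 0].
Proof.
split; last by move=> a x /= x0; rewrite !ahM x0 mulr0 mul0r.
by split=> [|a x y /= x0 y0]; rewrite /= ?ah0 // ah_linear x0 y0 scaler0 addr0.
Qed.

Lemma quotalg_lift (X : set A) (phi : {alghom A -> B}) :
  (forall x, X x -> phi x = 0) ->
  exists psi : {alghom quotalg X -> B}, forall a, psi (qalg X a) = phi a.
Proof.
move=> phiX; pose psi (u : quotalg X) := phi (repr u).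
have psiE a : psi (qalg X a) = phi a.
  apply/eqP; rewrite -subr_eq0 -ahB; apply/eqP.
  by apply: (ideal_min (ker_two_sided phi) phiX); apply/qalgP; rewrite qalg_repr.
have psiL : linear psi.
  move=> k u v; have [x ->] := @qalg_surj _ _ X u; have [y ->] := @qalg_surj _ _ X v.
  by rewrite -qalgZ -qalgD !psiE ah_linear.
have psi1 : psi 1 = 1 by rewrite -[1 in LHS]/(qalg X 1) psiE ah1.
have psiM : {morph psi : u v / u * v}.
  move=> u v; have [x ->] := @qalg_surj _ _ X u; have [y ->] := @qalg_surj _ _ X v.
  by rewrite -qalgM !psiE ahM.
by exists (mkalghom psiL psi1 psiM) => a; rewrite mkalghomE psiE.
Qed.

Lemma qalgB (X : set A) x y : qalg X (x - y) = qalg X x - qalg X y.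
Proof. exact: raddfB. Qed.

Lemma qalg_rel0 (X : set A) x : X x -> qalg X x = 0.
Proof.
move=> Xx; rewrite -[0]/(qalg X 0); apply/qalgP; rewrite subr0.
exact: sub_ideal.
Qed.

End QuotientLift.

Section RelationsLift.
Variables (F : fieldType) (B : pzAlgType F).

Lemma linear_rel_linear (B' V : lmodType F) (f : V -> B) (p : {linear B -> B'}) :
  (forall r, linear_rel f r -> p r = 0) -> linear (p \o f).
Proof.
move=> pr a u v; apply/eqP; rewrite -subr_eq0; apply/eqP => /=.
by rewrite -linearP -linearB; apply: pr; exists a, u, v.
Qed.

Lemma linear_rel_ker (B' : lmodType F) (V : lmodType F) (f : V -> B)
    (g : V -> B') (p : {linear B -> B'}) :
  (forall v, p (f v) = g v) -> linear g -> forall r, linear_rel f r -> p r = 0.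
Proof.
move=> pf gL _ [a [u [v ->]]].
by rewrite linearB linearD linearZ_LR !pf gL subrr.
Qed.

End RelationsLift.

Section TensorAlgebraLift.
Variables (F : fieldType) (V : lmodType F).

Lemma tvec_linear : linear (@tvec F V).
Proof.
pose p : {linear freealg F V -> tensoralg V} := qalg (linear_rel (@fgen F V)).
apply: (linear_rel_linear (p := p)) => r rr; exact: qalg_rel0.
Qed.

Lemma tensoralg_lift (B : pzAlgType F) (f : V -> B) : linear f ->
  exists phi : {alghom tensoralg V -> B}, forall v, phi (tvec v) = f v.
Proof.
move=> fL; have [phi phiE] := freealg_lift f.
have [|psi psiE] := quotalg_lift (phi := phi) (X := linear_rel (@fgen F V)).
  exact: (linear_rel_ker (p := phi) phiE fL).
by exists psi => v; rewrite psiE.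
Qed.

End TensorAlgebraLift.

Lemma alghom_rel_ker (F : fieldType) (A E C : pzAlgType F) (f : A -> C) (p : {alghom C -> E})
    (phi : {alghom A -> E}) :
  (forall a, p (f a) = phi a) -> forall r, alghom_rel f r -> p r = 0.
Proof.
move=> pf r [[rl|->]|[x [y ->]]].
- exact: (linear_rel_ker (p := linear_pack (ah_linear p)) pf (ah_linear phi) rl).
- by rewrite ahB pf !ah1 subrr.
- by rewrite ahB ahM !pf ahM subrr.
Qed.

Section FreeProductLift.
Variables (F : fieldType) (A B E : pzAlgType F).

Lemma freeprod_lift (phiA : {alghom A -> E}) (phiB : {alghom B -> E}) :
  exists psi : {alghom freeprod A B -> E},
    (forall a, psi (fp_inl B a) = phiA a) /\ (forall b, psi (fp_inr A b) = phiB b).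
Proof.
pose f (x : (A + B)%type) := match x with inl a => phiA a | inr b => phiB b end.
have [phi phiE] := freealg_lift f.
have [|psi psiE] := quotalg_lift (phi := phi) (X := @freeprod_rel F A B).
  by move=> r [/(alghom_rel_ker (phi := phiA))|/(alghom_rel_ker (phi := phiB))];
    apply=> a; exact: phiE.
by exists psi; split=> x; rewrite psiE phiE.
Qed.

End FreeProductLift.

Lemma alghom_of_rel (F : fieldType) (A B : pzAlgType F) (X : set B) (f : A -> B) :
  alghom_rel f `<=` gen_ideal X ->
  exists phi : {alghom A -> quotalg X}, forall a, phi a = qalg X (f a).
Proof.
move=> fX; have zero r : alghom_rel f r -> qalg X r = 0.
  by move=> /fX rX; rewrite -[0]/(qalg X 0); apply/qalgP; rewrite subr0.
pose g a := qalg X (f a).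
have gL : linear g.
  apply: (linear_rel_linear (p := qalg X)) => r rr; apply: zero; left; left.
  exact: rr.
have g1 : g 1 = 1.
  have := zero (f 1 - 1) (or_introl (or_intror erefl)).
  by rewrite qalgB => /eqP; rewrite subr_eq0 => /eqP.
have gM : {morph g : x y / x * y}.
  move=> x y; have := zero (f (x * y) - f x * f y) (or_intror (ex_intro _ x (ex_intro _ y erefl))).
  by rewrite qalgB qalgM => /eqP; rewrite subr_eq0 => /eqP.
by exists (mkalghom gL g1 gM) => a; rewrite mkalghomE.
Qed.

Section SmashLift.
Variables (F : fieldType) (H : hopfAlg F) (V : orthModule H) (B : pzAlgType F).
Variable j : V -> B.

Lemma smash_lift (E : pzAlgType F) (phiB : {alghom B -> E}) (phiH : {alghom H -> E}) :
  (forall h v, phiH h * phiB (j v)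
     = \tsum_(a, b <- comul h) (phiB (j (orth_act a v)) * phiH b)) ->
  exists psi : {alghom smash j -> E},
    (forall b, psi (smash_inl j b) = phiB b) /\ (forall h, psi (smash_inr j h) = phiH h).
Proof.
move=> rel; have [phi [phil phir]] := freeprod_lift phiB phiH.
have [|psi psiE] := quotalg_lift (phi := phi) (X := smash_rel j).
  move=> _ [h [v ->]]; rewrite ahB ahM phil phir rel ah_tlift.
  apply/eqP; rewrite subr_eq0; apply/eqP; apply: eq_tlift => a b.
  by rewrite ahM phil phir.
by exists psi; split=> x; rewrite psiE.
Qed.

Lemma smash_inl_alghom : exists phi : {alghom B -> smash j}, forall b, phi b = smash_inl j b.
Proof.
have [|phi phiE] := @alghom_of_rel _ B _ (@freeprod_rel F B H) (fun b : B => fgen F (inl b)).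
  by move=> r rr; apply: sub_ideal; left.
by exists (ah_comp (qalg (smash_rel j)) phi) => b; rewrite ah_compE phiE.
Qed.

Lemma smash_inr_alghom : exists phi : {alghom H -> smash j}, forall h, phi h = smash_inr j h.
Proof.
have [|phi phiE] := @alghom_of_rel _ H _ (@freeprod_rel F B H) (fun b : H => fgen F (inr b)).
  by move=> r rr; apply: sub_ideal; right.
by exists (ah_comp (qalg (smash_rel j)) phi) => b; rewrite ah_compE phiE.
Qed.

Lemma smash_commute h v : smash_inr j h * smash_inl j (j v)
  = \tsum_(a, b <- comul h) (smash_inl j (j (orth_act a v)) * smash_inr j b).
Proof.
have := qalg_rel0 (X := smash_rel j) (ex_intro _ h (ex_intro _ v erefl)).
rewrite qalgB qalgM (ah_tlift (qalg (smash_rel j))) => /eqP.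
rewrite subr_eq0 => /eqP E; apply: etrans E _; apply: eq_tlift => a b.
exact: qalgM.
Qed.

End SmashLift.

(** * A module that evaluates symbols in the smash product of S(V) and H *)

Section EndomorphismAlgebra.
Variables (F : fieldType) (V : lmodType F).

Record endo := Endo { endo_fun :> V -> V; endo_linear : linear endo_fun }.

Lemma endo_ext (f g : endo) : f =1 g -> f = g.
Proof.
case: f g => [f fL] [g gL] /= /funext fg; move: fL gL; rewrite fg => fL gL.
by rewrite (Prop_irrelevance fL gL).
Qed.

HB.instance Definition _ := gen_eqMixin endo.
HB.instance Definition _ := gen_choiceMixin endo.

Fact endo_add_linear (f g : endo) : linear (fun x => f x + g x).
Proof.
by move=> a x y; rewrite (endo_linear f) (endo_linear g) scalerDr addrACA.
Qed.
Fact endo_opp_linear (f : endo) : linear (fun x => - f x).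
Proof. by move=> a x y; rewrite (endo_linear f) opprD scalerN. Qed.
Fact endo_zero_linear : linear (fun _ : V => 0 : V).
Proof. by move=> a x y; rewrite scaler0 addr0. Qed.
Fact endo_id_linear : linear (fun x : V => x).
Proof. by []. Qed.
Fact endo_scale_linear (c : F) (f : endo) : linear (fun x => c *: f x).
Proof.
by move=> a x y; rewrite (endo_linear f) scalerDr !scalerA mulrC.
Qed.
Fact endo_mul_linear (f g : endo) : linear (fun x => g (f x)).
Proof. by move=> a x y; rewrite (endo_linear f) (endo_linear g). Qed.

Definition endo_add f g := Endo (endo_add_linear f g).
Definition endo_opp f := Endo (endo_opp_linear f).
Definition endo_zero := Endo endo_zero_linear.
Definition endo_one := Endo endo_id_linear.
Definition endo_scale c f := Endo (endo_scale_linear c f).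
(* The product is the reversed composition: algebra maps to [endo] are right
   actions. *)
Definition endo_mul f g := Endo (endo_mul_linear f g).

Fact endo_addA : associative endo_add.
Proof. by move=> f g h; apply: endo_ext => x /=; rewrite addrA. Qed.
Fact endo_addC : commutative endo_add.
Proof. by move=> f g; apply: endo_ext => x /=; rewrite addrC. Qed.
Fact endo_add0 : left_id endo_zero endo_add.
Proof. by move=> f; apply: endo_ext => x /=; rewrite add0r. Qed.
Fact endo_addN : left_inverse endo_zero endo_opp endo_add.
Proof. by move=> f; apply: endo_ext => x /=; rewrite addNr. Qed.
HB.instance Definition _ :=
  GRing.isZmodule.Build endo endo_addA endo_addC endo_add0 endo_addN.

Fact endo_mulA : associative endo_mul.
Proof. by move=> f g h; apply: endo_ext. Qed.
Fact endo_mul1l : left_id endo_one endo_mul.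
Proof. by move=> f; apply: endo_ext. Qed.
Fact endo_mul1r : right_id endo_one endo_mul.
Proof. by move=> f; apply: endo_ext. Qed.
Fact endo_mulDl : left_distributive endo_mul +%R.
Proof.
move=> f g h; apply: endo_ext => x /=; rewrite -[f x]scale1r (endo_linear h).
by rewrite !scale1r.
Qed.
Fact endo_mulDr : right_distributive endo_mul +%R.
Proof. by move=> f g h; apply: endo_ext. Qed.
HB.instance Definition _ := GRing.Zmodule_isPzRing.Build endo
  endo_mulA endo_mul1l endo_mul1r endo_mulDl endo_mulDr.

Fact endo_scaleA a b f : endo_scale a (endo_scale b f) = endo_scale (a * b) f.
Proof. by apply: endo_ext => x /=; rewrite scalerA. Qed.
Fact endo_scale1 : left_id 1 endo_scale.
Proof. by move=> f; apply: endo_ext => x /=; rewrite scale1r. Qed.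
Fact endo_scaleDr : right_distributive endo_scale +%R.
Proof. by move=> a f g; apply: endo_ext => x /=; rewrite scalerDr. Qed.
Fact endo_scaleDl f : {morph endo_scale^~ f : a b / a + b}.
Proof. by move=> a b; apply: endo_ext => x /=; rewrite scalerDl. Qed.
HB.instance Definition _ := GRing.Zmodule_isLmodule.Build F endo
  endo_scaleA endo_scale1 endo_scaleDr endo_scaleDl.

Fact endo_scaleAl (a : F) (f g : endo) : a *: (f * g) = (a *: f) * g.
Proof.
apply: endo_ext => x /=; have g0 : g 0 = 0.
  by have := endo_linear g (-1) 0 0; rewrite scaler0 addr0 scaleN1r addNr.
change (a *: g (f x) = g (a *: f x)).
by rewrite -[a *: f x]addr0 (endo_linear g) g0 addr0.
Qed.
Fact endo_scaleAr (a : F) (f g : endo) : a *: (f * g) = f * (a *: g).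
Proof. by apply: endo_ext. Qed.
HB.instance Definition _ := PzRing_isPzAlgebra.Build F endo
  (@scalerA F endo) (@scale0r F endo) (@scale1r F endo)
  (@scalerDr F endo) (@scalerDl F endo) endo_scaleAl endo_scaleAr.

End EndomorphismAlgebra.

Section Evaluation.
Variables (F : fieldType) (H : hopfAlg F) (V : orthModule H).
Hypothesis coco : cocommutative H.
Variable xi : {linear V -> F^o}.

Lemma matrix_coef_linear (v : V) : linear (fun h : H => xi (orth_act h v)).
Proof. by move=> a x y; rewrite ((orth_act_bilin V).1 v) linearP. Qed.

Definition matrix_coef v : {linear H -> F^o} := mklin (matrix_coef_linear v).

Definition endo_of (L : {linear H -> H}) : endo H := Endo (fun a x y => linearP L a x y).
(** With [rho_H], this is the right module over the smash product induced from the character of S(V)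
    given by [xi], realized on [H]: a vector [v] acts through its matrix coefficient. *)
Definition rho_V v : endo H := endo_of (hit (matrix_coef v)).
Definition rho_H h : endo H := endo_of (rmul h).

Lemma rho_H_linear : linear rho_H.
Proof.
move=> a x y; apply: endo_ext => z.
change (rmul (a *: x + y) z = a *: rmul x z + rmul y z).
by rewrite !rmulE mulrDr pzscalerAr.
Qed.
Lemma rho_H1 : rho_H 1 = 1.
Proof. by apply: endo_ext => z; change (rmul 1 z = z); rewrite rmulE mulr1. Qed.
Lemma rho_HM : {morph rho_H : x y / x * y}.
Proof.
move=> x y; apply: endo_ext => z; change (rmul (x * y) z = rmul y (rmul x z)).
by rewrite !rmulE mulrA.
Qed.

Lemma rho_V_linear : linear rho_V.
Proof.
move=> a v w; apply: endo_ext => z.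
change (hit (matrix_coef (a *: v + w)) z
  = a *: hit (matrix_coef v) z + hit (matrix_coef w) z).
rewrite hit_comb; apply: eq_hit => h /=; rewrite !mklinE.
by rewrite ((orth_act_bilin V).2 h) linearP.
Qed.

Lemma rho_VC v w : rho_V v * rho_V w = rho_V w * rho_V v.
Proof. by apply: endo_ext => z; exact: hitC. Qed.

(** In the coproduct of [z h], the coefficient of [v] at [z_(1) h_(1)] is the coefficient of
    [h_(1) v] at [z_(1)]. *)
Lemma rho_HV h v :
  rho_H h * rho_V v = \tsum_(a, b <- comul h) (rho_V (orth_act a v) * rho_H b).
Proof.
apply: endo_ext => z.
have evalz : linear (fun f : endo H => f z) by [].
rewrite [RHS](linear_tlift (linear_pack evalz)).
change (hit (matrix_coef v) (rmul h z)
  = \tsum_(a, b <- comul h) rmul b (hit (matrix_coef (orth_act a v)) z)).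
rewrite rmulE -(comul_sliceL coco) comulM.
rewrite -[X in _ * X](tlift_tens (comul h)).
rewrite -[X in sliceL _ X]/(linear_pack (tmul_linearr (comul z)) _).
rewrite -[LHS]/((sliceL (matrix_coef v) \o linear_pack (tmul_linearr (comul z))) _).
rewrite linear_tlift; apply: eq_tlift => a b.
rewrite rmulE -(comul_sliceL coco).
change (sliceL (matrix_coef v) (comul z * (a ⊗ b))
  = sliceL (matrix_coef (orth_act a v)) (comul z) * b).
move: (comul z) => t.
pose L := sliceL (matrix_coef v) \o linear_pack (tmul_linearl (a ⊗ b)).
pose R := rmul b \o @sliceL F H H (matrix_coef (orth_act a v)).
transitivity (L t); first by [].
transitivity (R t); last by rewrite [LHS]rmulE.
apply: tensor_linear_eq => c d.
transitivity (sliceL (matrix_coef v) ((c ⊗ d) * (a ⊗ b))); first by [].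
rewrite [RHS]rmulE tensM !sliceLE -pzscalerAl !mklinE.
by rewrite orth_actM.
Qed.

(* The linear functional xi extends to a character of S(V); the value at 1 of the
   induced right action of S(V) x| H on H is xi(s) h for s h in S(V) x| H. *)
Lemma SH_eval : exists ev : {linear SH V -> H}, forall v n h,
  ev (SH_S (symproj (tvec v ^+ n)) * SH_H V h) = (xi v : F) ^+ n *: h.
Proof.
have [phiT phiTE] := tensoralg_lift rho_V_linear.
have [|phiS phiSE] := quotalg_lift (phi := phiT) (X := [set r | exists v w : V,
    r = tvec v * tvec w - tvec w * tvec v]).
  by move=> _ [v [w ->]]; rewrite ahB !ahM !phiTE rho_VC subrr.
have [|psi [psiS psiH]] := @smash_lift _ _ _ _ (fun v : V => symproj (tvec v)) _ phiS
    (mkalghom rho_H_linear rho_H1 rho_HM).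
  move=> h v; rewrite mkalghomE phiSE phiTE rho_HV; apply: eq_tlift => a b.
  by rewrite mkalghomE phiSE phiTE.
have eval1 : linear (fun f : endo H => f 1) by [].
exists (linear_pack eval1 \o linear_pack (ah_linear psi)) => v n h.
change ((psi (SH_S (symproj (tvec v ^+ n)) * SH_H V h) : endo H) 1 = (xi v : F) ^+ n *: h).
rewrite ahM psiS psiH mkalghomE phiSE ahX phiTE.
change (rmul h ((rho_V v ^+ n : endo H) 1) = (xi v : F) ^+ n *: h).
have -> : (rho_V v ^+ n : endo H) 1 = (xi v : F) ^+ n *: (1 : H).
  elim: n => [|n IH]; first by rewrite expr0 scale1r.
  rewrite exprSr; change (hit (matrix_coef v) ((rho_V v ^+ n : endo H) 1) = xi v ^+ n.+1 *: (1 : H)).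
  rewrite IH linearZ_LR hitS comul1 sliceRE mklinE orth_act1 scalerA.
  by rewrite exprSr.
by rewrite rmulE -pzscalerAl mul1r.
Qed.

End Evaluation.

(** * Hopf-Hecke algebras and Clifford algebras *)

Section SpanningMonomials.
Import finmap monalg.
Variables (F : fieldType) (X : choiceType).

Lemma fmonomE (m : {fmonom X}) :
  (<< m >> : freealg F X) = \prod_(x <- fmonom_val m) fgen F x.
Proof.
case: m => s /=; elim: s => [|x s IH].
  by rewrite big_nil -(@fmoneE X).
rewrite big_cons -IH /fgen [RHS]malgM_def fgmulUU mulr1.
by congr << _ >>; apply: val_inj; rewrite [RHS]fmM fmU.
Qed.

Lemma freealg_span (g : freealg F X) :
  linspan [set \prod_(x <- xs) fgen F x | xs in [set: seq X]] g.
Proof.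
rewrite [g]monalgE; apply: subspace_sum => [|m _]; first exact: span_subspace.
have -> : << g@_m *g m >> = g@_m *: (<< m >> : freealg F X).
  by apply/malgP => k; rewrite mcoeffZ !mcoeffU mulr_natr.
apply: (subspaceZ _ (span_subspace _)).
by apply: Defs.sub_span; exists (fmonom_val m); rewrite // fmonomE.
Qed.

End SpanningMonomials.

(* Stated for an abstract algebra with the relations of [hecke kappa], because
   unification would unfold the latter down to the free algebra. *)
Section HeckeRelations.
Variables (F : fieldType) (H : hopfAlg F) (V : orthModule H) (A : pzAlgType F).
Variables (hV : V -> A) (hH : {alghom H -> A}) (kap : V -> V -> H).
Hypothesis char0 : [pchar F] =i pred0.
Hypothesis hV_linear : linear hV.
Hypothesis hH_V : forall h v,
  hH h * hV v = \tsum_(a, b <- comul h) (hV (orth_act a v) * hH b).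
Hypothesis hV_comm : forall v w, hV v * hV w = hV w * hV v + hH (kap v w).

(** The index is shifted as in [hecke_fil]: degree at most [n] is [fil n.+1], and [fil 0] is
    zero. *)
Definition fil n : set A := linspan
  [set x | exists vs h, (size vs < n)%N /\ x = \prod_(v <- vs) hV v * hH h].

Lemma fil_subspace n : subspace (fil n).
Proof. exact: span_subspace. Qed.
Hint Resolve fil_subspace : core.

Lemma fil_le m n : (m <= n)%N -> fil m `<=` fil n.
Proof.
move=> mn; apply: linspan_sub => _ [vs [h [sm ->]]].
by exists vs, h; split=> //; apply: leq_trans mn.
Qed.

Lemma fil_prod vs h n : (size vs < n)%N -> fil n (\prod_(v <- vs) hV v * hH h).
Proof. by move=> sn; apply: Defs.sub_span; exists vs, h. Qed.

Lemma filV n v x : fil n x -> fil n.+1 (hV v * x).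
Proof.
rewrite -lmulE; apply: span_map => // _ [vs [h [sn ->]]].
rewrite lmulE mulrA; have -> : hV v * \prod_(w <- vs) hV w = \prod_(w <- v :: vs) hV w.
  by rewrite big_cons.
exact: fil_prod.
Qed.

Lemma filHr n h x : fil n x -> fil n (x * hH h).
Proof.
rewrite -rmulE; apply: span_map => // _ [vs [h' [sn ->]]].
by rewrite rmulE -mulrA -ahM; exact: fil_prod.
Qed.

Lemma fil_H h n : fil n.+1 (hH h).
Proof. by have := @fil_prod [::] h n.+1; rewrite big_nil mul1r; apply. Qed.

Lemma filHl n h x : fil n x -> fil n (hH h * x).
Proof.
rewrite -lmulE; apply: span_map => // _ [vs [h' [sn ->]]]; rewrite lmulE.
elim: vs n sn h => [|v vs IH] [|n] //= sn h.
  by rewrite big_nil mul1r -ahM; exact: fil_H.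
rewrite big_cons -(mulrA (hV v)) mulrA hH_V.
rewrite -rmulE linear_tlift; apply: tlift_subspace => // a b.
by rewrite rmulE -mulrA; apply: filV; apply: IH.
Qed.

Lemma fil_exp v n h : fil n.+1 (hV v ^+ n * hH h).
Proof.
have -> : hV v ^+ n = \prod_(w <- nseq n v) hV w by rewrite big_nseq iter_mulr mulr1.
by apply: fil_prod; rewrite size_nseq.
Qed.

Lemma fil_exp1 v n : fil n.+1 (hV v ^+ n).
Proof. by have := @fil_exp v n 1; rewrite ah1 mulr1. Qed.

(** Each transposition of [v] and [w] costs a commutator in [H], which lowers the degree by two. *)
Lemma fil_swap v w a b :
  fil (a + b) (hV v ^+ a * hV w * hV v ^+ b - hV w * hV v ^+ (a + b)).
Proof.
elim: a => [|a IH]; first by rewrite mul1r subrr; exact: (fil_subspace _).1.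
set x := _ - _ in IH *.
have -> : hV v ^+ a.+1 * hV w * hV v ^+ b - hV w * hV v ^+ (a.+1 + b)
    = hV v * x + hH (kap v w) * hV v ^+ (a + b).
  rewrite /x mulrBr !mulrA -exprS (hV_comm v w) mulrDl opprD addrA.
  by rewrite subrK -(mulrA (hV w)) -exprS.
rewrite addSn; apply: (subspaceD (fil_subspace _)); first exact: filV.
by apply: filHl; apply: fil_exp1.
Qed.

Lemma fil_dpow v w n :
  fil n (dpow (hV v) (hV w) n.+1 - n.+1%:R *: (hV w * hV v ^+ n)).
Proof.
elim: n => [|n IH].
  by rewrite /= mulr0 add0r scale1r subrr; exact: (fil_subspace _).1.
set x := _ - _ in IH.
have -> : dpow (hV v) (hV w) n.+2 - n.+2%:R *: (hV w * hV v ^+ n.+1)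
    = hV v * x + n.+1%:R *: (hV v ^+ 1 * hV w * hV v ^+ n - hV w * hV v ^+ (1 + n)).
  rewrite -[dpow _ _ n.+2]/(hV v * dpow (hV v) (hV w) n.+1 + hV w * hV v ^+ n.+1).
  rewrite /x mulrBr -pzscalerAr scalerBr mulrA expr1 addrA subrK add1n.
  rewrite -[n.+2]addn1 natrD scalerDl scale1r opprD addrA.
  by rewrite addrAC addrK.
apply: (subspaceD (fil_subspace _)); first exact: filV.
apply: (subspaceZ _ (fil_subspace _)).
exact: (@fil_swap v w 1 n).
Qed.

(** Up to lower degree, [w v^m] is a multiple of the coefficient of [t] in [(v + t w)^(m+1)]. That
    coefficient is a combination of values of the polynomial, which are powers of single vectors. *)
Lemma fil_powers n : fil n `<=` linspan
  [set x | exists m v h, (m < n)%N /\ x = hV v ^+ m * hH h].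
Proof.
elim: n => [|n IH]; first by apply: span_min => [|_ [vs [h []]]//]; exact: span_subspace.
set S := linspan _ in IH; set S' := linspan _.
have sS' : subspace S' by exact: span_subspace.
have SS' : S `<=` S'.
  apply: linspan_sub => _ [m [v [h [mn ->]]]]; exists m, v, h; split=> //.
  exact: ltnW.
have pow_step v m w h : (m < n)%N -> S' (hV w * (hV v ^+ m * hH h)).
  move=> mn; apply: (@subspaceZr _ _ _ m.+1%:R _ sS').
    by rewrite ((pcharf0P F).1 char0).
  have := filHr h (@fil_dpow v w m).
  move=> /(fil_le (ltnW mn))/IH/SS' /(subspaceN sS').
  rewrite mulrBl opprB -pzscalerAl -mulrA => E; apply: (subspaceBr sS' _ E).
  have [P [_ <- PE]] := exprD_scale (hV v) (hV w) m.+1.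
  apply: (poly_coef_subspace (n := m.+3) (a := fun k => P k * hH h) char0 sS') => // t.
  have -> : \sum_(k < m.+3) t ^+ k *: (P k * hH h) = hV (t *: w + v) ^+ m.+1 * hH h.
    rewrite hV_linear addrC PE mulr_suml; apply: eq_bigr => k _.
    by rewrite pzscalerAl.
  by apply: Defs.sub_span; exists m.+1, (t *: w + v), h; split.
apply: span_min => // _ [[|w vs] [h [sn ->]]].
  by apply: Defs.sub_span; exists 0, 0, h; rewrite big_nil.
rewrite big_cons -mulrA -lmulE.
apply: (span_map (L := lmul (hV w)) sS' _ (IH _ (fil_prod h (sn : (size vs < n)%N)))).
by move=> _ [m [v [h' [mn ->]]]]; rewrite lmulE; apply: pow_step.
Qed.

End HeckeRelations.

Section HeckeAlgebra.
Variables (F : fieldType) (H : hopfAlg F) (V : orthModule H).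
Variable kappa : {linear wedge2 V -> H}.
Local Notation A := (hecke kappa).
Local Notation hV := (hecke_V kappa).

Lemma hecke_T_alghom : exists phi : {alghom tensoralg V -> A},
  forall t, phi t = hecke_T kappa t.
Proof.
have [phi phiE] := smash_inl_alghom (@tvec F V).
by exists (ah_comp (qalg (hecke_rel kappa)) phi) => t; rewrite ah_compE phiE.
Qed.

Lemma hecke_H_alghom : exists phi : {alghom H -> A}, forall h, phi h = hecke_H kappa h.
Proof.
have [phi phiE] := smash_inr_alghom (@tvec F V).
by exists (ah_comp (qalg (hecke_rel kappa)) phi) => t; rewrite ah_compE phiE.
Qed.

Definition hT : {alghom tensoralg V -> A} := sval (cid hecke_T_alghom).
Definition hHa : {alghom H -> A} := sval (cid hecke_H_alghom).
Lemma hTE t : hT t = hecke_T kappa t.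
Proof. exact: (svalP (cid hecke_T_alghom)). Qed.
Lemma hHaE h : hHa h = hecke_H kappa h.
Proof. exact: (svalP (cid hecke_H_alghom)). Qed.

Lemma hV_linear : linear hV.
Proof. by move=> a v w; rewrite /hecke_V -!hTE tvec_linear ah_linear. Qed.

Lemma hecke_T_prod vs : hecke_T kappa (\prod_(v <- vs) tvec v) = \prod_(v <- vs) hV v.
Proof. by rewrite -hTE ah_prod; apply: eq_bigr => v _; rewrite hTE. Qed.

Lemma hHa_V h v : hHa h * hV v = \tsum_(a, b <- comul h) (hV (orth_act a v) * hHa b).
Proof.
rewrite hHaE -[LHS]/(qalg _ (TH_H V h) * qalg _ (TH_T (tvec v))).
rewrite -qalgM [TH_H V h * _]smash_commute.
rewrite (ah_tlift (qalg (hecke_rel kappa))); apply: eq_tlift => a b.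
by rewrite hHaE; exact: qalgM.
Qed.

Lemma hV_comm v w : hV v * hV w = hV w * hV v + hHa (kappa (wedge v w)).
Proof.
have := qalg_rel0 (X := hecke_rel kappa) (ex_intro _ v (ex_intro _ w erefl)).
rewrite !qalgB !qalgM => /eqP; rewrite -addrA -opprD subr_eq0 => /eqP.
by rewrite hHaE; exact.
Qed.

Lemma hecke_filE n : hecke_fil n = fil hV hHa n.
Proof.
apply/seteqP; split; apply: span_min; try exact: span_subspace.
  move=> _ [k [t [h [kn tk ->]]]]; rewrite -hTE -rmulE.
  apply: (@span_map _ _ _ (linear_pack (ah_linear hT)) _
    [set x | fil hV hHa n (rmul (hecke_H kappa h) x)] t _ _ tk).
    exact: (subspace_preim _ (fil_subspace _ _ _)).
  move=> _ [vs vsk <-]; change (fil hV hHa n (rmul (hecke_H kappa h) (hT (\prod_(v <- vs) tvec v)))).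
  rewrite rmulE hTE hecke_T_prod -hHaE.
  by apply: fil_prod; rewrite vsk.
move=> _ [vs [h [sn ->]]]; apply: Defs.sub_span.
exists (size vs), (\prod_(v <- vs) tvec v), h; split=> //; last by rewrite hecke_T_prod hHaE.
by apply: Defs.sub_span; exists vs.
Qed.

(** By PBW the leading term already vanishes in the degree [n] part of the smash product with S(V),
    where [SH_eval] may be applied. *)
Lemma PBW_symbol (I : Type) (s : seq I) (v : I -> V) (h : I -> H) n :
  cocommutative H -> PBW kappa ->
  fil hV hHa n (\sum_(i <- s) hV (v i) ^+ n * hHa (h i)) ->
  forall xi : {linear V -> F^o}, \sum_(i <- s) (xi (v i) : F) ^+ n *: h i = 0.
Proof.
move=> coco /(_ n)[Phi [PhiE Phi_inj _]] Fn xi.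
have deg_pow w : tensoralg_deg n (tvec w ^+ n : tensoralg V).
  apply: Defs.sub_span; exists (nseq n w); first by rewrite /= size_nseq.
  by rewrite big_nseq iter_mulr mulr1.
pose x := \sum_(i <- s) SH_S (symproj (tvec (v i) ^+ n)) * SH_H V (h i).
have x0 : x = 0.
  apply: Phi_inj.
  - apply: subspace_sum => [|i _]; first exact: span_subspace.
    by apply: Defs.sub_span; exists (tvec (v i) ^+ n), (h i).
  - exact: (span_subspace _).1.
  rewrite linear0 /x linear_sum.
  transitivity (qproj (hecke_fil n) (\sum_(i <- s) hV (v i) ^+ n * hHa (h i))).
    rewrite linear_sum; apply: eq_bigr => i _; rewrite PhiE //.
    by rewrite -hTE ahX hTE hHaE.
  rewrite -[RHS](linear0 (qproj (hecke_fil n))); apply/qprojP.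
  by rewrite subr0; apply: Defs.sub_span; rewrite hecke_filE.
have [ev evE] := SH_eval coco xi.
have := congr1 ev x0; rewrite linear0 /x linear_sum; apply: etrans.
by apply: eq_bigr => i _; rewrite evE.
Qed.

End HeckeAlgebra.

(** * The Clifford algebra and its parity automorphism *)

Section CliffordAlgebra.
Variables (F : fieldType) (H : hopfAlg F) (V : orthModule H).
Local Notation C := (clifford V).
Local Notation form := (@orth_form F H V).

Lemma tensoralg_span (t : tensoralg V) :
  linspan [set \prod_(v <- vs) tvec v | vs in [set: seq V]] t.
Proof.
have [g ->] := qalg_surj t; have := freealg_span g.
rewrite -[qalg _ g]/(linear_pack (ah_linear (qalg _)) g).
apply: span_map => [|_ [vs _ <-]]; first exact: span_subspace.
by apply: Defs.sub_span; exists vs => //; rewrite /= ah_prod.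
Qed.

Definition qcl : {alghom tensoralg V -> C} := qalg _.

Lemma clifford_span (c : C) :
  linspan [set \prod_(v <- vs) cvec v | vs in [set: seq V]] c.
Proof.
have [t ->] := qalg_surj c; have := tensoralg_span t.
rewrite -[qalg _ t]/(linear_pack (ah_linear qcl) t).
apply: span_map => [|_ [vs _ <-]]; first exact: span_subspace.
by apply: Defs.sub_span; exists vs => //; rewrite /= ah_prod.
Qed.

Lemma cvec_linear : linear (@cvec F H V).
Proof. by move=> a v w; rewrite /cvec tvec_linear -/qcl ah_linear. Qed.

Lemma cvec_anticomm v w :
  cvec v * cvec w + cvec w * cvec v = (2 * form v w) *: (1 : C).
Proof.
have := @qalg_rel0 _ _ [set r : tensoralg V | exists v w,
    r = tvec v * tvec w + tvec w * tvec v
        - (2 * orth_form v w) *: (1 : tensoralg V)] _ (ex_intro _ v (ex_intro _ w erefl)).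
rewrite qalgB qalgD !qalgM qalgZ => /eqP; rewrite subr_eq0 => /eqP.
exact.
Qed.

Lemma parity_exists : exists theta : {alghom C -> C}, forall v, theta (cvec v) = - cvec v.
Proof.
have nL : linear (fun v : V => - cvec v : C).
  by move=> a v w; rewrite cvec_linear opprD scalerN.
have [phi phiE] := tensoralg_lift nL.
have [|theta thetaE] := quotalg_lift (phi := phi) (X := [set r : tensoralg V | exists v w,
    r = tvec v * tvec w + tvec w * tvec v
        - (2 * orth_form v w) *: (1 : tensoralg V)]).
  by move=> _ [v [w ->]]; rewrite ahB ahD !ahM ahZ ah1 !phiE !mulrNN cvec_anticomm subrr.
by exists theta => v; rewrite thetaE phiE.
Qed.

Definition theta : {alghom C -> C} := sval (cid parity_exists).
Lemma thetaE v : theta (cvec v) = - cvec v.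
Proof. exact: (svalP (cid parity_exists)). Qed.

Lemma theta_prod vs :
  theta (\prod_(v <- vs) cvec v) = (-1) ^+ (odd (size vs)) *: \prod_(v <- vs) cvec v.
Proof.
elim: vs => [|v vs IH]; first by rewrite !big_nil ah1 scale1r.
rewrite !big_cons ahM IH thetaE mulNr -pzscalerAr -scaleN1r scalerA.
by rewrite /=; case: odd; rewrite /= ?expr0 ?expr1 ?mulrNN ?mulr1.
Qed.

Lemma thetaK : involutive theta.
Proof.
move=> c; have L := linear_eq_span (f := linear_pack (ah_linear (ah_comp theta theta)))
  (g := linear_pack (ah_linear (mkalghom (A := C) (B := C) (f := id) (fun _ _ _ => erefl) erefl (fun _ _ => erefl)))).
have := L _ _ (clifford_span c); rewrite /= ah_compE mkalghomE; apply.
move=> _ [vs _ <-]; rewrite /= ah_compE mkalghomE theta_prod ahZ theta_prod scalerA.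
by case: odd; rewrite ?mulrNN ?mulr1 scale1r.
Qed.

Hypothesis char0 : [pchar F] =i pred0.

Lemma two_neq0 : (2 : F) != 0.
Proof. by rewrite ((pcharf0P F).1 char0). Qed.

Lemma clifford_partP e c : clifford_part e c <-> theta c = (-1) ^+ e *: c.
Proof.
split=> [ce|ce].
  pose f := linear_pack (ah_linear theta).
  pose g : {linear C -> C} := ((-1) ^+ e \*: idfun)%R.
  apply: (linear_eq_span (f := f) (g := g) ce) => _ [vs vse <-].
  by rewrite /f /g /= theta_prod; move: vse => /= ->.
have half (d : C) : clifford_part e (d + (-1) ^+ e *: theta d).
  pose f : {linear C -> C} := (idfun \+ ((-1) ^+ e \*: linear_pack (ah_linear theta)))%R.
  have := clifford_span d; rewrite -[_ + _]/(f d); apply: span_map; first exact: span_subspace.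
  move=> _ [vs _ <-]; rewrite /f /= theta_prod scalerA.
  have [oe|oe] := eqVneq (odd (size vs)) e.
    rewrite oe -signr_addb addbb expr0 scale1r.
    apply: (subspaceD (span_subspace _)); apply: Defs.sub_span; exists vs => //.
  rewrite -signr_addb (_ : e (+) odd (size vs) = true); last first.
    by move: oe; case: (e); case: odd.
  by rewrite expr1 scaleN1r subrr; exact: (span_subspace _).1.
have := half c; rewrite ce scalerA -signr_addb addbb expr0 scale1r.
rewrite -mulr2n -scaler_nat; apply: (subspaceZr (span_subspace _)); exact: two_neq0.
Qed.

End CliffordAlgebra.

Section OrthogonalForm.
Variables (F : fieldType) (H : hopfAlg F) (V : orthModule H).
Local Notation form := (@orth_form F H V).

Lemma formC v w : form v w = form w v.
Proof. by rewrite hermC /= expr0 mul1r. Qed.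

Lemma form_linearl w : linear (fun v => form v w : F^o).
Proof. by move=> a u v; rewrite linearPl. Qed.

Lemma form_linearr v : linear (fun w => form v w : F^o).
Proof. by move=> a u w; rewrite formC form_linearl ![form _ v]formC. Qed.

Definition form_functional w : {linear V -> F^o} := mklin (form_linearl w).

Lemma dual_basesC n (b b' : n.-tuple V) : dual_bases b b' -> dual_bases b' b.
Proof. by case=> bb bb'' E; split=> // i j; rewrite formC E eq_sym. Qed.

Lemma dual_basis_sum n (b b' : n.-tuple V) v : dual_bases b b' -> v = \sum_i form v (tnth b' i) *: tnth b i.
Proof.
case=> bb _ E; rewrite {1}(coord_basis bb (memvf v)).
apply: eq_bigr => i _; rewrite -tnth_nth; congr (_ *: _).
rewrite {2}(coord_basis bb (memvf v)).
rewrite -[RHS]/(linear_pack (form_linearl (tnth b' i)) _) linear_sum (bigD1 i) //=.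
rewrite big1 ?addr0 => [|j ji].
  by rewrite -[RHS]/(linear_pack (form_linearl (tnth b' i)) _) linearZ_LR /= -tnth_nth E eqxx [RHS]mulr1.
rewrite -[LHS]/(linear_pack (form_linearl (tnth b' i)) _) linearZ_LR /= -tnth_nth E (negPf ji).
exact: mulr0.
Qed.

Variables (n : nat) (b b' : n.-tuple V).
Hypothesis bb' : dual_bases b b'.

Lemma dual_expand v : v = \sum_i form v (tnth b' i) *: tnth b i.
Proof. exact: dual_basis_sum. Qed.

Lemma dual_expand_dual v : v = \sum_i form v (tnth b i) *: tnth b' i.
Proof. exact: dual_basis_sum (dual_basesC bb'). Qed.

Lemma orth_act_linear h : linear (@orth_act F H V h).
Proof. exact: (orth_act_bilin V).2. Qed.

Lemma orth_primitive x v w : primitive x ->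
  form (orth_act x v) w = - form v (orth_act x w).
Proof.
move=> px; have := orth_form_invariant x v w.
pose f (a c : H) := form (orth_act a v) (orth_act c w) : F^o.
have bf : bilin f.
  split=> [c k a a'|a k c c'].
    by rewrite /f ((orth_act_bilin V).1 v) form_linearl.
  by rewrite /f ((orth_act_bilin V).1 w) form_linearr.
rewrite px -[LHS]/(linear_pack (tlift_linear bf) _) linearD /=.
rewrite !(tliftE _ _ bf) /f !orth_act1 eps_primitive // mul0r => /eqP.
by rewrite addr_eq0 => /eqP.
Qed.

Lemma orth_grouplike g v w : grouplike g ->
  form (orth_act g v) (orth_act g w) = form v w.
Proof.
move=> [gg g1]; have := orth_form_invariant g v w; rewrite g1 mul1r gg => <-.
rewrite tliftE //; split=> [c k a a'|a k c c'].
  by rewrite ((orth_act_bilin V).1 v) form_linearl.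
by rewrite ((orth_act_bilin V).1 w) form_linearr.
Qed.

(** The sum is the canonical tensor of the form, and group-likes act by isometries. *)
Lemma dual_tensor_grouplike g : grouplike g ->
  \sum_i orth_act g (tnth b i) ⊗ orth_act g (tnth b' i) = \sum_i tnth b i ⊗ tnth b' i.
Proof.
move=> Gg.
under eq_bigr do rewrite [X in X ⊗ _]dual_expand tens_suml.
rewrite exchange_big; apply: eq_bigr => j _ /=.
under eq_bigr do rewrite tensZl -tensZr.
rewrite -tens_sumr; congr (_ ⊗ _).
pose u := orth_act (antipode g) (tnth b' j).
have gu : orth_act g u = tnth b' j.
  by rewrite /u -orth_actM grouplike_antipode // orth_act1.
rewrite -gu {2}(dual_expand_dual u).
rewrite -[RHS]/(linear_pack (orth_act_linear g) _) linear_sum.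
apply: eq_bigr => i _; rewrite orth_grouplike // formC.
by rewrite [RHS](linearZ_LR (linear_pack (orth_act_linear g))).
Qed.

Lemma dual_tensor_primitive x : primitive x ->
  \sum_i (orth_act x (tnth b i) ⊗ tnth b' i + tnth b i ⊗ orth_act x (tnth b' i)) = 0.
Proof.
move=> px; rewrite big_split /=.
under eq_bigr do rewrite [X in X ⊗ _]dual_expand tens_suml.
rewrite exchange_big -big_split big1 //= => j _.
under eq_bigr do rewrite tensZl -tensZr.
rewrite -tens_sumr -tensDr -[RHS](tens0r _ (tnth b j)); congr (_ ⊗ _).
rewrite {1}(dual_expand_dual (orth_act x (tnth b' j))) -big_split big1 //= => i _.
by rewrite orth_primitive // formC scaleNr addNr.
Qed.

End OrthogonalForm.

Section OrthogonalDeterminant.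
Variables (F : fieldType) (H : hopfAlg F) (V : orthModule H).
Local Notation form := (@orth_form F H V).

(** The Gram matrix [G] satisfies [M G M^T = G], and it is invertible because the form is
    nondegenerate. *)
Lemma orth_det (f : 'End(V)) : (forall v w, form (f v) (f w) = form v w) ->
  \det (passmx.mxof (vbasis {:V}) (vbasis {:V}) f) ^+ 2 = 1.
Proof.
move=> finv; set e := vbasis {:V}; set M := passmx.mxof e e f.
have be : basis_of {:V} e by exact: vbasisP.
pose G : 'M[F]_(\dim {:V}) := \matrix_(i, j) form e`_i e`_j.
have gram (u w : 'rV[F]_(\dim {:V})) :
    form (passmx.vecof e u) (passmx.vecof e w) = (u *m G *m w^T) 0 0.
  rewrite /passmx.vecof !mxE.
  rewrite -[LHS]/(linear_pack (form_linearr (\sum_i u 0 i *: e`_i)) _) linear_sum.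
  apply: eq_bigr => j _; rewrite linearZ_LR /= [w^T _ _]mxE [(u *m G) 0 j]mxE mulr_suml.
  rewrite -[form _ _]/(linear_pack (form_linearl e`_j) _) linear_sum [LHS]mulr_sumr.
  apply: eq_bigr => i _; rewrite linearZ_LR /= mxE mulrC; congr (_ * _).
have MGM : M *m G *m M^T = G.
  apply/matrixP => i j.
  pose d k : 'rV[F]_(\dim {:V}) := delta_mx 0 k.
  have entry (B : 'M[F]_(\dim {:V})) : B i j = (d i *m B *m (d j)^T) 0 0.
    by rewrite -rowE trmx_delta -colE !mxE.
  rewrite [RHS](_ : _ = form (passmx.vecof e (d i)) (passmx.vecof e (d j))); last first.
    by rewrite !passmx.vecof_delta mxE.
  rewrite -[RHS]finv entry !mulmxA -[_ *m M^T *m _]mulmxA -trmx_mul -gram.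
  by rewrite !passmx.mul_mxof !passmx.rVofK.
have Gu : G \in unitmx.
  rewrite -row_free_unit; apply: inj_row_free => u uG.
  apply/eqP; rewrite -(passmx.vecof_eq0 be); apply/eqP.
  have /eqP := orth_form_nondegenerate V; move=> rad0.
  have : passmx.vecof e u \in orthov orth_form {:V}.
    apply/mem_orthovP => w _; rewrite -(passmx.rVofK be w).
    by rewrite [LHS]gram uG mul0mx mxE.
  by rewrite rad0 memv0 => /eqP.
have := congr1 determinant MGM; rewrite !det_mulmx det_tr.
rewrite mulrAC -expr2 => E; apply: (mulIf (x := \det G)).
  by rewrite unitmxE unitfE in Gu.
by rewrite E mul1r.
Qed.

End OrthogonalDeterminant.

(* Exterior multiplication and contraction, under the identification of C with
   the exterior algebra; locked to prevent unification from unfolding them. *)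
HB.lock Definition ext (F : fieldType) (H : hopfAlg F) (V : orthModule H) (v : V)
  (c : clifford V) : clifford V := 2^-1 *: (cvec v * c + theta V c * cvec v).
HB.lock Definition ctr (F : fieldType) (H : hopfAlg F) (V : orthModule H) (v : V)
  (c : clifford V) : clifford V := 2^-1 *: (cvec v * c - theta V c * cvec v).

Arguments ext {F H V} v c.
Arguments ctr {F H V} v c.

Section CanonicalAnticommutation.
Variables (F : fieldType) (H : hopfAlg F) (V : orthModule H).
Hypothesis char0 : [pchar F] =i pred0.
Local Notation C := (clifford V).
Local Notation form := (@orth_form F H V).
Local Notation theta := (theta V).
Implicit Types (v w : V) (c : C).

Lemma extE v c : ext v c = 2^-1 *: (cvec v * c + theta c * cvec v).
Proof. by rewrite ext.unlock. Qed.

Lemma ctrE v c : ctr v c = 2^-1 *: (cvec v * c - theta c * cvec v).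
Proof. by rewrite ctr.unlock. Qed.

Lemma ext_linear v : linear (ext v).
Proof.
move=> a c d; rewrite !extE ah_linear mulrDr mulrDl -pzscalerAr -pzscalerAl addrACA.
by rewrite [in RHS]scalerA [a * _]mulrC -[in RHS]scalerA -!scalerDr.
Qed.

Lemma ext_linear_vec c : linear (ext^~ c).
Proof.
move=> a v w; rewrite !extE cvec_linear mulrDr mulrDl -pzscalerAr -pzscalerAl addrACA.
by rewrite [in RHS]scalerA [a * _]mulrC -[in RHS]scalerA -!scalerDr.
Qed.

Definition extL v : {linear C -> C} := mklin (ext_linear v).
Lemma extLE v c : extL v c = ext v c. Proof. exact: mklinE. Qed.
Lemma ext_ctrE v c : ext v c + ctr v c = cvec v * c.
Proof.
rewrite extE ctrE -scalerDr addrACA subrr addr0 -mulr2n -scaler_nat scalerA.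
by rewrite mulVf ?scale1r // two_neq0.
Qed.

Lemma theta_ext v c : theta (ext v c) = - ext v (theta c).
Proof.
rewrite !extE ahZ ahD !ahM thetaE thetaK mulNr mulrN -scalerN opprD.
by [].
Qed.

Lemma theta_ctr v c : theta (ctr v c) = - ctr v (theta c).
Proof.
by rewrite !ctrE ahZ ahB !ahM thetaE thetaK mulNr mulrN -scalerN opprB opprK addrC.
Qed.

Lemma ctr1 v : ctr v 1 = 0.
Proof. by rewrite !ctrE ah1 mulr1 mul1r subrr scaler0. Qed.

Lemma ctr_ext_expand v w c : ctr v (ext w c) = (2^-1 * 2^-1) *:
  (cvec v * cvec w * c + cvec v * theta c * cvec w
   + (cvec w * theta c * cvec v + c * cvec w * cvec v)).
Proof.
rewrite !ctrE theta_ext mulNr opprK !extE thetaK -pzscalerAl -pzscalerAr -scalerDr scalerA.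
by rewrite mulrDr mulrDl !mulrA.
Qed.

Lemma ext_ctr_expand v w c : ext w (ctr v c) = (2^-1 * 2^-1) *:
  (cvec w * cvec v * c - cvec w * theta c * cvec v
   - (cvec v * theta c * cvec w - c * cvec v * cvec w)).
Proof.
rewrite !extE theta_ctr mulNr !ctrE thetaK -pzscalerAl -pzscalerAr -scalerBr scalerA.
by rewrite mulrBr mulrBl !mulrA.
Qed.

Lemma ext_ext_expand v w c : ext v (ext w c) = (2^-1 * 2^-1) *:
  (cvec v * cvec w * c + cvec v * theta c * cvec w
   - (cvec w * theta c * cvec v + c * cvec w * cvec v)).
Proof.
rewrite extE theta_ext mulNr !extE thetaK -pzscalerAl -pzscalerAr -scalerBr scalerA.
by rewrite mulrDr mulrDl !mulrA.
Qed.

(** In the expanded sum the terms with [theta c] in the middle cancel, and the outer ones combine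
    into anticommutators of vectors. *)
Lemma ctr_ext v w c : ctr v (ext w c) + ext w (ctr v c) = form v w *: c.
Proof.
have sum6 (M : zmodType) (x y z t u s : M) :
    x + y + (z + t) + (u - z - (y - s)) = (x + u) + (t + s).
  rewrite opprB [z + t]addrC (addrACA x) (addrACA u) [LHS]addrACA.
  by rewrite -[- z - y]opprD [z + y]addrC subrr addr0 addrACA.
rewrite ctr_ext_expand ext_ctr_expand -scalerDr sum6 -mulrDl cvec_anticomm.
rewrite -!mulrA -mulrDr addrC cvec_anticomm formC -pzscalerAl -pzscalerAr mul1r mulr1.
rewrite -scalerDl -mulr2n scalerA; congr (_ *: _).
by rewrite -[2 * _ *+ 2]mulr_natl -(mulrA 2^-1) !(mulKf (two_neq0 char0)).
Qed.

Lemma ext_anticomm v w c : ext v (ext w c) = - ext w (ext v c).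
Proof.
have sum6 (M : zmodType) (x y z t u s : M) :
    x + y - (z + t) + (u + z - (y + s)) = (x + u) - (t + s).
  rewrite !opprD [- z - t]addrC (addrACA x) [- y - s]addrC (addrACA u) [LHS]addrACA.
  by rewrite -[z - y]opprB subrr addr0 addrACA.
apply/eqP; rewrite -addr_eq0 !ext_ext_expand -scalerDr sum6 -mulrDl cvec_anticomm.
rewrite -!mulrA -mulrDr cvec_anticomm formC -pzscalerAl -pzscalerAr mul1r mulr1.
by rewrite subrr scaler0.
Qed.

Definition extw vs : C := foldr ext 1 vs.

(** Left multiplication by a vector is [ext + ctr]; by [ctr_ext], contraction preserves the span of
    the wedge products, so the span contains all Clifford monomials. *)
Lemma extw_span c : linspan [set extw vs | vs in [set: seq V]] c.
Proof.
set S := linspan _; have sS : subspace S by exact: span_subspace.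
have ctrS vs v : S (ctr v (extw vs)).
  elim: vs => [|w vs IH] /=; first by rewrite ctr1; exact: sS.1.
  have := ctr_ext v w (extw vs) => /(canRL (addrK _)) ->.
  apply: (subspaceB sS); first by apply: (subspaceZ _ sS); apply: Defs.sub_span; exists vs.
  rewrite -extLE.
  by apply: span_map IH => // _ [us _ <-]; rewrite extLE; apply: Defs.sub_span; exists (w :: us).
apply: (span_min sS) (clifford_span c) => _ [vs _ <-].
elim: vs => [|v vs IH]; first by rewrite big_nil; apply: Defs.sub_span; exists [::].
rewrite big_cons -lmulE; apply: span_map IH => // _ [us _ <-].
rewrite lmulE -ext_ctrE; apply: (subspaceD sS) => //.
by apply: Defs.sub_span; exists (v :: us).
Qed.

Section NumberOperator.
Variables (n : nat) (b b' : n.-tuple V).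
Hypothesis bb' : dual_bases b b'.

(** The number operator, whose eigenvalues are the exterior degrees. *)
Definition numop c : C := \sum_i ext (tnth b i) (ctr (tnth b' i) c).

Lemma numop_extw vs : numop (extw vs) = (size vs)%:R *: extw vs.
Proof.
elim: vs => [|v vs IH] /=.
  by rewrite scale0r /numop big1 // => i _; rewrite ctr1 -extLE linear0.
have -> : numop (ext v (extw vs)) = \sum_i (form v (tnth b' i) *: ext (tnth b i) (extw vs)
    + ext v (ext (tnth b i) (ctr (tnth b' i) (extw vs)))).
  apply: eq_bigr => i _.
  have /(canRL (addrK _)) -> := ctr_ext (tnth b' i) v (extw vs).
  by rewrite -extLE linearB linearZ_LR !extLE ext_anticomm opprK formC.
rewrite big_split /=; under [X in _ + X]eq_bigr do rewrite -extLE.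
rewrite -linear_sum -/(numop (extw vs)) IH linearZ_LR extLE -[(size vs).+1%:R]natr1 scalerDl scale1r addrC; congr (_ + _).
rewrite [in RHS](dual_expand bb' v).
rewrite -[RHS]/(linear_pack (ext_linear_vec (extw vs)) _) linear_sum.
by apply: eq_bigr => i _; rewrite [RHS]linearZ_LR.
Qed.

End NumberOperator.

End CanonicalAnticommutation.

(** * The Dirac differential and its contracting homotopy *)

(* T stands for A ⊗ C, hV v for v ⊗ 1, iC c for 1 ⊗ c, De for the diagonal map, Th for
   the parity automorphism and TF for the filtration by the degree in V. *)
Section DiracHomotopy.
Variables (F : fieldType) (H : hopfAlg F) (V : orthModule H).
Hypothesis char0 : [pchar F] =i pred0.
Local Notation C := (clifford V).
Local Notation form := (@orth_form F H V).
Local Notation theta := (theta V).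
Variables (K T : pzAlgType F).
Variables (hV : V -> T) (iC : {alghom C -> T}) (De : {alghom K -> T}) (Th : {alghom T -> T}).
Hypothesis hV_lin : linear hV.
Hypothesis iC_hV : forall c v, iC c * hV v = hV v * iC c.
Hypothesis Th_hV : forall v, Th (hV v) = hV v.
Hypothesis Th_iC : forall c, Th (iC c) = iC (theta c).
Hypothesis ThK : involutive Th.
Hypothesis Th_De : forall k, exists k', Th (De k) = De k'.
Variables (n : nat) (b b' : n.-tuple V).
Hypothesis bb' : dual_bases b b'.

Definition diracT : T := \sum_i hV (tnth b i) * iC (cvec (tnth b' i)).
Local Notation D := diracT.
Hypothesis D_De : forall k, D * De k = Th (De k) * D.

Definition gen v m c k : T := hV v ^+ m * iC c * De k.

Variable TF : nat -> set T.
Hypothesis TF_subspace : forall m, subspace (TF m).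
Hypothesis TF_le : forall m m', (m <= m')%N -> TF m `<=` TF m'.
Hypothesis TF_0 : forall x, TF 0 x -> x = 0.
Hypothesis TF_gen : forall m v c k, TF m.+1 (gen v m c k).
Hypothesis TF_spanned : forall m x, TF m x ->
  linspan [set y | exists j v c k, (j < m)%N /\ y = gen v j c k] x.
Hypothesis TF_exhaust : forall x, exists m, TF m x.
Hypothesis TF_hV : forall m v x, TF m x -> TF m.+1 (hV v * x).
Hypothesis TF_swap : forall v w m c k,
  TF m ((hV v ^+ m * hV w - hV w * hV v ^+ m) * iC c * De k).
Hypothesis TF_dpow : forall v w m c k,
  TF m ((dpow (hV v) (hV w) m.+1 - m.+1%:R *: (hV w * hV v ^+ m)) * iC c * De k).
Hypothesis TF_symbol : forall m (J : Type) (s : seq J) (v : J -> V) (c : J -> C) (k : J -> K),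
  TF m (\sum_(j <- s) gen (v j) m (c j) (k j)) ->
  forall f : {linear V -> F^o}, \sum_(j <- s) (f (v j) : F) ^+ m *: (iC (c j) * De (k j)) = 0.

Let iCZ a c k : a *: (iC c * De k) = iC (a *: c) * De k.
Proof. by rewrite ahZ -pzscalerAl. Qed.

Lemma iter_hV v m x : iter m (fun y => hV v * y) x = hV v ^+ m * x.
Proof. by elim: m => [|m IH]; rewrite ?mul1r //= IH mulrA -exprS. Qed.

Let hV_bilin : bilin (fun v (y : T) => hV v * y).
Proof.
split=> y; first by move=> a v w; rewrite hV_lin mulrDl -pzscalerAl.
by move=> a v w; rewrite mulrDr -pzscalerAr.
Qed.

(** Right multiplication of the relation by [D], after applying [Th], moves the vectors of [D] to
    the left of [De (k j)] and gives a relation of degree 1 in [V]. Evaluating its symbol at the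
    functional [form _ w] singles out [w]. *)
Lemma right_clifford (J : Type) (s : seq J) (c : J -> C) (k : J -> K) w :
  \sum_(j <- s) iC (c j) * De (k j) = 0 ->
  \sum_(j <- s) iC (theta (c j) * cvec w) * De (k j) = 0.
Proof.
move=> s0.
have s0D : \sum_(j <- s) \sum_i gen (tnth b i) 1 (theta (c j) * cvec (tnth b' i)) (k j) = 0.
  have := congr1 (fun x => Th x * D) s0; rewrite ah0 mul0r ah_sum mulr_suml.
  apply: etrans; apply: eq_bigr => j _.
  rewrite ahM Th_iC -mulrA -D_De /diracT mulr_suml mulr_sumr; apply: eq_bigr => i _.
  by rewrite /gen expr1 ahM !mulrA iC_hV.
have S1 : TF 1 (\sum_(p <- [seq (j, i) | j <- s, i <- index_enum 'I_n])
    gen (tnth b p.2) 1 (theta (c p.1) * cvec (tnth b' p.2)) (k p.1)).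
  by rewrite big_allpairs /= s0D; exact: subspace0.
have := TF_symbol S1 (form_functional w); rewrite big_allpairs /=.
apply: etrans; apply: eq_bigr => j _.
have wE : cvec w = \sum_i form w (tnth b i) *: cvec (tnth b' i) :> C.
  rewrite {1}(dual_expand_dual bb' w) -[LHS]/(linear_pack (@cvec_linear F H V) _) linear_sum.
  by apply: eq_bigr => i _; rewrite linearZ_LR.
rewrite wE mulr_sumr ah_sum mulr_suml; apply: eq_bigr => i _.
by rewrite expr1 mklinE iCZ -pzscalerAr formC.
Qed.

Local Notation I := (V * nat * C * K)%type.
Local Notation mv i := (i.1.1.1).
Local Notation md i := (i.1.1.2).
Local Notation mc i := (i.1.2).
Local Notation mk i := (i.2).
Local Notation genI i := (gen (mv i) (md i) (mc i) (mk i)).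

Let degree_sum (s : seq (F * I)) (f : F * I -> T) m0 : exists2 N, (m0 < N)%N &
  \sum_(p <- s) f p = \sum_(m < N) \sum_(p <- s | md p.2 == m) f p.
Proof.
exists (maxn m0 (\max_(p <- s) md p.2)).+1; first by rewrite ltnS leq_maxl.
rewrite (exchange_big_dep predT) //= big_seq [RHS]big_seq; apply: eq_bigr => p ps.
have pN : (md p.2 < (maxn m0 (\max_(p <- s) md p.2)).+1)%N.
  by rewrite ltnS leq_max; apply/orP; right; apply: (leq_bigmax_seq (F := fun p => md p.2)).
by rewrite (big_pred1 (Ordinal pN)) // => m; rewrite /= eq_sym.
Qed.

(** The top degree part of a relation lies in lower degree; its symbol is then 0, and by
    polarization the part itself is 0. Removing it and descending shows that relations are
    homogeneous. *)
Lemma gen_relation (s : seq (F * I)) : \sum_(p <- s) p.1 *: genI p.2 = 0 ->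
  forall m (f : {linear V -> F^o}), \sum_(p <- s | md p.2 == m)
    (f (mv p.2) : F) ^+ m *: (p.1 *: (iC (mc p.2) * De (mk p.2))) = 0.
Proof.
pose X m := \sum_(p <- s | md p.2 == m) p.1 *: genI p.2.
have XE m : X m = \sum_(p <- [seq p <- s | md p.2 == m])
    gen (mv p.2) m (p.1 *: mc p.2) (mk p.2).
  rewrite big_filter; apply: eq_bigr => p /eqP ->.
  by rewrite /gen ahZ -pzscalerAr -pzscalerAl.
have XTF m : TF m (X m) -> forall f : {linear V -> F^o}, \sum_(p <- s | md p.2 == m)
    (f (mv p.2) : F) ^+ m *: (p.1 *: (iC (mc p.2) * De (mk p.2))) = 0.
  rewrite XE => /TF_symbol S f; rewrite -[RHS](S f) big_filter.
  by apply: eq_bigr => p _; rewrite iCZ.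
have X0 m : TF m (X m) -> X m = 0.
  move=> /XTF S; rewrite XE.
  rewrite -[RHS](@polarize_iter F V T char0 (F * I)%type (fun p => mv p.2) m [seq p <- s | md p.2 == m]
    (fun p => p.1 *: (iC (mc p.2) * De (mk p.2))) _ hV_bilin) => [|f].
    by apply: eq_bigr => p _; rewrite iter_hV iCZ mulrA.
  by rewrite big_filter; exact: S.
have all0 N : \sum_(m < N) X m = 0 -> forall m, (m < N)%N -> TF m (X m).
  elim: N => [|N IH] // /[dup]; rewrite {1}big_ord_recr /= => sX0 sX.
  have XN : X N = 0.
    apply: X0; have -> : X N = - \sum_(m < N) X m.
      by apply/eqP; rewrite -addr_eq0 addrC sX0.
    apply: (subspaceN (TF_subspace N)).
    apply: (@subspace_sum F T (TF N) _ _ _ (fun i : 'I_N => X i) (TF_subspace N)) => i _.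
    apply: (TF_le (ltn_ord i)); rewrite XE; apply: (@subspace_sum F T _ _ _ _ _ (TF_subspace _)) => p _.
    exact: TF_gen.
  move=> m; rewrite ltnS leq_eqVlt => /orP[/eqP->|]; first by rewrite XN; exact: subspace0.
  by apply: IH; rewrite XN addr0 in sX0.
move=> s0 m; apply: XTF.
have [N mN sN] := degree_sum s (fun p => p.1 *: genI p.2) m.
by apply: (all0 N) mN; rewrite -sN.
Qed.

(** After [gen_relation], a relation in degree [m+1] allows [ext w] to be applied to its Clifford
    factors: left multiplication by [w] is harmless, and the right one is [right_clifford].
    Polarization then sets [w] equal to the vector of each term and restores the remaining
    powers. *)
Lemma contraction_exists : exists L : {linear T -> T},
  forall v m c k, L (gen v m c k) = m%:R *: gen v m.-1 (ext v c) k.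
Proof.
have [||L LE] := @linear_extension F T T I (fun i => genI i)
  (fun i => (md i)%:R *: gen (mv i) (md i).-1 (ext (mv i) (mc i)) (mk i)).
- move=> x; have [m /TF_spanned] := TF_exhaust x.
  by apply: linspan_sub => _ [j [v [c [k [_ ->]]]]]; exists (v, j, c, k).
- move=> s s0.
  have [N _ ->] := degree_sum s (fun p => p.1 *:
    ((md p.2)%:R *: gen (mv p.2) (md p.2).-1 (ext (mv p.2) (mc p.2)) (mk p.2))) 0.
  rewrite big1 // => -[[|m] _] _ /=.
    by rewrite big1 // => p /eqP ->; rewrite scale0r scaler0.
  pose x (p : F * I) w : T := p.1 *: (iC (ext w (mc p.2)) * De (mk p.2)).
  pose t := [seq p <- s | md p.2 == m.+1].
  have xL p : linear (x p).
    by move=> a v w; rewrite /x ext_linear_vec ah_linear mulrDl scalerDr -pzscalerAl !scalerA mulrC.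
  have R1 (f : {linear V -> F^o}) : \sum_(p <- t) (f (mv p.2) : F) ^+ m.+1 *: (p.1 *: (iC (mc p.2) * De (mk p.2))) = 0.
    by rewrite big_filter; exact: gen_relation.
  have R2 w (f : {linear V -> F^o}) : \sum_(p <- t) (f (mv p.2) : F) ^+ m.+1 *: x p w = 0.
    have E1 := congr1 (fun y => iC (cvec w) * y) (R1 f).
    rewrite mulr0 mulr_sumr in E1.
    have E0 : \sum_(p <- t) iC (((f (mv p.2) : F) ^+ m.+1 * p.1) *: mc p.2) * De (mk p.2) = 0.
      by rewrite -[RHS](R1 f); apply: eq_bigr => p _; rewrite -iCZ scalerA.
    have E2 := right_clifford w E0.
    have := congr2 (fun y z => 2^-1 *: (y + z)) E1 E2.
    rewrite addr0 scaler0 -big_split scaler_sumr; apply: etrans; apply: eq_bigr => p _ /=.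
    rewrite /x extE ahZ ahD !ahM ahZ -!pzscalerAl mulrDl.
    rewrite [in RHS]ahZ -[in RHS]pzscalerAr -[in RHS]pzscalerAr -!pzscalerAl.
    rewrite [in RHS]scalerA -[in RHS]scalerDr [in RHS]mulrA [in LHS]scalerA !scalerA.
    by rewrite mulrC.
  have R3 := @polarize_diag F V T char0 _ (fun p => mv p.2) m t x xL R2.
  have := @polarize_iter F V T char0 _ (fun p => mv p.2) m t (fun p => x p (mv p.2)) _ hV_bilin R3.
  rewrite /t big_filter => /(congr1 (fun y => m.+1%:R *: y)); rewrite scaler0 scaler_sumr.
  apply: etrans; apply: eq_bigr => p /eqP ->; rewrite iter_hV /x /gen /=.
  by rewrite -pzscalerAr !scalerA mulrC mulrA.
by exists L => v m c k; exact: (LE (v, m, c, k)).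
Qed.

Variable kT : {linear T -> T}.
Hypothesis kT_gen : forall v m c k, kT (gen v m c k) = m%:R *: gen v m.-1 (ext v c) k.

Lemma TF_map (L : {linear T -> T}) m j :
  (forall i v c k, (i < m)%N -> TF j (L (gen v i c k))) -> forall x, TF m x -> TF j (L x).
Proof.
move=> Lg x /TF_spanned; apply: span_map => // _ [i [v [c [k [im ->]]]]]; exact: Lg.
Qed.

Lemma contraction_fil m x : TF m x -> TF m.-1 (kT x).
Proof.
apply: TF_map => -[|i] v c k im; first by rewrite kT_gen scale0r; exact: subspace0.
rewrite kT_gen; apply: (subspaceZ _ (TF_subspace _)).
by case: m im => // m im; apply: (TF_le _ (TF_gen _ _ _ _)).
Qed.

Lemma gen_span x : linspan [set y | exists v m c k, y = gen v m c k] x.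
Proof.
have [m /TF_spanned] := TF_exhaust x.
by apply: linspan_sub => _ [j [v [c [k [_ ->]]]]]; exists v, j, c, k.
Qed.

Lemma gen_linear_eq (L M : {linear T -> T}) :
  (forall v m c k, L (gen v m c k) = M (gen v m c k)) -> L =1 M.
Proof.
move=> LM x; apply: (linear_eq_span (gen_span x)) => _ [v [m [c [k ->]]]]; exact: LM.
Qed.

Lemma Th_gen v m c k : Th (gen v m c k) = hV v ^+ m * iC (theta c) * Th (De k).
Proof. by rewrite /gen !ahM ahX Th_hV Th_iC. Qed.

Lemma contraction_parity x : kT (Th x) = - Th (kT x).
Proof.
pose ThL := linear_pack (ah_linear Th).
pose L : {linear T -> T} := kT \o ThL; pose M : {linear T -> T} := ThL \o kT.
suff -> : kT (Th x) = (-1) *: Th (kT x) by rewrite scaleN1r.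
apply: (@gen_linear_eq L ((-1) \*: M)%R) => {x} v m c k.
rewrite /L /M /=.
have [k' kk'] := Th_De k.
rewrite /= Th_gen kk' -/(gen v m (theta c) k') kT_gen [RHS]scaleN1r kT_gen.
rewrite -[in RHS]/(Th _) ahZ Th_gen kk' theta_ext ahN mulrN mulNr scalerN opprK.
by [].
Qed.

(** Compare the coefficients of [t] in the value of [kT] on the monomial of [v + t w]. *)
Lemma contraction_dpow v w m c k : kT (dpow (hV v) (hV w) m * iC c * De k) =
  m%:R *: (dpow (hV v) (hV w) m.-1 * iC (ext v c) * De k + hV v ^+ m.-1 * iC (ext w c) * De k).
Proof.
case: m => [|m]; first by rewrite scale0r /= !mul0r linear0.
have [P [_ P1 Pt]] := exprD_scale (hV v) (hV w) m.+1.
have [Q [Q0 Q1 Qt]] := exprD_scale (hV v) (hV w) m.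
have vtw t : hV v + t *: hV w = hV (v + t *: w).
  by rewrite addrC -hV_lin addrC.
pose a j := kT (P j * iC c * De k).
(* [Q j] is controlled only for [j < m+2]; the truncation lets both polynomials have [m+3] terms. *)
pose q j := if (j < m.+2)%N then Q j else 0.
pose d j := m.+1%:R *: (q j * iC (ext v c) * De k
  + (if j is j'.+1 then Q j' else 0) * iC (ext w c) * De k).
have ad : a 1 = d 1.
  apply: (@poly_coef_eq F T char0 m.+3) => // t.
  transitivity (kT (gen (v + t *: w) m.+1 c k)).
    rewrite /gen -vtw Pt !mulr_suml linear_sum; apply: eq_bigr => j _.
    by rewrite -!pzscalerAl linearZ_LR.
  rewrite kT_gen /gen -vtw Qt /d.
  have -> : ext (v + t *: w) c = ext v c + t *: ext w c.
    by rewrite [RHS]addrC -ext_linear_vec addrC.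
  rewrite ahD ahZ mulrDr mulrDl scalerDr.
  under [RHS]eq_bigr do rewrite scalerA [_ * m.+1%:R]mulrC -scalerA scalerDr scalerDr.
  rewrite big_split /=; congr (_ + _).
    rewrite [RHS]big_ord_recr /= [q m.+2]/q ltnn !mul0r !scaler0 addr0 !mulr_suml scaler_sumr.
    by apply: eq_bigr => j _; rewrite /q ltn_ord -!pzscalerAl.
  rewrite [RHS]big_ord_recl /= !mul0r !scaler0 add0r !mulr_suml scaler_sumr.
  apply: eq_bigr => j _.
  by congr (_ *: _); rewrite -pzscalerAr -!pzscalerAl scalerA -exprS.
by rewrite -P1 -/(a 1) ad /d /q /= Q0 Q1.
Qed.

(** Modulo lower degree, [w v^m] is [dpow] divided by [m+1], and [contraction_dpow] gives the value
    of [kT] on the latter exactly. *)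
Lemma contraction_hV v w m c k : TF m.-1 (kT (hV w * gen v m c k)
  - (m%:R *: (hV w * gen v m.-1 (ext v c) k) + gen v m (ext w c) k)).
Proof.
have := contraction_fil (TF_dpow v w m c k).
rewrite !mulrBl linearB contraction_dpow -!pzscalerAl linearZ_LR -scalerBr.
move=> /(subspaceZr (TF_subspace _)) S1.
have {S1} := S1 _; rewrite ((pcharf0P F).1 char0) => /(_ isT) S1.
have S2 : TF m.-1 (dpow (hV v) (hV w) m * iC (ext v c) * De k
    - m%:R *: (hV w * gen v m.-1 (ext v c) k)).
  case: m {S1} => [|m] /=; first by rewrite !mul0r scale0r subr0; exact: subspace0.
  by have := TF_dpow v w m (ext v c) k; rewrite !mulrBl -!pzscalerAl /gen !mulrA.
have := subspaceB (TF_subspace _) S2 S1; rewrite /gen !mulrA /=.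
have sum4 (M : zmodType) (p q r s : M) : p - q - (p + s - r) = r - (q + s).
  by rewrite opprB addrC -addrA opprD -[- p - s + _]addrA [- s + _]addrCA addKr -opprD [s + q]addrC.
by rewrite sum4.
Qed.

Definition ddiff x := D * x - Th x * D.

Lemma ddiff_linear : linear ddiff.
Proof.
move=> a x y; rewrite /ddiff ah_linear mulrDr mulrDl -pzscalerAr -pzscalerAl.
by rewrite opprD addrACA -scalerBr.
Qed.

Definition ddiffL : {linear T -> T} := mklin ddiff_linear.
Lemma ddiffLE x : ddiffL x = ddiff x. Proof. exact: mklinE. Qed.

Lemma iC_gen u v m c k : iC u * gen v m c k = gen v m (u * c) k.
Proof.
have uv : GRing.comm (iC u) (hV v) := iC_hV u v.
by rewrite /gen !mulrA (commrX m uv) ahM !mulrA.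
Qed.

Lemma genD v m c c' k : gen v m (c + c') k = gen v m c k + gen v m c' k.
Proof. by rewrite /gen ahD mulrDr mulrDl. Qed.

Lemma genZ v m a c k : gen v m (a *: c) k = a *: gen v m c k.
Proof. by rewrite /gen ahZ -pzscalerAr -pzscalerAl. Qed.

Lemma genB v m c c' k : gen v m (c - c') k = gen v m c k - gen v m c' k.
Proof. by rewrite genD -scaleN1r genZ scaleN1r. Qed.

Lemma gen_sum (J : Type) (s : seq J) v m (c : J -> C) k :
  gen v m (\sum_(j <- s) c j) k = \sum_(j <- s) gen v m (c j) k.
Proof. by rewrite /gen ah_sum mulr_sumr mulr_suml. Qed.

Lemma ddiff_gen v m c k : TF m (ddiff (gen v m c k)
  - \sum_i hV (tnth b i) * gen v m (2 *: ctr (tnth b' i) c) k).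
Proof.
rewrite /ddiff Th_gen -(mulrA _ (Th _)) -D_De /diracT !mulr_suml mulr_sumr -!sumrB.
apply: (@subspace_sum F T (TF m) _ _ _ _ (TF_subspace m)) => i _.
set w := tnth b i; set u := cvec _.
have -> : 2 *: ctr (tnth b' i) c = u * c - theta c * u.
  by rewrite ctrE scalerA mulfV ?scale1r // two_neq0.
have := TF_swap v w m (theta c * u) k.
move=> /(subspaceN (TF_subspace m)); congr (TF _ _).
rewrite -(mulrA (hV w)) iC_gen genB mulrBr.
have sub4 (M : zmodType) (x y z : M) : x - y - (x - z) = z - y.
  by rewrite opprB addrC addrA subrK.
rewrite sub4 mulrBl mulrBl opprB /gen ahM !mulrA; congr (_ - _ * _).
by congr (_ * _); rewrite -!mulrA iC_hV.
Qed.

Lemma ddiff_TF m x : TF m x -> TF m.+1 (ddiff x).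
Proof.
rewrite -ddiffLE; apply: TF_map => i v c k im; rewrite ddiffLE.
apply: (subspaceBr (TF_subspace _) _ (TF_le _ (ddiff_gen v i c k))).
  apply: (@subspace_sum F T (TF m.+1) _ _ _ _ (TF_subspace _)) => j _.
  by apply: TF_hV; apply: TF_le (TF_gen _ _ _ _).
by rewrite ltnW // ltnW.
Qed.

Definition numT x := ddiff (kT x) + kT (ddiff x).

Lemma numT_TF m x : TF m x -> TF m (numT x).
Proof.
case: m => [/TF_0 ->|m mx].
  by rewrite /numT linear0 /ddiff ah0 mulr0 mul0r subrr linear0 addr0; exact: subspace0.
apply: (subspaceD (TF_subspace _)); first exact: ddiff_TF (contraction_fil mx).
exact: contraction_fil (ddiff_TF mx).
Qed.

(** The two products of [kT] and [d] involve [ctr] and [ext] in opposite orders. By [ctr_ext] their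
    sum yields [form v (tnth b' i)], which restores [v^m] with factor [m]; the remaining term is the
    number operator. *)
Lemma numT_gen v m vs k : TF m (numT (gen v m (extw vs) k)
  - (2 * (m + size vs))%:R *: gen v m (extw vs) k).
Proof.
set c := extw vs.
pose ci i := ctr (tnth b' i) c.
have kd : TF m (kT (ddiff (gen v m c k)) - \sum_i 2 *: (m%:R *: (hV (tnth b i) *
    gen v m.-1 (ext v (ci i)) k) + gen v m (ext (tnth b i) (ci i)) k)).
  have S1 := TF_le (leq_pred m) (contraction_fil (ddiff_gen v m c k)).
  rewrite linearB linear_sum /= in S1.
  apply: (subspaceBr (TF_subspace m) S1).
  rewrite opprB [_ - _ + _]addrC addrA subrK -sumrB.
  apply: (@subspace_sum F T (TF m) _ _ _ _ (TF_subspace m)) => i _.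
  rewrite genZ -pzscalerAr linearZ_LR -scalerBr; apply: (subspaceZ _ (TF_subspace m)).
  by apply: (TF_le (leq_pred m)); exact: contraction_hV.
have dk : TF m (ddiff (kT (gen v m c k)) - \sum_i 2 *: (m%:R *: (hV (tnth b i) *
    gen v m.-1 (ctr (tnth b' i) (ext v c)) k))).
  rewrite kT_gen -ddiffLE linearZ_LR ddiffLE.
  have S1 := TF_le (leq_pred m) (ddiff_gen v m.-1 (ext v c) k).
  have := subspaceZ m%:R (TF_subspace m) S1.
  rewrite scalerBr scaler_sumr; congr (TF _ (_ - _)); apply: eq_bigr => i _.
  by rewrite genZ -pzscalerAr !scalerA mulrC.
have := subspaceD (TF_subspace m) dk kd.
rewrite addrACA -opprD -big_split /=; congr (TF _ (_ - _)).
have -> : (2 * (m + size vs))%:R *: gen v m c k =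
    2 *: (m%:R *: gen v m c k) + 2 *: gen v m (numop b b' c) k.
  by rewrite (numop_extw char0 bb') genZ natrM natrD -scalerDr -scalerDl scalerA.
rewrite /numop gen_sum scaler_sumr.
have -> : 2 *: (m%:R *: gen v m c k) = \sum_i 2 *: (m%:R *: (hV (tnth b i) *
    gen v m.-1 (form v (tnth b' i) *: c) k)).
  (* In degree 0 the factor [m] kills both sides; otherwise one factor [v] is expanded in the dual
     bases. *)
  rewrite -!scaler_sumr; case: (m) => [|m']; first by rewrite !scale0r.
  have -> : gen v m'.+1 c k = hV v * gen v m' c k by rewrite /gen exprS !mulrA.
  congr (_ *: (_ *: _)); rewrite {1}(dual_expand bb' v).
  rewrite -[hV _]/(linear_pack hV_lin _) linear_sum !mulr_suml.
  by apply: eq_bigr => i _; rewrite linearZ_LR -!pzscalerAl genZ -pzscalerAr /gen !mulrA.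
rewrite -big_split; apply: eq_bigr => i _ /=.
by rewrite formC -(ctr_ext char0) genD mulrDr -!scalerDr addrA -scalerDr.
Qed.

Lemma contraction_grouplike u (f : V -> V) (al : C -> C) (e : bool) :
  (forall v, De u * hV v = hV (f v) * De u) -> (forall c, De u * iC c = iC (al c) * De u) ->
  Th (De u) = (-1) ^+ e *: De u ->
  (forall v c, ext (f v) (al c) = (-1) ^+ e *: al (ext v c)) ->
  forall x, kT (De u * x) = Th (De u) * kT x.
Proof.
move=> uV uC uTh uE; have uX v m : De u * hV v ^+ m = hV (f v) ^+ m * De u.
  elim: m => [|m IH]; first by rewrite mul1r mulr1.
  by rewrite !exprS mulrA uV -(mulrA _ (De u)) IH mulrA.
have ug v m c k : De u * gen v m c k = gen (f v) m (al c) (u * k).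
  by rewrite /gen !mulrA uX -(mulrA _ (De u)) uC ahM !mulrA.
move=> x; rewrite uTh -pzscalerAl; pose a : F := (-1) ^+ e.
rewrite -[LHS]/((kT \o linear_pack ((@mul_bilin F T).2 (De u))) x).
rewrite -[RHS]/((a \*: (linear_pack ((@mul_bilin F T).2 (De u)) \o kT))%R x).
apply: gen_linear_eq => {x} v m c k.
transitivity (kT (De u * gen v m c k)) => //.
transitivity (a *: (De u * kT (gen v m c k))); last by [].
by rewrite ug !kT_gen uE genZ -pzscalerAr ug !scalerA mulrC.
Qed.

(** Here [u] acts on monomials as a derivation, producing [dpow] on powers; [contraction_dpow]
    matches the two resulting terms with [dl (ext v c)]. *)
Lemma contraction_primitive u (f : V -> V) (dl : C -> C) :
  (forall v, De u * hV v = hV (f v) + hV v * De u) ->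
  (forall c, De u * iC c = iC (dl c) + iC c * De u) -> Th (De u) = De u ->
  (forall v c, dl (ext v c) = ext (f v) c + ext v (dl c)) ->
  forall x, kT (De u * x) = Th (De u) * kT x.
Proof.
move=> uV uC uTh uE.
have uX v m : De u * hV v ^+ m = dpow (hV v) (hV (f v)) m + hV v ^+ m * De u.
  elim: m => [|m IH]; first by rewrite mul1r mulr1 add0r.
  rewrite exprS mulrA uV mulrDl -(mulrA _ (De u)) IH mulrDr /= addrA mulrA.
  by congr (_ + _); rewrite addrC.
have ug v m c k : De u * gen v m c k = dpow (hV v) (hV (f v)) m * iC c * De k
    + gen v m (dl c) k + gen v m c (u * k).
  rewrite /gen !mulrA uX !mulrDl -(mulrA _ (De u)) uC mulrDr mulrDl ahM !mulrA addrA.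
  by [].
move=> x; rewrite uTh.
rewrite -[LHS]/((kT \o linear_pack ((@mul_bilin F T).2 (De u))) x).
rewrite -[RHS]/((linear_pack ((@mul_bilin F T).2 (De u)) \o kT) x).
apply: gen_linear_eq => {x} v m c k.
transitivity (kT (De u * gen v m c k)) => //.
transitivity (De u * kT (gen v m c k)); last by [].
rewrite ug !linearD contraction_dpow !kT_gen -pzscalerAr ug uE genD -!scalerDr.
congr (_ *: _); rewrite /gen.
set p := dpow _ _ _ * _ * _.
by rewrite -!addrA.
Qed.

Lemma contraction_equivariant_closed : subspace
  [set k | forall x, kT (De k * x) = Th (De k) * kT x].
Proof.
split=> [x|a k k' ek ek' x /=]; first by rewrite !ah0 !mul0r linear0.
by rewrite !ah_linear !mulrDl -!pzscalerAl linearP ek ek'.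
Qed.

Lemma contraction_equivariantM k k' : (forall x, kT (De k * x) = Th (De k) * kT x) ->
  (forall x, kT (De k' * x) = Th (De k') * kT x) ->
  forall x, kT (De (k * k') * x) = Th (De (k * k')) * kT x.
Proof. by move=> ek ek' x; rewrite !ahM -!mulrA ek ek'. Qed.

(* For e = true this is (A ⊗ C)_det^odd, see [twisted_invariantP]. *)
Definition det_inv (e : bool) : set T := [set x | Th x = (-1) ^+ e *: x /\
  forall k, (if e then Th (De k) else De k) * x = x * De k].

Lemma det_inv_subspace e : subspace (det_inv e).
Proof.
split=> [|a x y [Tx Dx] [Ty Dy]].
  by split=> [|k]; rewrite ?ah0 ?scaler0 ?mulr0 ?mul0r.
split=> [|k]; first by rewrite ah_linear Tx Ty scalerDr !scalerA mulrC.
by rewrite mulrDr mulrDl -pzscalerAr -pzscalerAl Dx Dy.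
Qed.

Hypothesis kT_De : forall k x, kT (De k * x) = Th (De k) * kT x.

Lemma contractionMr x k : kT (x * De k) = kT x * De k.
Proof.
pose R := linear_pack ((@mul_bilin F T).1 (De k)).
apply: (@gen_linear_eq (kT \o R) (R \o kT)) => v m c k' /=.
rewrite -[LHS]/(kT (gen v m c k' * De k)) -[RHS]/(kT (gen v m c k') * De k).
have gM j c' : gen v j c' k' * De k = gen v j c' (k' * k) by rewrite /gen ahM !mulrA.
by rewrite gM !kT_gen -pzscalerAl gM.
Qed.

Lemma ddiffMl k x : ddiff (De k * x) = Th (De k) * ddiff x.
Proof. by rewrite /ddiff mulrA D_De ahM mulrBr !mulrA. Qed.

Lemma ddiffMr x k : ddiff (x * De k) = ddiff x * De k.
Proof. by rewrite /ddiff ahM -(mulrA (Th x)) -D_De mulrBl !mulrA. Qed.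

Lemma Th_D : Th D = - D.
Proof.
rewrite /diracT ah_sum -sumrN; apply: eq_bigr => i _.
by rewrite ahM Th_hV Th_iC thetaE ahN mulrN.
Qed.

Lemma ddiff_Th x : ddiff (Th x) = - Th (ddiff x).
Proof. by rewrite /ddiff ahB !ahM Th_D !ThK mulNr mulrN opprK opprD opprK. Qed.

Lemma det_inv_map (L : {linear T -> T}) e x : (forall y, L (Th y) = - Th (L y)) ->
  (forall k y, L (De k * y) = Th (De k) * L y) ->
  (forall k y, L (y * De k) = L y * De k) -> det_inv e x -> det_inv (~~ e) (L x).
Proof.
move=> LTh Ll Lr [Tx Dx]; split=> [|k].
  rewrite -[Th _]opprK -LTh Tx linearZ_LR -scaleNr; case: (e) => /=.
    by rewrite expr1 opprK.
  by rewrite expr0.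
rewrite -Lr -Dx; case: (e) => //=.
by have [k' kk'] := Th_De k; rewrite kk' Ll -kk' ThK.
Qed.

Lemma contraction_det_inv e x : det_inv e x -> det_inv (~~ e) (kT x).
Proof. by apply: det_inv_map => *; rewrite ?contraction_parity ?kT_De ?contractionMr. Qed.

Lemma ddiff_Xe e x : det_inv e x -> det_inv (~~ e) (ddiff x).
Proof. by rewrite -ddiffLE; apply: det_inv_map => *; rewrite !ddiffLE ?ddiff_Th ?ddiffMl ?ddiffMr. Qed.

Variables (c0 : T) (k0 : K).
Hypothesis c0_central : forall x, c0 * x = x * c0.
Hypothesis Th_k0 : Th (De k0) = De k0.
Hypothesis D2 : D * D = c0 + De k0.

(** With the signs of [Th], [d (d x)] is the commutator of [D * D] with [x]; [c0] is central, and
    [De k0] is even, hence commutes with [x]. *)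
Lemma ddiff2 e x : det_inv e x -> ddiff (ddiff x) = 0.
Proof.
move=> [_ Dx]; rewrite /ddiff ahB !ahM Th_D ThK mulrBr mulrBl !mulrA D2 mulrDl c0_central.
have -> : De k0 * x = x * De k0 by rewrite -Dx; case: (e); rewrite ?Th_k0.
by rewrite -mulrDr -D2 mulrN !mulNr opprK mulrA opprD opprK addrA subrK subrr.
Qed.

Fact numT_linear : linear numT.
Proof.
move=> a x y; rewrite /numT -!ddiffLE linearP [ddiffL _]linearP [ddiffL (a *: x + y)]linearP.
by rewrite linearP addrACA -scalerDr.
Qed.

Definition numL : {linear T -> T} := mklin numT_linear.
Lemma numLE x : numL x = numT x. Proof. exact: mklinE. Qed.

(** The product of the operators [numT - 2 j] over [p <= j < p + R]. *)
Fixpoint numpoly p R x := if R is R'.+1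
  then numT (numpoly p R' x) - (2 * (p + R'))%:R *: numpoly p R' x else x.

Lemma numpoly_linear p R : linear (numpoly p R).
Proof.
elim: R => [|R IH] a x y //=; rewrite IH numT_linear [X in _ - X]scalerDr opprD addrACA.
by rewrite scalerBr !scalerA [_ * a]mulrC.
Qed.

Lemma numpoly_TF p R m x : TF m x -> TF m (numpoly p R x).
Proof.
move=> mx; elim: R => //= R IH.
apply: (subspaceB (TF_subspace m)); first exact: numT_TF.
exact: (subspaceZ _ (TF_subspace m)).
Qed.

Lemma numpoly_gen p R m v vs k : exists a : F,
  TF m (numpoly p R (gen v m (extw vs) k) - a *: gen v m (extw vs) k)
  /\ ((p <= m + size vs < p + R)%N -> a = 0).
Proof.
set g := gen _ _ _ _; elim: R => [|R [a [IH a0]]] /=.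
  exists 1; rewrite scale1r subrr; split; first exact: subspace0.
  by rewrite addn0 => /andP[/leq_ltn_trans h /h]; rewrite ltnn.
exists (a * ((2 * (m + size vs))%:R - (2 * (p + R))%:R)); split.
  set y := numpoly _ _ _ in IH *.
  have S1 := numT_TF IH; have S2 := subspaceZ a (TF_subspace m) (numT_gen v m vs k).
  have S3 := subspaceZ (2 * (p + R))%:R (TF_subspace m) IH.
  have := subspaceB (TF_subspace m) (subspaceD (TF_subspace m) S1 S2) S3.
  have sum5 (M : zmodType) (u t p' q r : M) : u - t + (t - p') - (q - r) = u - q - (p' - r).
    by rewrite addrA subrK !opprB addrACA [RHS]addrACA [- p' - q]addrC.
  rewrite -numLE linearB linearZ_LR !numLE -/g scalerBr [X in _ - X]scalerBr sum5.
  by congr (TF _ (_ - _)); rewrite mulrBr scalerBl !scalerA [_ * a]mulrC.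
move=> /andP[pm]; rewrite addnS ltnS leq_eqVlt => /orP[/eqP->|mR].
  by rewrite subrr mulr0.
by rewrite a0 ?mul0r // pm.
Qed.

(** Only monomials of total degree below [p] escape the factors of [numpoly]; the others are pushed
    into [TF m] once [R] is large enough for the finitely many monomials of [x]. *)
Lemma numpoly_span (S : set T) m p : subspace S -> TF m `<=` S ->
  (forall v vs k, (m + size vs < p)%N -> S (gen v m (extw vs) k)) ->
  forall x, TF m.+1 x -> exists R, S (numpoly p R x).
Proof.
move=> sS TS Sg x mx.
(* Asking for all large [R] makes the condition stable under sums, by taking the larger bound. *)
pose Q := [set x | exists R0, forall R, (R0 <= R)%N -> S (numpoly p R x)].
suff [R0 QR] : Q x by exists R0; exact: QR.
have sQ : subspace Q.
  split=> [|a y z [R1 Q1] [R2 Q2]].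
    exists 0 => R _; rewrite -[numpoly p R]/(linear_pack (numpoly_linear p R) : _ -> _).
    by rewrite linear0; exact: subspace0.
  exists (maxn R1 R2) => R; rewrite geq_max => /andP[r1 r2].
  by rewrite numpoly_linear; apply: sS.2; [exact: Q1|exact: Q2].
have := TF_spanned mx; move: x {mx}; apply: span_min => // _ [j [v [c [k [jm ->]]]]].
have gl : linear (fun c => gen v j c k) by move=> a c' d; rewrite genD genZ.
have -> : gen v j c k = mklin gl c by rewrite mklinE.
apply: (span_map sQ _ (extw_span char0 c)) => _ [vs _ <-]; rewrite mklinE.
move: jm; rewrite ltnS leq_eqVlt => /orP[/eqP {j gl}->|jm]; last first.
  by exists 0 => R _; apply: TS; apply: numpoly_TF; apply: TF_le (TF_gen _ _ _ _).
have [mp|pm] := ltnP (m + size vs) p.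
  exists 0 => R _; have [a [/TS Sa _]] := numpoly_gen p R m v vs k.
  by apply: (subspaceBr sS) Sa; apply: (subspaceZ _ sS); exact: Sg.
exists (m + size vs).+1 => R mR; have [a [/TS Sa a0]] := numpoly_gen p R m v vs k.
rewrite a0 ?scale0r ?subr0 // in Sa.
by rewrite pm /= (leq_trans mR) // leq_addl.
Qed.

Lemma numT_Xe e x : det_inv e x -> det_inv e (numT x).
Proof.
move=> Xx; apply: (subspaceD (det_inv_subspace e)); rewrite -[e]negbK.
  exact/ddiff_Xe/contraction_det_inv.
exact/contraction_det_inv/ddiff_Xe.
Qed.

Lemma numT_diff e y : det_inv e y -> numT (ddiff y) = ddiff (kT (ddiff y)).
Proof. by move=> Xy; rewrite /numT (ddiff2 Xy) linear0 addr0. Qed.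

(** Each factor [numT - l] acts on [x] as [-l] up to the coboundary of [kT x] and the lower term
    [kT (ddiff x)]. Bounding the degree of [ddiff x], rather than asking it to be 0, also covers
    elements whose differential is some [De k]. *)
Lemma numpoly_homotopy e m p R x : (0 < p)%N -> det_inv e x -> TF m.+1 x -> TF m.+1 (ddiff x) ->
  exists a y w, [/\ a != 0, det_inv (~~ e) y /\ TF m y, det_inv e w /\ TF m w
    & numpoly p R x = a *: x + ddiff y + w].
Proof.
move=> p0 Xx mx mdx.
have kTx : det_inv (~~ e) (kT x) /\ TF m (kT x) by split; [exact: contraction_det_inv|exact: (contraction_fil mx)].
have kdx : det_inv e (kT (ddiff x)) /\ TF m (kT (ddiff x)).
  by split; [rewrite -[e]negbK; apply: contraction_det_inv; exact: ddiff_Xe|exact: (contraction_fil mdx)].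
have comb (S : set T) (a l : F) u v z : subspace S -> S u -> S v -> S z ->
    S (a *: u + v - l *: z).
  move=> sS Su Sv Sz; apply: (subspaceB sS); last exact: (subspaceZ _ sS).
  by apply: (subspaceD sS) => //; exact: (subspaceZ _ sS).
elim: R => [|R [a [y [w [a0 [Xy my] [Xw mw] IH]]]]].
  exists 1, 0, 0; split; [exact: oner_neq0 | | |].
  - by split; apply: subspace0; [exact: det_inv_subspace|].
  - by split; apply: subspace0; [exact: det_inv_subspace|].
  - by rewrite /= scale1r addr0 -ddiffLE linear0 addr0.
(* The eigenvalue removed by the next factor, nonzero since [p] is positive. *)
pose l := (2 * (p + R))%:R : F.
exists (- (l * a)), (a *: kT x + kT (ddiff y) - l *: y), (a *: kT (ddiff x) + numT w - l *: w); split.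
- rewrite oppr_eq0 mulf_neq0 // ((pcharf0P F).1 char0).
  by rewrite muln_eq0 addn_eq0 /= negb_and -lt0n p0.
- have kdy : det_inv (~~ e) (kT (ddiff y)) by rewrite -[~~ e]negbK; apply: contraction_det_inv; exact: ddiff_Xe.
  have mkdy : TF m (kT (ddiff y)) by exact: (contraction_fil (ddiff_TF my)).
  by case: kTx => ? ?; split; apply: comb => //; exact: det_inv_subspace.
- case: kdx => ? ?; split; apply: comb => //; first exact: det_inv_subspace.
    exact: numT_Xe.
  exact: numT_TF.
have dE : numT (ddiff y) = ddiff (kT (ddiff y)) by exact: numT_diff Xy.
have -> : ddiff (a *: kT x + kT (ddiff y) - l *: y) = a *: ddiff (kT x) + ddiff (kT (ddiff y)) - l *: ddiff y.
  by rewrite -!ddiffLE linearB linearP [ddiffL (l *: _)]linearZ_LR.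
have nE : numT (a *: x + ddiff y + w) = a *: numT x + numT (ddiff y) + numT w.
  by rewrite -!numLE linearD linearP.
rewrite /= IH -/l nE dE [numT x]/numT [a *: (_ + _)]scalerDr.
move: (ddiff (kT x)) (kT (ddiff x)) (ddiff (kT (ddiff y))) (numT w) (ddiff y) => A B E N Y.
rewrite 2!(scalerDr l) !opprD scalerA scaleNr.
by rewrite (AC (4 * 3) (5 * ((1 * 3) * 6) * ((2 * 4) * 7))).
Qed.

Lemma reduce_degree e m x : (0 < m)%N -> det_inv e x -> TF m.+1 x -> TF m.+1 (ddiff x) ->
  exists2 y, det_inv (~~ e) y & TF m (x - ddiff y).
Proof.
move=> m0 Xx mx mdx.
(* With [p = m], no monomial of degree [m] in [V] has total degree below [p], so the product removes
   them all. *)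
have [//|//||R S] := @numpoly_span (TF m) m m _ _ _ x mx.
  by move=> v vs k; rewrite ltnNge leq_addr.
have [a [y [w [a0 [Xy my] [Xw mw] E]]]] := numpoly_homotopy R m0 Xx mx mdx.
exists (- a^-1 *: y); first exact: (subspaceZ _ (det_inv_subspace _)).
apply: (subspaceZr (TF_subspace m) a0).
have := subspaceB (TF_subspace m) S mw; rewrite E addrK; congr (TF _ _).
by rewrite -[ddiff (_ *: _)]ddiffLE linearZ_LR scalerBr scalerA mulrN mulfV // scaleN1r opprK ddiffLE.
Qed.

Lemma degree0_image e x : det_inv e x -> TF 1 x -> TF 1 (ddiff x) -> exists k, x = De k.
Proof.
move=> Xx mx mdx.
pose S := [set x | exists k, x = De k].
have sS : subspace S.
  split=> [|a _ _ [k ->] [k' ->]]; first by exists 0; rewrite ah0.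
  by exists (a *: k + k'); rewrite ah_linear.
(* In degree 0 the choice [p = 1] spares exactly exterior degree 0, which is the image of [De]. *)
have [||R [k E]] := @numpoly_span S 0 1 sS _ _ x mx.
- by move=> y /TF_0 ->; exact: subspace0.
- move=> v [|//] k _; exists k; by rewrite /gen /= ah1 !mul1r.
have [a [y [w [a0 [_ /TF_0 y0] [_ /TF_0 w0]]]]] := numpoly_homotopy R (isT : (0 < 1)%N) Xx mx mdx.
rewrite E y0 w0 addr0 -ddiffLE linear0 addr0 => ax.
by exists (a^-1 *: k); rewrite ahZ ax scalerA mulVf // scale1r.
Qed.

Lemma De_Xe e k : det_inv e (De k) -> ddiff (De k) = 0.
Proof. by rewrite /ddiff D_De subrr. Qed.

Lemma De_TF k : TF 1 (De k).
Proof. by have := TF_gen 0 0 1 k; rewrite /gen expr0 ah1 !mul1r. Qed.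

Theorem ddiff_closed e x : det_inv e x -> ddiff x = 0 ->
  exists k y, det_inv (~~ e) y /\ x = De k + ddiff y.
Proof.
have [m] := TF_exhaust x; move: m x.
have main m : forall x, TF m.+1 x -> det_inv e x -> ddiff x = 0 ->
    exists k y, det_inv (~~ e) y /\ x = De k + ddiff y.
  elim: m => [|m IH] x mx Xx dx.
    have [|k ->] := degree0_image Xx mx; first by rewrite dx; exact: subspace0.
    exists k, 0; split; first exact: subspace0 (det_inv_subspace _).
    by rewrite -ddiffLE linear0 addr0.
  have [|y Xy my] := reduce_degree (isT : (0 < m.+1)%N) Xx mx.
    by rewrite dx; exact: subspace0.
  have Xdy : det_inv e (ddiff y) by rewrite -[e]negbK; exact: ddiff_Xe.
  have [||k [y' [Xy' E]]] := IH _ my.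
  - exact: (subspaceB (det_inv_subspace e)).
  - by rewrite -ddiffLE linearB !ddiffLE dx (ddiff2 Xy) subr0.
  exists k, (y + y'); split; first exact: (subspaceD (det_inv_subspace _)).
  by rewrite -[in RHS]ddiffLE linearD !ddiffLE addrCA -E addrC subrK.
by move=> m x mx; apply: (main m); exact: TF_le (leqnSn m) _ mx.
Qed.

(** Since [De k] has degree 0, [y] can be lowered to degree 0 without changing its differential;
    there it lies in the image of [De], where the differential vanishes. *)
Theorem ddiff_exact_image e y k : det_inv e y -> ddiff y = De k -> De k = 0.
Proof.
have [m] := TF_exhaust y; move: m y.
have main m : forall y, TF m.+1 y -> det_inv e y -> ddiff y = De k -> De k = 0.
  elim: m => [|m IH] y my Xy dy.
    have [|k' yk] := degree0_image Xy my; first by rewrite dy; exact: De_TF.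
    by rewrite -dy yk (@De_Xe e) // -yk.
  have [|z Xz mz] := reduce_degree (isT : (0 < m.+1)%N) Xy my.
    by rewrite dy; apply: TF_le (De_TF k).
  apply: (IH _ mz).
    apply: (subspaceB (det_inv_subspace e)) => //; rewrite -[e]negbK; exact: ddiff_Xe.
  by rewrite -ddiffLE linearB !ddiffLE dy (ddiff2 Xz) subr0.
by move=> m y my; apply: (main m); exact: TF_le (leqnSn m) _ my.
Qed.

End DiracHomotopy.

(** * The pin cover *)

Section HopfAntipode.
Variables (F : fieldType) (K : hopfAlg F).

Lemma grouplike1 : grouplike (1 : K).
Proof. by split; [exact: comul1|exact: counit1]. Qed.

Lemma antipode1 : antipode (1 : K) = 1.
Proof. by have := grouplike_antipodeV grouplike1; rewrite mulr1. Qed.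

Lemma tlift_primitive (W : lmodType F) (f : K -> K -> W) x : bilin f -> primitive x ->
  tlift (comul x) f = f x 1 + f 1 x.
Proof.
by move=> bf ->; rewrite -(mklinE (tlift_linear bf)) linearD !mklinE !tliftE.
Qed.

Lemma antipode_primitive (x : K) : primitive x -> antipode x = - x.
Proof.
move=> px; have := antipodel x; rewrite tlift_primitive //; last first.
  split=> [b a u v|a c u v]; first by rewrite linearP mulrDl pzscalerAl.
  by rewrite mulrDr pzscalerAr.
rewrite antipode1 mulr1 mul1r eps_primitive // scale0r => /eqP.
by rewrite addr_eq0 => /eqP.
Qed.

End HopfAntipode.

Section PinGenerators.
Variables (F : fieldType) (H : hopfAlg F) (V : orthModule H) (P : pinCover V).
Hypothesis char0 : [pchar F] =i pred0.
Local Notation act k v := (orth_act (pin_pi P k) v : V).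
Local Notation gamma := (pin_gamma P).
Local Notation detV := (act_det (fun (k : P) (v : V) => act k v)).

Lemma pin_pi_grouplike g : grouplike g -> grouplike (pin_pi P g).
Proof.
have [pc pe _] := pin_pi_hopf P; move=> [gg g1]; split; last by rewrite pe.
rewrite pc gg tliftE //.
exact: (tmap_bilin (linear_pack (ah_linear (pin_pi P))) (linear_pack (ah_linear (pin_pi P)))).
Qed.

Lemma pin_pi_primitive x : primitive x -> primitive (pin_pi P x).
Proof.
have [pc _ _] := pin_pi_hopf P; move=> px; rewrite /primitive pc tlift_primitive ?ah1 //.
exact: (tmap_bilin (linear_pack (ah_linear (pin_pi P))) (linear_pack (ah_linear (pin_pi P)))).
Qed.

Lemma act_linear k : linear (fun v => act k v).
Proof. exact: orth_act_linear. Qed.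

Lemma grouplike_det g : grouplike g -> exists e : bool, detV g = (-1) ^+ e.
Proof.
move=> Gg; have : detV g ^+ 2 = 1.
  apply: orth_det => v w.
  have E u : linfun (fun v => act g v) u = act g u.
    exact: (lfunE (linear_pack (act_linear g))).
  by rewrite !E orth_grouplike //; exact: pin_pi_grouplike.
move=> /eqP; rewrite sqrf_eq1 => /orP[/eqP ->|/eqP ->]; first by exists false.
by exists true; rewrite expr1.
Qed.

Definition pin_gen (e : bool) (u : P) : Prop :=
  (grouplike u /\ detV u = (-1) ^+ e) \/ (primitive u /\ e = false).

(** Statements about the whole cover reduce to left multiplication by a group-like or a primitive,
    by the generation theorem. *)
Lemma pin_ind (S : set P) : subspace S -> S 1 ->
  (forall e u k, pin_gen e u -> S k -> S (u * k)) -> forall k, S k.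
Proof.
move=> sS S1 SM k; have := pointed_gens char0 (@pin_cocommutative _ _ _ P) (@pin_pointed _ _ _ P) k.
apply: span_min => // _ [xs [g [pxs Gg ->]]].
elim: xs pxs => [|x xs IH] pxs.
  have [e ge] := grouplike_det Gg.
  by rewrite big_nil mul1r -[g]mulr1; apply: (SM e) => //; left.
have [px pxs'] := prims_cons pxs.
by rewrite big_cons -mulrA; apply: (SM false) (IH pxs'); right.
Qed.

Lemma detV1 : detV 1 = 1.
Proof.
rewrite /act_det; have -> : linfun (fun v => act 1 v) = \1%VF.
  apply/lfunP => v; rewrite id_lfunE.
  by rewrite (lfunE (linear_pack (act_linear 1))) /= ah1 orth_act1.
by rewrite passmx.mxof1 ?det1 // (basis_free (vbasisP _)).
Qed.

Lemma pin_gen_part e u : pin_gen e u -> pin_part P e u.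
Proof.
case=> [[Gu ue]|[pu ->]]; apply: Defs.sub_span.
  by exists [::], u; split=> //; rewrite big_nil mul1r.
exists [:: u], 1; split; [|exact: grouplike1|exact: detV1|by rewrite big_seq1 mulr1].
by move=> x; rewrite inE => /eqP ->.
Qed.

Lemma pin_gen_theta e u : pin_gen e u -> theta V (gamma u) = (-1) ^+ e *: gamma u.
Proof. by move=> /pin_gen_part /pin_gamma_graded /(clifford_partP char0). Qed.

Let twist_bilin v : bilin (fun a c : P => gamma a * cvec v * gamma (antipode c)).
Proof.
split=> [c a x y|x a c c']; first by rewrite ah_linear !mulrDl -!pzscalerAl.
by rewrite linearP ah_linear mulrDr -pzscalerAr.
Qed.

Lemma grouplike_twisted (e : bool) g v : grouplike g -> detV g = (-1) ^+ e ->
  gamma g * cvec v = (-1) ^+ e *: (cvec (act g v) * gamma g).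
Proof.
move=> Gg ge; have := pin_twisted v (pin_gen_part (or_introl (conj Gg ge))).
have [gg _] := Gg; rewrite gg tliftE; last exact: twist_bilin.
rewrite pzscalerAl => ->; by rewrite -!mulrA -ahM grouplike_antipodeV // ah1 mulr1.
Qed.

Lemma primitive_twisted x v : primitive x ->
  gamma x * cvec v = cvec (act x v) + cvec v * gamma x.
Proof.
move=> px; have := pin_twisted v (pin_gen_part (or_intror (conj px erefl))).
rewrite expr0 scale1r tlift_primitive // => ->.
by rewrite antipode1 ah1 antipode_primitive // ahN mulr1 mul1r mulrN subrK.
Qed.

(** Conjugation by [gamma g] sends [cvec v] to [cvec (act g v)] up to the sign [e], and preserves
    [theta] because [gamma g] is homogeneous. *)
Lemma grouplike_ext (e : bool) g v c : grouplike g -> detV g = (-1) ^+ e ->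
  ext (act g v) (gamma g * c * gamma (antipode g))
  = (-1) ^+ e *: (gamma g * ext v c * gamma (antipode g)).
Proof.
move=> Gg ge; have tg := grouplike_twisted _ Gg ge.
set a : F := (-1) ^+ e in tg *; set u := cvec (act g v).
have aa : a * a = 1 by rewrite -expr2 sqrr_sign.
set y := gamma g in tg *; set y' := gamma (antipode g).
have yy' : y * y' = 1 by rewrite -ahM grouplike_antipode // ah1.
have y'y : y' * y = 1 by rewrite -ahM grouplike_antipodeV // ah1.
have ty : theta V y = a *: y by apply: pin_gen_theta; left.
have ty' : theta V y' = a *: y'.
  have : theta V y' * theta V y = 1 by rewrite -ahM y'y ah1.
  rewrite ty => /(congr1 (fun z => a *: (z * y'))).
  by rewrite -pzscalerAr -pzscalerAl scalerA aa scale1r -mulrA yy' mulr1 mul1r.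
have uy : u * y = a *: (y * cvec v) by rewrite tg scalerA aa scale1r.
have y'u : y' * u = a *: (cvec v * y').
  rewrite -[u]mulr1 -yy' !mulrA -(mulrA y') uy -pzscalerAr -pzscalerAl.
  by rewrite mulrA y'y mul1r.
have tc : theta V (y * c * y') = y * theta V c * y'.
  by rewrite !ahM ty ty' -!pzscalerAl -pzscalerAr scalerA aa scale1r.
rewrite !extE tc -/u mulrA mulrA uy -[_ * y' * u]mulrA y'u -!pzscalerAl -pzscalerAr -scalerDr.
by rewrite -pzscalerAr -pzscalerAl !scalerA mulrC mulrDr mulrDl !mulrA.
Qed.

Lemma primitive_ext x v c : primitive x ->
  gamma x * ext v c - ext v c * gamma x
  = ext (act x v) c + ext v (gamma x * c - c * gamma x).
Proof.
move=> px; have tx := primitive_twisted v px.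
have thx : theta V (gamma x) = gamma x.
  by rewrite (@pin_gen_theta false) ?scale1r //; right.
rewrite !extE ahB !ahM thx -pzscalerAr -pzscalerAl -scalerBr -scalerDr; congr (_ *: _).
rewrite mulrDr mulrDl mulrBr mulrBl !mulrA tx.
have -> : cvec (act x v) = gamma x * cvec v - cvec v * gamma x by rewrite tx addrK.
rewrite !mulrDl !mulNr !mulrDr !mulrN !mulrA.
have sum6 (M : zmodType) (p q r s t w : M) :
    p - q + q + r - (s + t) = p - q + (w - t) + (q - s + (r - w)).
  rewrite opprD addrA [RHS](AC (2 * 2 * (2 * 2)) (((1 * 2) * 5) * 7 * 6 * 4 * (3 * 8))) /=.
  by rewrite subrr addr0.
exact: sum6.
Qed.

End PinGenerators.

(** * The map on centers *)

Section CentralMap.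
Variables (F : fieldType) (A K T : pzAlgType F) (De : {alghom K -> T}) (j : A -> T).
Variables (B : set T) (X : set K).
Hypothesis X_ker : forall k, X k <-> De k = 0.
Hypothesis j_linear : linear j.
Hypothesis j1 : j 1 = 1.
Hypothesis B_subspace : subspace B.
Hypothesis B_De : forall k, B (De k) -> De k = 0.
Hypothesis exists_rep : forall z : A, (forall x, z * x = x * z) -> exists k, B (j z - De k).
Hypothesis rep_commutes : forall (z : A) k l, (forall x, z * x = x * z) ->
  B (j z - De k) -> De k * De l = De l * De k.
Hypothesis rep_mul : forall (z z' : A) k k',
  (forall x, z * x = x * z) -> (forall x, z' * x = x * z') ->
  B (j z - De k) -> B (j z' - De k') -> B (j (z * z') - De (k * k')).
Local Notation Q := (quotalg X).

Lemma quotalg_induced : exists2 psi : {alghom Q -> T},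
  forall k, psi (qalg X k) = De k & injective psi.
Proof.
have [k /X_ker //|psi psiE] := @quotalg_lift _ _ _ X De.
exists psi => // x y; rewrite -[x]qalg_repr -[y]qalg_repr !psiE => E.
apply/qalgP; apply: sub_ideal; apply/X_ker.
by rewrite ahB E subrr.
Qed.

(** As [B] meets the image of [De] only in 0, a representative is unique in the quotient; linearity,
    unit and products of the map all follow from this uniqueness. *)
Theorem central_map : exists zeta : {alghom center A -> center Q},
  forall (z : center A) (y : center Q),
    B (j (center_val z) - De (repr (center_val y : Q))) <-> y = zeta z.
Proof.
have [psi psiE psi_inj] := quotalg_induced.
have De_repr (y : Q) : De (repr y) = psi y by rewrite -psiE qalg_repr.
pose rep (z : center A) (y : center Q) := B (j (center_val z) - psi (center_val y)).
have centerC (z : center A) x : center_val z * x = x * center_val z.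
  by have /centralP := valP z; exact.
have rep_exists z : exists y, rep z y.
  have [k Bk] := exists_rep (centerC z).
  have kC : @central F Q (qalg X k).
    apply/centralP => y; apply: psi_inj; rewrite !ahM psiE -De_repr.
    exact: rep_commutes Bk.
  by exists (Center kC); rewrite /rep /= psiE.
have rep_unique z y y' : rep z y -> rep z y' -> y = y'.
  move=> r r'; apply: val_inj; apply: psi_inj; apply/eqP; rewrite -subr_eq0; apply/eqP.
  have := subspaceB B_subspace r' r.
  have sub3 (u v w : T) : u - v - (u - w) = w - v by rewrite opprB addrC addrA subrK.
  rewrite sub3 -ahB -De_repr => /B_De.
  by rewrite De_repr.
pose f z := sval (cid (rep_exists z)).
have fP z : rep z (f z) by rewrite /f; case: cid.
have fL : linear f.
  move=> a z z'; apply: (rep_unique _ _ _ (fP _)).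
  have := subspaceD B_subspace (subspaceZ a B_subspace (fP z)) (fP z').
  by rewrite /rep /= j_linear ah_linear scalerBr addrACA -opprD.
have f1 : f 1 = 1.
  apply: (rep_unique _ _ _ (fP _)); rewrite /rep /= j1 ah1 subrr.
  exact: subspace0.
have fM : {morph f : x y / x * y}.
  move=> z z'; apply: (rep_unique _ _ _ (fP _)).
  have r y z1 : rep z1 y -> B (j (center_val z1) - De (repr (center_val y : Q))).
    by rewrite De_repr.
  have := rep_mul (centerC z) (centerC z') (r _ _ (fP z)) (r _ _ (fP z')).
  by rewrite /rep /= ahM !De_repr ahM.
exists (mkalghom fL f1 fM) => z y; rewrite mkalghomE De_repr.
by split=> [r|->]; [exact: rep_unique r (fP z)|exact: fP].
Qed.

End CentralMap.

(** * Verification of the homotopy hypotheses on the tensor product of A and C *)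

Section PinDirac.
Variables (F : fieldType) (H : hopfAlg F) (V : orthModule H) (P : pinCover V).
Hypothesis char0 : [pchar F] =i pred0.
Local Notation act k v := (orth_act (pin_pi P k) v : V).
Local Notation gamma := (pin_gamma P).
Local Notation detV := (act_det (fun (k : P) (v : V) => act k v)).
Local Notation C := (clifford V).
Local Notation theta := (theta V).
Variables (A : pzAlgType F) (hV : V -> A) (hH : {alghom H -> A}) (kap : V -> V -> H).
Hypothesis hV_linear : linear hV.
Hypothesis hH_V : forall h v,
  hH h * hV v = \tsum_(a, b <- comul h) (hV (orth_act a v) * hH b).
Hypothesis hV_comm : forall v w, hV v * hV w = hV w * hV v + hH (kap v w).
Local Notation T := (A ⊗ C)%type.
Local Notation fil := (fil hV hH).

Definition tV v : T := hV v ⊗ (1 : C).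

Fact tC_linear : linear (fun c : C => (1 : A) ⊗ c). Proof. exact: (@tens_bilin F A C).2. Qed.
Fact tC_1 : (1 : A) ⊗ (1 : C) = 1 :> T. Proof. by []. Qed.
Fact tC_M : {morph (fun c : C => (1 : A) ⊗ c) : x y / x * y >-> (x * y : T)}.
Proof. by move=> c d; rewrite tensM mulr1. Qed.
Definition tC : {alghom C -> T} := mkalghom tC_linear tC_1 tC_M.
Lemma tCE c : tC c = (1 : A) ⊗ c. Proof. exact: mkalghomE. Qed.

Definition idA : {alghom A -> A} :=
  mkalghom (f := id) (fun _ _ _ => erefl) erefl (fun _ _ => erefl).
Lemma idAE a : idA a = a. Proof. exact: mkalghomE. Qed.

Fact tTheta_linear : linear (tmap idA theta).
Proof. exact: linearP. Qed.
Definition tTheta : {alghom T -> T} := mkalghom tTheta_linear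
  (tmap1 idA theta) (tmapM idA theta).
Lemma tThetaE a c : tTheta (a ⊗ c) = a ⊗ theta c.
Proof. by rewrite mkalghomE tmapE /= idAE. Qed.

Definition hP : {alghom P -> A} := ah_comp hH (pin_pi P).
Lemma hPE k : hP k = hH (pin_pi P k). Proof. exact: ah_compE. Qed.

Fact tDelta_linear : linear (fun k : P => tmap hP gamma (comul k)).
Proof. by move=> a k k'; rewrite -!comulLE linearP linearP. Qed.
Fact tDelta_1 : tmap hP gamma (comul (1 : P)) = 1.
Proof. by rewrite comul1 tmap1. Qed.
Fact tDelta_M : {morph (fun k : P => tmap hP gamma (comul k)) : x y / x * y >-> (x * y : T)}.
Proof. by move=> k k'; rewrite comulM tmapM. Qed.
Definition tDelta : {alghom P -> T} := mkalghom tDelta_linear tDelta_1 tDelta_M.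
Lemma tDeltaE k : tDelta k = tmap hP gamma (comul k). Proof. exact: mkalghomE. Qed.

Lemma tDelta_grouplike g : grouplike g -> tDelta g = hP g ⊗ gamma g.
Proof. by move=> [gg _]; rewrite tDeltaE gg tmapE. Qed.

Lemma tDelta_primitive x : primitive x -> tDelta x = hP x ⊗ (1 : C) + (1 : A) ⊗ gamma x.
Proof.
move=> px; rewrite tDeltaE px -[LHS]/(tmap hP gamma _) linearD !tmapE.
by congr (_ ⊗ _ + _ ⊗ _); exact: ah1.
Qed.

Lemma hH_grouplike g v : grouplike g -> hH g * hV v = hV (orth_act g v) * hH g.
Proof.
move=> [gg _]; rewrite hH_V gg tliftE //; split=> [b a x y|x a b b'].
  by rewrite ((orth_act_bilin V).1 v) hV_linear mulrDl -pzscalerAl.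
by rewrite ah_linear mulrDr -pzscalerAr.
Qed.

Lemma hH_primitive x v : primitive x -> hH x * hV v = hV (orth_act x v) + hV v * hH x.
Proof.
move=> px; rewrite hH_V tlift_primitive //; last first.
  split=> [b a y z|z a b b'].
    by rewrite ((orth_act_bilin V).1 v) hV_linear mulrDl -pzscalerAl.
  by rewrite ah_linear mulrDr -pzscalerAr.
by rewrite ah1 mulr1 orth_act1.
Qed.

Lemma tV_linear : linear tV.
Proof. by move=> a v w; rewrite /tV hV_linear tensDl tensZl. Qed.

Lemma tC_tV c v : tC c * tV v = tV v * tC c.
Proof. by rewrite tCE !tensM !mul1r !mulr1. Qed.

Lemma tTheta_tV v : tTheta (tV v) = tV v.
Proof. by rewrite tThetaE ah1. Qed.

Lemma tTheta_tC c : tTheta (tC c) = tC (theta c).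
Proof. by rewrite !tCE tThetaE. Qed.

Lemma tThetaK : involutive tTheta.
Proof.
move=> t; have [n [u [v ->]]] := tensor_sum t.
by rewrite !ah_sum; apply: eq_bigr => i _; rewrite !tThetaE thetaK.
Qed.

Lemma tTheta_gen e u : pin_gen e u -> tTheta (tDelta u) = (-1) ^+ e *: tDelta u.
Proof.
move=> ue; have th := pin_gen_theta char0 ue; case: ue th => [[Gu _]|[pu ->]] th.
  by rewrite tDelta_grouplike // tThetaE th tensZr.
by rewrite tDelta_primitive // ahD !tThetaE th ah1 expr0 !scale1r.
Qed.

Lemma tDelta_tV_grouplike g v : grouplike g -> tDelta g * tV v = tV (act g v) * tDelta g.
Proof.
move=> Gg; rewrite tDelta_grouplike // /tV !tensM mulr1 mul1r hPE hH_grouplike //.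
exact: pin_pi_grouplike.
Qed.

Lemma tDelta_tV_primitive x v : primitive x ->
  tDelta x * tV v = tV (act x v) + tV v * tDelta x.
Proof.
move=> px; rewrite tDelta_primitive // /tV mulrDl mulrDr !tensM !mulr1 !mul1r hPE.
rewrite hH_primitive ?tensDl ?addrA //; exact: pin_pi_primitive.
Qed.

Lemma tDelta_tC_grouplike g c : grouplike g ->
  tDelta g * tC c = tC (gamma g * c * gamma (antipode g)) * tDelta g.
Proof.
move=> Gg; rewrite tDelta_grouplike // !tCE !tensM mulr1 mul1r -!mulrA -ahM.
by rewrite grouplike_antipodeV // ah1 mulr1.
Qed.

Lemma tDelta_tC_primitive x c : primitive x ->
  tDelta x * tC c = tC (gamma x * c - c * gamma x) + tC c * tDelta x.
Proof.
move=> px; rewrite tDelta_primitive // !tCE mulrDl mulrDr !tensM !mulr1 !mul1r.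
by rewrite tensBr addrC -addrA [- _ + _]addrC addrK addrC.
Qed.

Section DiracElement.
Variables (n : nat) (b b' : n.-tuple V).
Hypothesis bb' : dual_bases b b'.
Local Notation D := (diracT tV tC b b').

Fact tVC_bilin : bilin (fun v w : V => tV v * tC (cvec w)).
Proof.
split=> [w a v v'|v a w w']; first by rewrite tV_linear mulrDl -pzscalerAl.
by rewrite cvec_linear ah_linear mulrDr -pzscalerAr.
Qed.

(** A group-like moves past [D] by acting on both factors of the canonical tensor, which is
    invariant; the determinant sign in the Clifford factor is that of [tTheta]. For a primitive the
    correction is the infinitesimal variation of this tensor, hence 0. *)
Lemma dirac_tDelta k : D * tDelta k = tTheta (tDelta k) * D.
Proof.
pose S := [set k | D * tDelta k = tTheta (tDelta k) * D].
have sS : subspace S.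
  split=> [|a x y Sx Sy]; first by rewrite /S /= !ah0 mulr0 mul0r.
  by rewrite /S /= !ah_linear mulrDr mulrDl -pzscalerAr -pzscalerAl Sx Sy.
have S1 : S 1 by rewrite /S /= !ah1 mulr1 mul1r.
suff SM e u k' : pin_gen e u -> S k' -> S (u * k').
  exact: (@pin_ind _ _ _ _ char0 S sS S1 SM k).
move=> ue Sk; rewrite /S /= !ahM mulrA -[RHS]mulrA -[in RHS]Sk mulrA; congr (_ * _).
rewrite (tTheta_gen ue) /diracT mulr_sumr.
pose L := tliftL tVC_bilin.
have LE v w : tV v * tC (cvec w) = L (v ⊗ w) by rewrite tliftLE.
case: ue => [[Gu ue]|[pu ->]].
  have E v w : ((-1) ^+ e *: tDelta u) * (tV v * tC (cvec w))
      = tV (act u v) * tC (cvec (act u w)) * tDelta u.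
    rewrite -pzscalerAl mulrA tDelta_tV_grouplike // -[in LHS]mulrA tDelta_tC_grouplike //.
    rewrite (grouplike_twisted w Gu ue) -pzscalerAl -mulrA -ahM grouplike_antipode // ah1 mulr1.
    by rewrite ahZ -pzscalerAl -pzscalerAr scalerA -expr2 sqrr_sign scale1r mulrA.
  under [RHS]eq_bigr do rewrite E.
  rewrite -mulr_suml; congr (_ * _).
  under eq_bigr do rewrite LE; under [RHS]eq_bigr do rewrite LE.
  by rewrite -!linear_sum (dual_tensor_grouplike bb' (pin_pi_grouplike Gu)).
have E v w : ((-1) ^+ false *: tDelta u) * (tV v * tC (cvec w))
    = L (act u v ⊗ w + v ⊗ act u w) + tV v * tC (cvec w) * tDelta u.
  rewrite expr0 scale1r mulrA tDelta_tV_primitive // mulrDl -[in LHS]mulrA.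
  rewrite tDelta_tC_primitive // primitive_twisted // addrK mulrDr mulrA addrA.
  by rewrite linearD -!LE.
under [RHS]eq_bigr do rewrite E.
rewrite big_split /= -linear_sum (dual_tensor_primitive bb' (pin_pi_primitive pu)).
by rewrite linear0 add0r mulr_suml.
Qed.

End DiracElement.

Definition Tfil m : set T := linspan [set a ⊗ c | a in fil m & c in [set: C]].

Lemma Tfil_subspace m : subspace (Tfil m). Proof. exact: span_subspace. Qed.

Lemma Tfil_tens m a c : fil m a -> Tfil m (a ⊗ c).
Proof. by move=> fa; apply: Defs.sub_span; exists a => //; exists c. Qed.

Lemma Tfil_le m m' : (m <= m')%N -> Tfil m `<=` Tfil m'.
Proof.
move=> mm'; apply: linspan_sub => _ [a fa [c _ <-]]; exists a; first exact: fil_le fa.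
by exists c.
Qed.

Lemma Tfil_0 x : Tfil 0 x -> x = 0.
Proof.
have f0 a : fil 0 a -> a = 0.
  by apply: (span_min (subspace0set A)) => y [vs [h []]].
by apply: (span_min (subspace0set T)) => _ [a /f0 -> [c _ <-]]; exact: tens0l.
Qed.

Lemma Tfil_mul m a c k : fil m a -> Tfil m ((a ⊗ (1 : C)) * tC c * tDelta k).
Proof.
move=> fa; rewrite tCE tensM mul1r mulr1 tDeltaE.
pose S : set (P ⊗ P)%type := [set t | Tfil m (lmul (a ⊗ c) (tmap hP gamma t))].
suff : S (comul k) by rewrite /S /= lmulE.
apply: tensor_subspace => [|u v].
  exact: (@subspace_preim _ _ _ (tmap hP gamma) _ (@subspace_preim _ _ _ (lmul (a ⊗ c)) _ (Tfil_subspace m))).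
rewrite /S /= lmulE tmapE tensM; apply: Tfil_tens.
by have := @filHr _ _ _ _ hV hH m (pin_pi P u) a fa; rewrite -hPE.
Qed.

Lemma tV_exp v m : tV v ^+ m = hV v ^+ m ⊗ (1 : C).
Proof. by elim: m => // m IH; rewrite !exprS IH tensM mulr1. Qed.

Lemma tV_dpow v w m : dpow (tV v) (tV w) m = dpow (hV v) (hV w) m ⊗ (1 : C).
Proof.
elim: m => [|m IH] /=; first by rewrite tens0l.
by rewrite IH tV_exp !tensM !mulr1 tensDl.
Qed.

Local Notation gen := (gen tV tC tDelta).

Lemma Tfil_gen m v c k : Tfil m.+1 (gen v m c k).
Proof. by rewrite /gen tV_exp; apply: Tfil_mul; exact: fil_exp1. Qed.

Lemma Tfil_tV m v x : Tfil m x -> Tfil m.+1 (tV v * x).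
Proof.
move=> mx; have := @span_map _ _ _ (lmul (tV v)) _ _ x (Tfil_subspace m.+1) _ mx.
rewrite lmulE; apply=> _ [a fa [c _ <-]].
by rewrite lmulE tensM; apply: Tfil_tens; exact: filV.
Qed.

Lemma Tfil_swap v w m c k :
  Tfil m ((tV v ^+ m * tV w - tV w * tV v ^+ m) * tC c * tDelta k).
Proof.
rewrite tV_exp !tensM !mulr1 -tensBl; apply: Tfil_mul.
by have := @fil_swap _ _ _ _ _ _ _ hH_V hV_comm v w m 0; rewrite addn0 expr0 mulr1.
Qed.

Lemma Tfil_dpow v w m c k : Tfil m
  ((dpow (tV v) (tV w) m.+1 - m.+1%:R *: (tV w * tV v ^+ m)) * tC c * tDelta k).
Proof.
rewrite tV_dpow tV_exp tensM mulr1 -tensZl -tensBl; apply: Tfil_mul.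
exact: (fil_dpow hH_V hV_comm).
Qed.

(** On generators [g ⊗ 1] is [gamma (antipode g)] times the diagonal of [g], and [x ⊗ 1] is the
    diagonal of [x] minus [gamma x]; so [H] can be traded for the diagonal. *)
Lemma hP_span k c : linspan [set x | exists c' k', x = tC c' * tDelta k'] (hP k ⊗ c).
Proof.
set X := [set x | _]; have sX := span_subspace X.
pose S := [set k | forall c, linspan X (hP k ⊗ c)].
have sS : subspace S.
  split=> [d|a x y Sx Sy d]; first by rewrite ah0 tens0l; exact: subspace0.
  by rewrite ah_linear tensDl tensZl; apply: sX.2.
have S1 : S 1 by move=> d; apply: Defs.sub_span; exists d, 1; rewrite !ah1 mulr1 tCE.
suff SM e u k' : pin_gen e u -> S k' -> S (u * k').
  exact: (@pin_ind _ _ _ _ char0 S sS S1 SM k c).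
move=> ue Sk d.
have -> : hP (u * k') ⊗ d = lmul (hP u ⊗ (1 : C)) (hP k' ⊗ d).
  by rewrite lmulE tensM mul1r ahM.
apply: (span_map sX _ (Sk d)) => _ [c' [k1 ->]]; rewrite lmulE mulrA.
have -> : (hP u ⊗ (1 : C)) * tC c' = tC c' * (hP u ⊗ (1 : C)).
  by rewrite tCE !tensM !mul1r !mulr1.
case: ue => [[Gu _]|[pu _]].
  have -> : hP u ⊗ (1 : C) = tC (gamma (antipode u)) * tDelta u.
    by rewrite tDelta_grouplike // tCE tensM mul1r -ahM grouplike_antipodeV // ah1.
  apply: Defs.sub_span; exists (c' * gamma (antipode u)), (u * k1).
  by rewrite !ahM !mulrA.
have -> : hP u ⊗ (1 : C) = tDelta u - tC (gamma u).
  by rewrite tDelta_primitive // tCE addrK.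
rewrite mulrBr mulrBl; apply: (subspaceB sX); apply: Defs.sub_span.
  by exists c', (u * k1); rewrite ahM mulrA.
by exists (c' * gamma u), k1; rewrite ahM.
Qed.

Lemma Tfil_spanned m x : Tfil m x ->
  linspan [set y | exists j v c k, (j < m)%N /\ y = gen v j c k] x.
Proof.
set Y := [set y | _]; have sY := span_subspace Y.
apply: (span_min sY) => _ [a fa [c _ <-]].
rewrite -[a ⊗ c]/(tensl _ c a).
have := fil_powers char0 hV_linear hH_V hV_comm fa.
apply: (span_map sY) => _ [j [v [h [jm ->]]]].
have [k <-] := pin_pi_epi P h.
have -> : tensl _ c (hV v ^+ j * hH (pin_pi P k)) = lmul (tV v ^+ j) (hP k ⊗ c).
  by rewrite lmulE tV_exp tensM mul1r hPE.
apply: (span_map sY _ (hP_span k c)) => _ [c' [k' ->]].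
by apply: Defs.sub_span; exists j, v, c', k'; rewrite lmulE /gen mulrA.
Qed.

Hypothesis fil_exhaust : forall a, exists m, fil m a.

Lemma Tfil_exhaust x : exists m, Tfil m x.
Proof.
apply: (@tensor_subspace F A C [set x | exists m, Tfil m x]) => [|a c].
  split; first by exists 0; exact: (Tfil_subspace 0).1.
  move=> a y z [m my] [m' mz]; exists (maxn m m'); apply: (Tfil_subspace _).2.
    exact: Tfil_le (leq_maxl _ _) _ my.
  exact: Tfil_le (leq_maxr _ _) _ mz.
by have [m fa] := fil_exhaust a; exists m; exact: Tfil_tens.
Qed.

Hypothesis fil_symbol : forall (I : Type) (s : seq I) (v : I -> V) (h : I -> H) m,
  fil m (\sum_(i <- s) hV (v i) ^+ m * hH (h i)) ->
  forall xi : {linear V -> F^o}, \sum_(i <- s) (xi (v i) : F) ^+ m *: h i = 0.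

Lemma sliceR_tDelta (r : {linear C -> F^o}) a c k :
  sliceR r ((a ⊗ (1 : C)) * tC c * tDelta k)
  = a * hP (hit (r \o lmul c \o linear_pack (ah_linear gamma)) k).
Proof.
rewrite tCE tensM mul1r mulr1 tDeltaE hitS.
pose f := sliceR r \o (lmul (a ⊗ c) \o tmap hP gamma).
pose g := lmul a \o (linear_pack (ah_linear hP) \o
  sliceR (r \o lmul c \o linear_pack (ah_linear gamma))).
have := @tensor_linear_eq F P P A f g _ (comul k).
rewrite /f /g /= !lmulE; apply=> u v; rewrite !lmulE tmapE tensM !sliceRE.
by rewrite ahZ -pzscalerAr /= lmulE.
Qed.

Lemma Tfil_slice m (r : {linear C -> F^o}) x : Tfil m x -> fil m (sliceR r x).
Proof.
have sf := @fil_subspace _ _ _ _ hV hH m.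
apply: (span_map sf) => _ [a fa [c _ <-]].
by rewrite sliceRE; apply: (subspaceZ _ sf).
Qed.

(** A slice along [C] turns [c] and the diagonal of [k] into one element of [H], to which the symbol
    property in [A] applies; all slices together detect elements of the tensor product. *)
Lemma Tfil_symbol m (J : Type) (s : seq J) (v : J -> V) (c : J -> C) (k : J -> P) :
  Tfil m (\sum_(j <- s) gen (v j) m (c j) (k j)) ->
  forall f : {linear V -> F^o},
  \sum_(j <- s) (f (v j) : F) ^+ m *: (tC (c j) * tDelta (k j)) = 0.
Proof.
move=> S f; apply: tensor_eq0 => r.
pose h j := pin_pi P (hit (r \o lmul (c j) \o linear_pack (ah_linear gamma)) (k j)).
have E a j : sliceR r ((a ⊗ (1 : C)) * tC (c j) * tDelta (k j)) = a * hH (h j).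
  by rewrite sliceR_tDelta hPE.
have := Tfil_slice r S; rewrite linear_sum.
under eq_bigr do rewrite /gen tV_exp E.
move=> /fil_symbol /(_ f) /(congr1 hH); rewrite ah0 ah_sum => E0.
rewrite linear_sum -[RHS]E0; apply: eq_bigr => j _.
by rewrite linearZ_LR -[tC _]mul1r E mul1r ahZ.
Qed.

Lemma tTheta_tDelta k : exists k', tTheta (tDelta k) = tDelta k'.
Proof.
pose S := [set k | exists k', tTheta (tDelta k) = tDelta k'].
have sS : subspace S.
  split=> [|a x y [x' ex] [y' ey]]; first by exists 0; rewrite !ah0.
  by exists (a *: x' + y'); rewrite !ah_linear ex ey.
have S1 : S 1 by exists 1; rewrite !ah1.
suff SM e u l : pin_gen e u -> S l -> S (u * l).
  exact: (@pin_ind _ _ _ _ char0 S sS S1 SM k).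
move=> ue [l' el]; exists (((-1) ^+ e *: u) * l').
by rewrite !ahM ahZ (tTheta_gen ue) el.
Qed.

Section DiracCohomology.
Variables (n : nat) (b b' : n.-tuple V).
Hypothesis bb' : dual_bases b b'.
Local Notation D := (diracT tV tC b b').
Local Notation d := (ddiff tV tC tTheta b b').
Local Notation X := (det_inv tDelta tTheta).

(** Equivariance is multiplicative in [k], so it is enough to check it on the generators of the
    cover. *)
Lemma contraction_equivariant : exists kT : {linear T -> T},
  (forall v m c k, kT (gen v m c k) = m%:R *: gen v m.-1 (ext v c) k) /\
  (forall k x, kT (tDelta k * x) = tTheta (tDelta k) * kT x).
Proof.
have [kT kTE] := contraction_exists char0 tV_linear tC_tV tTheta_tC bb' (dirac_tDelta bb')
  Tfil_subspace Tfil_le Tfil_gen Tfil_spanned Tfil_exhaust Tfil_symbol.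
exists kT; split=> // k.
pose S := [set k | forall x, kT (tDelta k * x) = tTheta (tDelta k) * kT x].
have S1 : S 1 by move=> x; rewrite !ah1 !mul1r.
have sS : subspace S := contraction_equivariant_closed tDelta tTheta kT.
suff SM e u l : pin_gen e u -> S l -> S (u * l).
  exact: (@pin_ind _ _ _ _ char0 S sS S1 SM k).
move=> ue; apply: contraction_equivariantM; have th := tTheta_gen ue.
case: ue th => [[Gu ue]|[pu ->]] th.
  apply: (contraction_grouplike Tfil_spanned Tfil_exhaust kTE) th _ => [v|c|v c].
  - exact: tDelta_tV_grouplike.
  - exact: tDelta_tC_grouplike.
  - exact: grouplike_ext.
rewrite expr0 scale1r in th.
apply: (contraction_primitive char0 tV_linear Tfil_spanned Tfil_exhaust kTE) th _ => [v|c|v c].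
- exact: tDelta_tV_primitive.
- exact: tDelta_tC_primitive.
- exact: primitive_ext.
Qed.

Variables (c0 : T) (k0 : P).
Hypothesis c0_central : forall x, c0 * x = x * c0.
Hypothesis Th_k0 : tTheta (tDelta k0) = tDelta k0.
Hypothesis D2 : D * D = c0 + tDelta k0.

Lemma dirac_closed e x : X e x -> d x = 0 ->
  exists k y, X (~~ e) y /\ x = tDelta k + d y.
Proof.
have [kT [kTE kTD]] := contraction_equivariant.
exact: (ddiff_closed char0 tV_linear tC_tV tTheta_tV tTheta_tC tThetaK tTheta_tDelta bb'
  (dirac_tDelta bb') Tfil_subspace Tfil_le Tfil_0 Tfil_gen Tfil_spanned Tfil_exhaust
  Tfil_tV Tfil_swap Tfil_dpow kTE kTD c0_central Th_k0 D2).
Qed.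

Lemma dirac_exact_image e y k : X e y -> d y = tDelta k -> tDelta k = 0.
Proof.
have [kT [kTE kTD]] := contraction_equivariant.
exact: (ddiff_exact_image char0 tV_linear tC_tV tTheta_tV tTheta_tC tThetaK tTheta_tDelta bb'
  (dirac_tDelta bb') Tfil_subspace Tfil_le Tfil_0 Tfil_gen Tfil_spanned Tfil_exhaust
  Tfil_tV Tfil_swap Tfil_dpow kTE kTD c0_central Th_k0 D2).
Qed.

Lemma dirac_odd a : X true a -> d a = D * a + a * D.
Proof. by move=> [Ta _]; rewrite /ddiff Ta scaleN1r mulNr opprK. Qed.

Lemma dirac_even_map e x : X e x -> X (~~ e) (d x).
Proof. exact: (ddiff_Xe tTheta_tV tTheta_tC tThetaK tTheta_tDelta (dirac_tDelta bb')). Qed.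

Section CentralElements.
Variable z : A.
Hypothesis zC : forall x, z * x = x * z.

Lemma central_tens (t : T) : (z ⊗ (1 : C)) * t = t * (z ⊗ (1 : C)).
Proof.
have [m [u [v ->]]] := tensor_sum t.
rewrite mulr_sumr mulr_suml; apply: eq_bigr => i _.
by rewrite !tensM mul1r mulr1 zC.
Qed.

Lemma central_X0 : X false (z ⊗ (1 : C)).
Proof.
by split=> [|k]; [rewrite tThetaE ah1 expr0 scale1r|rewrite central_tens].
Qed.

Lemma central_decomposition : exists k a, X true a /\ z ⊗ (1 : C) = tDelta k + d a.
Proof.
apply: (dirac_closed central_X0).
by rewrite /ddiff tThetaE ah1 central_tens subrr.
Qed.

(** It follows that the representative commutes with the whole image of [tDelta], which is why
    [zeta] takes central values. *)
Lemma decomposition_X0 k a : X true a -> z ⊗ (1 : C) = tDelta k + d a ->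
  X false (tDelta k).
Proof.
move=> Xa /esym/(canRL (addrK _)) ->; apply: (subspaceB (det_inv_subspace _ _ _)).
  exact: central_X0.
exact: (dirac_even_map Xa).
Qed.

End CentralElements.

(** With [w = z' ⊗ 1], the product is [tDelta k * tDelta k' + tDelta k * d a' + d a * w]. The last
    two terms are [d (tDelta k * a' + a * w)], since [tDelta k] is even and [w] commutes with
    [D]. *)
Lemma decomposition_mul (z z' : A) k k' a a' : (forall x, z * x = x * z) ->
  (forall x, z' * x = x * z') -> X true a -> X true a' ->
  z ⊗ (1 : C) = tDelta k + d a -> z' ⊗ (1 : C) = tDelta k' + d a' ->
  exists a1, X true a1 /\ (z * z') ⊗ (1 : C) = tDelta (k * k') + d a1.
Proof.
move=> zC z'C Xa Xa' E E'.
have [Tk Ck] := decomposition_X0 zC Xa E.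
have [Tz Cz] := central_X0 z'C; set w := z' ⊗ (1 : C) in E' Tz Cz *.
exists (tDelta k * a' + a * w); split.
  apply: (subspaceD (det_inv_subspace _ _ _)).
    case: Xa' => Ta' Ca'; split=> [|l]; first by rewrite ahM Tk Ta' expr0 scale1r pzscalerAr.
    have [l' el] := tTheta_tDelta l.
    by rewrite mulrA el Ck -mulrA -el Ca' mulrA.
  case: Xa => Ta Ca; split=> [|l]; first by rewrite ahM Tz Ta expr0 scale1r pzscalerAl.
  by rewrite mulrA Ca -[LHS]mulrA Cz mulrA.
have -> : (z * z') ⊗ (1 : C) = (z ⊗ (1 : C)) * w by rewrite tensM mulr1.
rewrite E mulrDl {1}E' mulrDr -ahM -addrA; congr (_ + _).
rewrite -[d (_ + _)]ddiffLE linearD !ddiffLE (ddiffMl (dirac_tDelta bb')) Tk expr0 scale1r; congr (_ + _).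
rewrite /ddiff ahM Tz expr0 scale1r mulrBl -!mulrA; congr (_ * _ - _ * _).
by rewrite (central_tens z'C).
Qed.

Theorem dirac_central_map (Y : set P) : (forall k, Y k <-> tDelta k = 0) ->
  exists zeta : {alghom center A -> center (quotalg Y)},
  forall (z : center A) (y : center (quotalg Y)),
    (exists2 a, X true a & center_val z ⊗ (1 : C)
       = tDelta (repr (center_val y : quotalg Y)) + d a) <-> y = zeta z.
Proof.
move=> Yker; pose B : set T := [set x | exists2 a, X true a & x = d a].
have sB : subspace B.
  split=> [|a x y [u Xu ->] [v Xv ->]].
    by exists 0; [exact: subspace0 (det_inv_subspace _ _ _)|rewrite -ddiffLE linear0].
  by exists (a *: u + v); [exact: (det_inv_subspace _ _ _).2|rewrite -!ddiffLE linearP].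
have BE (z : A) k : B (z ⊗ (1 : C) - tDelta k) <->
    exists2 a, X true a & z ⊗ (1 : C) = tDelta k + d a.
  split=> -[a Xa E]; exists a => //; first by rewrite -E addrC subrK.
  by rewrite E addrC addKr.
have jL : linear (fun z : A => z ⊗ (1 : C)) by exact: (@tens_bilin F A C).1.
have B_De k : B (tDelta k) -> tDelta k = 0.
  by move=> [a Xa E]; exact: (dirac_exact_image Xa).
have ex (z : A) : (forall x, z * x = x * z) -> exists k, B (z ⊗ (1 : C) - tDelta k).
  move=> zC; have [k [a [Xa E]]] := central_decomposition zC.
  by exists k; apply/BE; exists a.
have rc (z : A) k l : (forall x, z * x = x * z) -> B (z ⊗ (1 : C) - tDelta k) ->
    tDelta k * tDelta l = tDelta l * tDelta k.
  by move=> zC /BE [a Xa E]; have [_ ->] := decomposition_X0 zC Xa E.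
have rm (z z' : A) k k' : (forall x, z * x = x * z) -> (forall x, z' * x = x * z') ->
    B (z ⊗ (1 : C) - tDelta k) -> B (z' ⊗ (1 : C) - tDelta k') ->
    B ((z * z') ⊗ (1 : C) - tDelta (k * k')).
  move=> zC z'C /BE [a Xa E] /BE [a' Xa' E'].
  by have [a1 [Xa1 E1]] := decomposition_mul zC z'C Xa Xa' E E'; apply/BE; exists a1.
have [zeta zP] := central_map Yker jL erefl sB B_De ex rc rm.
by exists zeta => z y; rewrite -zP BE.
Qed.

End DiracCohomology.

(** Gives the first Sweedler factor the parity of [k], so that the sign in [twisted_invariantP] can
    be taken out of the sum. *)
Lemma pin_part_span e k : pin_part P e k ->
  linspan [set a ⊗ c | a in pin_part P e & c in [set: P]] (comul k).
Proof.
have sp e' := span_subspace (V := P) [set h | exists (xs : seq P) (g : P),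
    [/\ {in xs, forall x, primitive x}, grouplike g, detV g = (-1) ^+ e'
      & h = (\prod_(x <- xs) x) * g]].
pose Y := [set a ⊗ c | a in pin_part P e & c in [set: P]].
have sY : subspace (linspan Y) := span_subspace _.
rewrite -/Y -comulLE; apply: (@span_map _ _ _ (comulL P) _ (linspan Y) k sY) => _ [xs [g [pxs Gg ge ->]]].
rewrite comulLE.
elim: xs pxs => [|x xs IH] pxs.
  rewrite big_nil mul1r; have [-> _] := Gg; apply: Defs.sub_span.
  exists g; last by exists g.
  exact: (@pin_gen_part _ _ _ _ e g (or_introl (conj Gg ge))).
have [px pxs'] := prims_cons pxs.
rewrite big_cons -mulrA comulM px.
have partM a : pin_part P e a -> pin_part P e (x * a).
  rewrite -lmulE; apply: (span_map (sp e)) => _ [ys [g' [pys Gg' ge' ->]]].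
  apply: Defs.sub_span; exists (x :: ys), g'; split=> //; last by rewrite lmulE big_cons mulrA.
  by move=> y; rewrite inE => /orP[/eqP ->|/pys].
pose L : {linear (P ⊗ P)%type -> (P ⊗ P)%type} :=
  lmul (x ⊗ (1 : P) + (1 : P) ⊗ x : (P ⊗ P)%type).
suff gY y : Y y -> linspan Y (L y).
  have := @span_map _ _ _ L Y (linspan Y) _ sY gY (IH pxs').
  by rewrite /L lmulE.
case=> a ea [c _ <-]; rewrite /L lmulE mulrDl !tensM !mul1r; apply: (subspaceD sY); apply: Defs.sub_span.
  by exists (x * a); [exact: partM|exists c].
by exists a => //; exists (x * c).
Qed.

Lemma tTheta_part e k : pin_part P e k -> tTheta (tDelta k) = (-1) ^+ e *: tDelta k.
Proof.
move=> ek.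
pose f := linear_pack (ah_linear (ah_comp tTheta tDelta)).
pose g : {linear P -> T} := ((-1) ^+ e \*: linear_pack (ah_linear tDelta))%R.
suff : f k = g k by rewrite /f /= ah_compE.
apply: (linear_eq_span ek) => _ [xs [u [pxs Gu ue ->]]].
rewrite /f /= ah_compE.
elim: xs pxs => [|x xs IH] pxs.
  by rewrite big_nil mul1r; apply: tTheta_gen; left.
have [px pxs'] := prims_cons pxs.
rewrite big_cons -mulrA; have {IH} := IH pxs'; set y := _ * u => IH.
have xe : pin_gen false x by right.
by rewrite /= (ahM tDelta) (ahM tTheta) IH (tTheta_gen xe) expr0 scale1r pzscalerAr.
Qed.

(** In one direction the twisted commutation is read off on generators. In the other, [tDelta a * x]
    is a sign times [x * tDelta a], and the antipode axiom collapses the sum. *)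
Lemma twisted_invariantP (x : T) :
  (tTheta x = - x /\ forall e k, pin_part P e k ->
     \tsum_(a, c <- comul k) (tDelta a * x * tDelta (antipode c))
     = ((-1) ^+ e * counit k) *: x)
  <-> det_inv tDelta tTheta true x.
Proof.
have bx : bilin (fun a c : P => tDelta a * x * tDelta (antipode c)).
  split=> [c a u v|a c u v]; first by rewrite ah_linear !mulrDl -!pzscalerAl.
  by rewrite linearP ah_linear mulrDr -pzscalerAr.
split=> [[Tx Ix]|[Tx Cx]]; split; rewrite ?scaleN1r ?Tx ?scaleN1r //.
  pose S := [set k | tTheta (tDelta k) * x = x * tDelta k].
  have sS : subspace S.
    split=> [|a y z Sy Sz]; first by rewrite /S /= !ah0 mulr0 mul0r.
    by rewrite /S /= !ah_linear mulrDr mulrDl -pzscalerAr -pzscalerAl Sy Sz.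
  have S1 : S 1 by rewrite /S /= !ah1 mulr1 mul1r.
  suff SM e u l : pin_gen e u -> S l -> S (u * l).
    move=> k.
    exact: (@pin_ind _ _ _ _ char0 S sS S1 SM k).
  move=> ue Sl; rewrite /S /= !ahM mulrA -[LHS]mulrA Sl mulrA; congr (_ * _).
  rewrite (tTheta_gen ue); have := Ix _ _ (@pin_gen_part _ _ _ _ _ _ ue).
  case: ue => [[Gu _]|[pu ->]].
    have [gg g1] := Gu; rewrite gg g1 mulr1 tliftE // => E.
    rewrite -pzscalerAl -[tDelta u * x]mulr1 -(ah1 tDelta) -(grouplike_antipodeV Gu).
    by rewrite ahM mulrA E -pzscalerAl scalerA -expr2 sqrr_sign scale1r.
  rewrite tlift_primitive // antipode1 antipode_primitive // !ah1 mulr1 mul1r.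
  rewrite eps_primitive // mulr0 scale0r ahN mulrN expr0 scale1r => E.
  by apply/eqP; rewrite -subr_eq0 E.
move=> e k ek.
have bS : bilin (fun a c : P => a * antipode c).
  split=> [c a u v|a c u v]; first by rewrite mulrDl -pzscalerAl.
  by rewrite linearP mulrDr -pzscalerAr.
pose g : {linear (P ⊗ P)%type -> T} :=
  ((-1) ^+ e \*: (lmul x \o (linear_pack (ah_linear tDelta) \o tliftL bS)))%R.
have fg : tliftL bx (comul k) = g (comul k).
  apply: (linear_eq_span (pin_part_span ek)) => _ [a ea [c _ <-]].
  rewrite /g /= lmulE !tliftLE ahM mulrA -Cx (tTheta_part ea) -!pzscalerAl scalerA.
  by rewrite -expr2 sqrr_sign scale1r.
transitivity (tliftL bx (comul k)); first by rewrite mklinE.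
rewrite fg /g /= lmulE mklinE antipoder ahZ ah1 -pzscalerAr mulr1 scalerA.
by [].
Qed.

End PinDirac.

Section HeckeExhaustion.
Variables (F : fieldType) (H : hopfAlg F) (V : orthModule H).
Variable kappa : {linear wedge2 V -> H}.
Local Notation A := (hecke kappa).
Local Notation hV := (hecke_V kappa).
Local Notation hH := (hHa kappa).

(** The union of the filtration contains 1 and is stable under left multiplication by both kinds of
    generators. *)
Lemma hecke_fil_exhaust (x : A) : exists n, fil hV hH n x.
Proof.
pose S : set A := [set x | exists n, fil hV hH n x].
have sS : subspace S.
  split; first by exists 0; exact: (@fil_subspace _ _ _ _ hV hH 0).1.
  move=> a y z [m my] [m' mz]; exists (maxn m m'); apply: (@fil_subspace _ _ _ _ hV hH _).2.
    exact: (@fil_le _ _ _ _ _ _ _ _ (leq_maxl m m') _ my).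
  exact: (@fil_le _ _ _ _ _ _ _ _ (leq_maxr m m') _ mz).
have S1 : S 1 by exists 1; rewrite -(ah1 hH); exact: fil_H.
have SH h y : S y -> S (hH h * y) by move=> [m my]; exists m; apply: (filHl (@hHa_V _ _ _ kappa)).
have ST t y : S y -> S (hT kappa t * y).
  move=> Sy; rewrite -rmulE.
  have := @span_map _ _ _ (rmul y \o linear_pack (ah_linear (hT kappa))) _ S t sS _ (tensoralg_span t).
  rewrite /= rmulE; apply=> _ [vs _ <-]; rewrite /= rmulE ah_prod.
  elim: vs => [|v vs IH]; first by rewrite big_nil mul1r.
  have [m my] := IH; rewrite big_cons -mulrA hTE; exists m.+1; exact: filV.
have [t ->] := qalg_surj x; have [u ->] := qalg_surj t; have [w ->] := qalg_surj u.
pose phi := ah_comp (qalg (hecke_rel kappa))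
  (ah_comp (qalg (smash_rel (@tvec F V))) (qalg (@freeprod_rel F (tensoralg V) H))).
have -> : qalg (hecke_rel kappa) (qalg (smash_rel (@tvec F V))
    (qalg (@freeprod_rel F (tensoralg V) H) w)) = phi w by rewrite !ah_compE.
apply: (@span_map _ _ _ (linear_pack (ah_linear phi)) _ S w sS _ (freealg_span w)) => _ [s _ <-].
rewrite /= ah_prod; elim: s => [|g s IH]; first by rewrite big_nil.
rewrite big_cons; case: g => [t'|h].
  have -> : phi (fgen F (inl t')) = hT kappa t' by rewrite !ah_compE hTE.
  exact: ST.
have -> : phi (fgen F (inr h)) = hH h by rewrite !ah_compE hHaE.
exact: SH.
Qed.

End HeckeExhaustion.

Lemma AC_oddP (F : fieldType) (H : hopfAlg F) (V : orthModule H)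
    (kappa : {linear wedge2 V -> H}) : [pchar F] =i pred0 ->
  forall x, @AC_odd _ _ _ kappa x <-> tTheta V (hecke kappa) x = - x.
Proof.
move=> char0 x; set Th := tTheta _ _.
pose f := linear_pack (ah_linear Th).
split=> [xo|xTh].
  pose g : {linear (hecke kappa ⊗ clifford V)%type -> (hecke kappa ⊗ clifford V)%type} :=
    ((-1) \*: idfun)%R.
  suff : f x = g x by rewrite /g /= scaleN1r.
  apply: (linear_eq_span xo) => _ [a _ [c co <-]].
  have /(clifford_partP char0) tc := co.
  by rewrite /f /g /= tThetaE tc expr1 tensZr.
have sO : subspace (@AC_odd F H V kappa) := span_subspace _.
have odd_part t : @AC_odd _ _ _ kappa (t - Th t).
  apply: (@tensor_subspace _ _ _ [set t | @AC_odd _ _ _ kappa (t - Th t)]) => [|a c].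
    exact: (@subspace_preim _ _ _ (idfun \- f)%R _ sO).
  rewrite /= tThetaE -tensBr; apply: Defs.sub_span; exists a => //.
  exists (c - theta V c) => //; apply/(clifford_partP char0).
  by rewrite ahB thetaK expr1 scaleN1r opprB.
have := subspaceZ 2^-1 sO (odd_part x); rewrite xTh opprK -mulr2n -scaler_nat scalerA.
by rewrite mulVf ?scale1r // two_neq0.
Qed.

Theorem proposition4p1 (F : fieldType) (char0 : [pchar F] =i pred0)
    (H : hopfAlg F) (H_cocommutative : cocommutative H) (H_pointed : pointed H)
    (V : orthModule H) (kappa : {linear wedge2 V -> H})
    (hecke_PBW : PBW kappa) (P : pinCover V)
    (n : nat) (b b' : n.-tuple V) (bb' : dual_bases b b')
    (D2 : parthasarathy P (dirac kappa b b')) :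
  let D := dirac kappa b b' in
  exists zeta : {alghom center (hecke kappa) -> center (pin_quot kappa P)},
    forall z : center (hecke kappa),
      (exists2 a, AC_det_odd P a &
         center_val z ⊗ (1 : clifford V)
         = DeltaC' (center_val (zeta z)) + D * a + a * D)
      /\ (forall y : center (pin_quot kappa P),
            (exists2 a, AC_det_odd P a &
               center_val z ⊗ (1 : clifford V)
               = DeltaC' (center_val y) + D * a + a * D) ->
            y = zeta z).
Proof.
move=> D; pose De := tDelta P (hHa kappa); pose Th := tTheta V (hecke kappa).
have DeE k : DeltaC kappa k = De k.
  have hE u : hP P (hHa kappa) u = hecke_H kappa (pin_pi P u) by rewrite hPE hHaE.
  by rewrite /De tDeltaE mklinE; apply: eq_tlift => u v; congr (_ ⊗ _); exact/esym/hE.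
have DE : diracT (tV (hecke_V kappa)) (tC V (hecke kappa)) b b' = D.
  by apply: eq_bigr => i _; rewrite tCE tensM mulr1 mul1r.
have oddE x : @AC_odd _ _ _ kappa x <-> Th x = - x.
  exact: AC_oddP.
have detE a : AC_det_odd P a <-> det_inv De Th true a.
  rewrite -twisted_invariantP //; split=> [[da /oddE oa]|[oa da]].
    split=> // e k ek; rewrite -da // /pin_act; apply: eq_tlift => u v.
    by rewrite !DeE.
  split; last exact/oddE.
  move=> e k ek; rewrite -da // /pin_act; apply: eq_tlift => u v.
  by rewrite !DeE.
have [c0 [k0 [k0e D2E]]] := D2.
have c0C x : center_val c0 * x = x * center_val c0 by have /centralP := valP c0; exact.
have Thk0 : Th (De k0) = De k0.
  by rewrite (tTheta_part char0 (hHa kappa) k0e) expr0 scale1r.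
have symb (I : Type) (s : seq I) (v : I -> V) (h : I -> H) m :
    fil (hecke_V kappa) (hHa kappa) m (\sum_(i <- s) hecke_V kappa (v i) ^+ m * hHa kappa (h i)) ->
    forall xi : {linear V -> F^o}, \sum_(i <- s) (xi (v i) : F) ^+ m *: h i = 0.
  exact: PBW_symbol.
have D2' : diracT (tV (hecke_V kappa)) (tC V (hecke kappa)) b b' *
    diracT (tV (hecke_V kappa)) (tC V (hecke kappa)) b b' = center_val c0 + De k0.
  by rewrite DE D2E DeE.
have ker k : [set k : P | DeltaC kappa k = 0] k <-> De k = 0 by rewrite /= DeE.
have [zeta zP] := dirac_central_map char0 (@hV_linear _ _ _ kappa) (@hHa_V _ _ _ kappa)
  (@hV_comm _ _ _ kappa) (@hecke_fil_exhaust _ _ _ kappa) symb bb' c0C Thk0 D2' ker.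
have zP' z y : (exists2 a, AC_det_odd P a & center_val z ⊗ (1 : clifford V)
    = DeltaC' (center_val y) + D * a + a * D) <-> y = zeta z.
  rewrite -zP; split=> -[a Xa E]; exists a; try exact/detE.
    by rewrite (dirac_odd _ _ _ ((detE a).1 Xa)) DE E /DeltaC' DeE addrA.
  by rewrite E (dirac_odd _ _ _ Xa) DE /DeltaC' DeE addrA.
by exists zeta => z; split=> [|y]; rewrite zP'.
Qed.
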